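(* Under the standing assumptions described in the context, there exists an optimal control $\bar u\in\mathfrak M(\omega_1)$, i.e., a global minimizer of the reduced problem $$\min_{u\in\mathfrak M(\omega_1)} \; J(Su)+\alpha\,\mathrm D^c_{u^0}(u).$$
   Context: For a compact set $X\subset\mathbb R^n$, $\mathfrak M(X)=C(X)^*$ denotes the finite signed Borel measures on $X$ with the total variation norm. $r'$ denotes the conjugate exponent of $r$. Standing assumptions. $d_0\in\mathbb N$, $d_1\in\{2,3\}$; $\Omega\subset\mathbb R^{d_1}$ is a bounded Lipschitz domain; $\omega_0\subset\mathbb R^{d_0}$ and $\omega_1\subset\overline\Omega$ are nonempty compact sets; $u^0\in\mathfrak M(\omega_0)$, $u^0\ge 0$; $c\in C(\omega_0\times\omega_1)$; $\alpha>0$. $p_\Omega>d_1$ is an exponent (provided by Theorem 0.5(a) of Jerison–Kenig 1995) such that for every $p\in(p_\Omega',p_\Omega)$ and every $f\in W^{-1,p}(\Omega)$ the equation $-\Delta y=f$ has a unique solution $y\in W^{1,p}_0(\Omega)$. The exponent $q$ is fixed with $q'\in(d_1,p_\Omega)$ and, if $d_1=3$, additionally $q'<6$. $J:W^{1,q}_0(\Omega)\to\mathbb R$ is continuous and Gâteaux differentiable. The weak Laplacian $\Delta:W^{1,r}_0(\Omega)\to W^{-1,r}(\Omega)=W_0^{1,r'}(\Omega)^*$ is given by $-\langle\Delta y,v\rangle=\int_\Omega\nabla y\cdot\nabla v\,d\lambda^{d_1}$. $E:W^{1,q'}_0(\Omega)\to C(\omega_1)$ is the Sobolev embedding into $C_0(\Omega)\subset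 C(\overline\Omega)$ followed by restriction to $\omega_1$; its adjoint is $E^*:\mathfrak M(\omega_1)\to W^{-1,q}(\Omega)$, $\langle E^*u,v\rangle=\int_{\omega_1}v\,du$. $S:=(-\Delta)^{-1}E^*:\mathfrak M(\omega_1)\to W^{1,q}_0(\Omega)$ is the solution operator of the state equation $-\Delta y=E^*u$. Generalized transportation distance: $\mathrm D^c_{u^0}(u):=\inf\{\int_{\omega_0\times\omega_1}c\,d\pi:\pi\in\mathfrak M(\omega_0\times\omega_1),\ \pi\ge0,\ (P_0)_\#\pi=u^0,\ (P_1)_\#\pi=u\}$, where $P_0,P_1$ are the coordinate projections and $\inf\emptyset=\infty$. *)

(* Defs.v *)
From HB Require Import structures.
From mathcomp Require Import all_boot all_order all_algebra.
From mathcomp Require Import ring_quotient generic_quotient.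
From mathcomp Require Import all_classical all_reals all_analysis.
From mathcomp Require Import measurable_realfun.
Set Implicit Arguments.
Unset Strict Implicit.
Unset Printing Implicit Defensive.
Import Order.TTheory GRing.Theory Num.Theory.
Import numFieldNormedType.Exports.
Local Open Scope classical_set_scope.
Local Open Scope ring_scope.

Section borel_rV.
Context {R : realType} {n : nat}.

HB.instance Definition _ := @isMeasurable.Build
  default_measure_display 'rV[R]_n <<s @open 'rV[R]_n >>
  (@sigma_algebra0 _ setT (@open 'rV[R]_n))
  (@sigma_algebraC _ (@open 'rV[R]_n))
  (@sigma_algebra_bigcup _ setT (@open 'rV[R]_n)).

Lemma open_measurable_rV (A : set 'rV[R]_n) : open A -> measurable A.
Proof. by move=> oA; exact: sub_gen_smallest. Qed.

Lemma closed_measurable_rV (A : set 'rV[R]_n) : closed A -> measurable A.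
Proof.
move=> cA; rewrite -[A]setCK; apply: measurableC.
by apply: open_measurable_rV; exact: closed_openC.
Qed.

Lemma continuous_measurable_rV (f : 'rV[R]_n -> R) :
  continuous f -> measurable_fun setT f.
Proof.
move=> cf; apply: (measurability (@RGenOInfty.G R)).
  exact: RGenOInfty.measurableE.
move=> _ [_ [a ->] <-]; rewrite setTI; apply: open_measurable_rV.
by move/continuousP: cf; apply; exact: rray_open.
Qed.

Lemma measurable_coord (i : 'I_n) :
  measurable_fun setT (fun v : 'rV[R]_n => v ord0 i).
Proof. by apply: continuous_measurable_rV => v; exact: coord_continuous. Qed.

Lemma measurable_fun_rV d (T : measurableType d) (f : T -> 'rV[R]_n) :
  (forall i, measurable_fun setT (fun t => f t ord0 i)) ->
  measurable_fun setT f.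
Proof.
move=> mf; apply: (measurability (@open 'rV[R]_n)) => //.
move=> _ [U oU <-]; rewrite setTI.
pose C (qk : 'rV[rat]_n * nat) : set 'rV[R]_n :=
  [set v | forall i, `|ratr (qk.1 ord0 i) - v ord0 i| < qk.2.+1%:R^-1].
have -> : f @^-1` U = \bigcup_(k in [set: nat])
   (if unpickle k is Some qk then
      if `[< C qk `<=` U >] then f @^-1` C qk else set0 else set0).
  apply/seteqP; split => [t /= Uft|t [k _]]; last first.
    by case: unpickle => // qk; case: asboolP => // CU /= /CU.
  have /nbhs_ballP[e /= e0 eU] : nbhs (f t) U by exact: open_nbhs_nbhs.
  have [k ke] : exists k, (2 * k.+1%:R^-1 : R) < e.
    have [k] := ltr_add_invr (divr_gt0 e0 (ltr0n _ 2)).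
    rewrite add0r => ke; exists k.
    by rewrite mulrC -ltr_pdivlMr.
  have /choice[q qP] : forall i : 'I_n, exists q : rat,
      `|ratr q - f t ord0 i| < k.+1%:R^-1.
    move=> i; have : f t ord0 i - k.+1%:R^-1 < f t ord0 i + k.+1%:R^-1.
      by rewrite ltrBlDr -addrA ltrDl addr_gt0// invr_gt0.
    move=> /rat_in_itvoo[q]; rewrite inE/= => qi.
    by exists q; rewrite distrC ltr_distlC.
  exists (pickle ((\row_i q i : 'rV[rat]_n), k)) => //.
  rewrite pickleK; case: asboolP => [_ i|[]]; first by rewrite /= mxE.
  move=> v /= vC; apply: eU => /=; split => // i j.
  rewrite ord1 /ball/=.
  have := vC j; rewrite mxE => vj.
  rewrite (le_lt_trans _ ke)// mulr_natl mulr2n.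
  rewrite (le_trans (ler_distD (ratr (q j)) _ _))// lerD ?ltW//.
  by rewrite distrC.
apply: bigcupT_measurable => k; case: unpickle => // qk.
case: asboolP => // _.
rewrite (_ : _ @^-1` _ = \bigcap_(i in [set: 'I_n])
   ((fun t => f t ord0 i) @^-1` ball (ratr (qk.1 ord0 i) : R) qk.2.+1%:R^-1)).
  apply: fin_bigcap_measurable => // i _.
  rewrite -[X in measurable X]setTI; apply: mf => //.
  exact: measurable_ball.
by apply/seteqP; split => [t Ct i _|t Ct i]; [exact: Ct|exact: (Ct i I)].
Qed.

End borel_rV.

Section lebesgue_rV.
Context {R : realType}.

Section step.
Context {n : nat} (m : {sigma_finite_measure set 'rV[R]_n -> \bar R}).

Definition cons_rV (z : R * 'rV[R]_n) : 'rV[R]_n.+1 :=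
  \row_i (if unlift ord0 i is Some j then z.2 ord0 j else z.1).

Definition uncons_rV (v : 'rV[R]_n.+1) : R * 'rV[R]_n :=
  (v ord0 ord0, \row_j v ord0 (lift ord0 j)).

Lemma uncons_rVK : cancel uncons_rV cons_rV.
Proof.
move=> v; apply/rowP => i; rewrite /cons_rV /uncons_rV/= !mxE.
by case: unliftP => [j ->|->]; rewrite ?mxE.
Qed.

Lemma cons_rVK : cancel cons_rV uncons_rV.
Proof.
move=> [x v]; rewrite /cons_rV /uncons_rV/= !mxE unlift_none; congr pair.
by apply/rowP => j; rewrite !mxE liftK.
Qed.

Lemma measurable_cons_rV : measurable_fun setT cons_rV.
Proof.
apply: measurable_fun_rV => i; rewrite /cons_rV.
under eq_fun do rewrite mxE.
case: unliftP => [j _|_]; last exact: measurable_fst.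
exact: (measurableT_comp (measurable_coord j) measurable_snd).
Qed.

Lemma measurable_uncons_rV : measurable_fun setT uncons_rV.
Proof.
apply: measurable_fun_pair; first exact: measurable_coord.
apply: measurable_fun_rV => i; under eq_fun do rewrite mxE.
exact: measurable_coord.
Qed.

Definition lebesgue_cons : set 'rV[R]_n.+1 -> \bar R :=
  pushforward (lebesgue_measure \x m)%E cons_rV.

Let lebesgue_cons0 : lebesgue_cons set0 = 0%E.
Proof. by rewrite /lebesgue_cons /pushforward preimage_set0 measure0. Qed.

Let lebesgue_cons_ge0 A : (0 <= lebesgue_cons A)%E.
Proof. by rewrite /lebesgue_cons /pushforward. Qed.

Let lebesgue_cons_sigma_additive : semi_sigma_additive lebesgue_cons.
Proof.
move=> F mF tF mUF; rewrite /lebesgue_cons /pushforward preimage_bigcup.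
apply: measure_semi_sigma_additive.
- by move=> k; rewrite -[X in measurable X]setTI; exact: measurable_cons_rV.
- apply/trivIsetP => /= i j _ _ ij; rewrite -preimage_setI.
  by move/trivIsetP : tF => /(_ _ _ _ _ ij) ->//; rewrite preimage_set0.
- rewrite -preimage_bigcup -[X in measurable X]setTI.
  exact: measurable_cons_rV.
Qed.

HB.instance Definition _ := isMeasure.Build _ _ _ lebesgue_cons
  lebesgue_cons0 lebesgue_cons_ge0 lebesgue_cons_sigma_additive.

Let lebesgue_cons_sigma_finite : sigma_finite setT lebesgue_cons.
Proof.
have /sigma_finiteP[G [TG ndG Goo]] := sigma_finiteT m.
have /sigma_finiteP[F [TF ndF Foo]] := sigma_finiteT (@lebesgue_measure R).
exists (fun k => uncons_rV @^-1` (F k `*` G k)).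
  apply/seteqP; split => // v _.
  have [k _ Fk] : (\bigcup_k F k) (uncons_rV v).1 by rewrite -TF.
  have [l _ Gl] : (\bigcup_k G k) (uncons_rV v).2 by rewrite -TG.
  exists (maxn k l) => //; split.
  - by move: Fk; exact/subsetPset/ndF/leq_maxl.
  - by move: Gl; exact/subsetPset/ndG/leq_maxr.
move=> k; have [mFk Fk] := Foo k; have [mGk Gk] := Goo k.
have mFG : measurable (F k `*` G k) by exact: measurableX.
split.
  by rewrite -[X in measurable X]setTI; exact: measurable_uncons_rV.
rewrite /lebesgue_cons /pushforward -comp_preimage.
rewrite (_ : _ \o _ = id) ?preimage_id; last exact/funext/cons_rVK.
by rewrite product_measure1E// lte_mul_pinfty// ge0_fin_numE.
Qed.

HB.instance Definition _ := @Measure_isSigmaFinite.Build _ _ _ lebesgue_cons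
  lebesgue_cons_sigma_finite.

End step.

Fixpoint lebesgue_rV (n : nat) : {sigma_finite_measure set 'rV[R]_n -> \bar R} :=
  match n with
  | 0 => \d_(0 : 'rV[R]_0)
  | n'.+1 => lebesgue_cons (lebesgue_rV n')
  end.

Definition box_rV n (k : nat) : set 'rV[R]_n :=
  [set v | forall i, v ord0 i \in `[- k%:R, k%:R]].

Lemma measurable_box_rV n k : measurable (@box_rV n k).
Proof.
rewrite (_ : @box_rV n k = \bigcap_(i in [set: 'I_n])
   ((fun t : 'rV[R]_n => t ord0 i) @^-1` [set` `[- k%:R, k%:R] : interval R])).
  apply: fin_bigcap_measurable => // i _.
  by rewrite -[X in measurable X]setTI; exact: measurable_coord.
by apply/seteqP; split => [t Ct i _|t Ct i]; [exact: Ct|exact: (Ct i I)].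
Qed.

Lemma lebesgue_box_rV n k : (lebesgue_rV n (@box_rV n k) < +oo)%E.
Proof.
elim: n => [|n ih] /=.
  by rewrite diracE; case: (_ \in _); rewrite ltry.
rewrite /lebesgue_cons /pushforward.
have -> : cons_rV @^-1` @box_rV n.+1 k =
    [set` `[- k%:R, k%:R] : interval R] `*` @box_rV n k.
  apply/seteqP; split => [[x v] /= xv|[x v] [/= xk vk] i]; last first.
    by rewrite mxE; case: unliftP.
  split; first by have := xv ord0; rewrite mxE unlift_none.
  by move=> j; have := xv (lift ord0 j); rewrite mxE liftK.
rewrite product_measure1E//; last exact: measurable_box_rV.
rewrite [X in (X * _)%E](@lebesgue_measure_itv R `[- k%:R, k%:R])/=.
case: ifPn => _; last by rewrite mul0e ltry.
rewrite -EFinB lte_mul_pinfty// lee_fin opprK.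
Qed.

Lemma lebesgue_compact n (K : set 'rV[R]_n) : compact K ->
  (lebesgue_rV n K < +oo)%E.
Proof.
move=> cK.
have /compact_bounded[M [_ KM]] := cK.
have [k Mk] : exists k : nat, M < k%:R.
  by exists (Num.truncn M).+1; exact: truncnS_gt.
apply: (le_lt_trans _ (lebesgue_box_rV n k)).
apply: le_measure; rewrite ?inE.
- by apply: closed_measurable_rV; apply: compact_closed => //; exact: norm_hausdorff.
- exact: measurable_box_rV.
- move=> v Kv i; have := KM _ Mk v Kv.
  rewrite in_itv/= -ler_norml; apply: le_trans.
  rewrite [leRHS]/Num.norm/= mx_normrE.
  exact: (le_bigmax _ (fun ij => `|v ij.1 ij.2|) (ord0, i)).
Qed.

End lebesgue_rV.

Record seminorm (R : realType) (V : lmodType R) := Seminorm {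
  seminorm_fun :> V -> R ;
  seminormD : forall x y, seminorm_fun (x + y) <= seminorm_fun x + seminorm_fun y ;
  seminormZ : forall a x, seminorm_fun (a *: x) = `|a| * seminorm_fun x }.

Section seminorm_quotient.
Context {R : realType} {V : lmodType R} (N : seminorm V).
Local Open Scope quotient_scope.

Lemma seminorm0 : N 0 = 0.
Proof. by rewrite -(scale0r 0) seminormZ normr0 mul0r. Qed.

Lemma seminormN x : N (- x) = N x.
Proof. by rewrite -scaleN1r seminormZ normrN1 mul1r. Qed.

Lemma seminorm_ge0 x : 0 <= N x.
Proof.
have := seminormD N x (- x).
by rewrite subrr seminorm0 seminormN -mulr2n pmulrn_lge0.
Qed.

Definition seminorm_ker : {pred V} := [pred x | N x == 0].

Lemma seminorm_ker_zmod_closed : zmod_closed seminorm_ker.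
Proof.
split=> [|x y]; rewrite !inE ?seminorm0// => /eqP x0 /eqP y0.
rewrite eq_le seminorm_ge0 andbT.
by rewrite (le_trans (seminormD _ _ _))// seminormN x0 y0 addr0.
Qed.

HB.instance Definition _ := GRing.isZmodClosed.Build V seminorm_ker
  seminorm_ker_zmod_closed.

Definition seminorm_quot : Type := {ideal_quot seminorm_ker}.
HB.instance Definition _ := GRing.Zmodule.on seminorm_quot.
HB.instance Definition _ := EqQuotient.on seminorm_quot.
HB.instance Definition _ := ZmodQuotient.on seminorm_quot.

Local Notation Q := seminorm_quot.

Definition seminorm_class (x : V) : Q := \pi_Q x.

Definition seminorm_repr (x : Q) : V := repr x.

Lemma seminorm_reprK : cancel seminorm_repr seminorm_class.
Proof. by move=> x; exact: reprK. Qed.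

Lemma seminorm_classP x y :
  seminorm_class x = seminorm_class y <-> N (x - y) = 0.
Proof.
split=> [/eqP|xy]; last apply/eqP.
  by rewrite -Quotient.idealrBE => /eqP.
by rewrite -Quotient.idealrBE; apply/eqP.
Qed.

Lemma seminorm_classD x y :
  seminorm_class (x + y) = seminorm_class x + seminorm_class y.
Proof. by rewrite /seminorm_class Quotient.pi_add. Qed.

Let scale (a : R) (x : Q) : Q := seminorm_class (a *: seminorm_repr x).

Let scale_class a x : scale a (seminorm_class x) = seminorm_class (a *: x).
Proof.
apply/seminorm_classP; rewrite -scalerBr seminormZ.
by have /seminorm_classP -> := seminorm_reprK (seminorm_class x); rewrite mulr0.
Qed.

Let scaleA a b x : scale a (scale b x) = scale (a * b) x.
Proof. by rewrite -[x]seminorm_reprK !scale_class scalerA. Qed.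

Let scale1 : left_id 1 scale.
Proof. by move=> x; rewrite -[x]seminorm_reprK scale_class scale1r. Qed.

Let scaleDr : right_distributive scale +%R.
Proof.
move=> a x y; rewrite -[x]seminorm_reprK -[y]seminorm_reprK.
by rewrite -seminorm_classD !scale_class -seminorm_classD scalerDr.
Qed.

Let scaleDl x : {morph scale^~ x : a b / a + b}.
Proof.
move=> a b /=; rewrite -[x]seminorm_reprK.
by rewrite !scale_class -seminorm_classD scalerDl.
Qed.

HB.instance Definition _ := GRing.Zmodule_isLmodule.Build R Q
  scaleA scale1 scaleDr scaleDl.

Lemma seminorm_classZ a x :
  seminorm_class (a *: x) = a *: seminorm_class x.
Proof. by rewrite -scale_class. Qed.

Let norm (x : Q) : R := N (seminorm_repr x).

Let norm_class x : norm (seminorm_class x) = N x.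
Proof.
have h y z : N (y - z) = 0 -> N y <= N z.
  move=> yz; rewrite -{1}(subrK z y) (le_trans (seminormD _ _ _))// yz.
  by rewrite add0r.
have /seminorm_classP xx := seminorm_reprK (seminorm_class x).
apply/eqP; rewrite eq_le; apply/andP.
by split; apply: h => //; rewrite -seminormN opprB.
Qed.

Let normD x y : norm (x + y) <= norm x + norm y.
Proof.
rewrite -[x]seminorm_reprK -[y]seminorm_reprK -seminorm_classD !norm_class.
exact: seminormD.
Qed.

Let normZ a x : norm (a *: x) = `|a| * norm x.
Proof.
by rewrite -[x]seminorm_reprK -seminorm_classZ !norm_class seminormZ.
Qed.

Lemma seminorm_class0 : seminorm_class 0 = 0.
Proof.
by apply: (addrI (seminorm_class 0)); rewrite -seminorm_classD !addr0.
Qed.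

Let norm_eq0 x : norm x = 0 -> x = 0.
Proof.
rewrite -[x]seminorm_reprK norm_class -seminorm_class0 => x0.
by apply/seminorm_classP; rewrite subr0.
Qed.

HB.instance Definition _ := Lmodule_isNormed.Build R Q normD normZ norm_eq0.

Lemma norm_seminorm_class (x : V) : `|seminorm_class x| = N x.
Proof. exact: norm_class. Qed.

End seminorm_quotient.

Record exponent (R : realType) := Exponent {
  exponent_val :> R ;
  exponent_gt1 : 1 < exponent_val }.

Lemma conjugate_gt1 (R : realType) (p : exponent R) : 1 < (p : R) / ((p : R) - 1).
Proof.
have p1 := exponent_gt1 p.
by rewrite ltr_pdivlMr ?subr_gt0// mul1r ltrBlDr ltrDl.
Qed.

Definition conjugate (R : realType) (p : exponent R) : exponent R :=
  Exponent (conjugate_gt1 p).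

Section test_functions.
Context {R : realType} {n : nat}.

Definition partial (i : 'I_n) (f : 'rV[R]_n -> R) : 'rV[R]_n -> R :=
  'D_(delta_mx ord0 i : 'rV[R]_n) f.

(* C^oo: every iterated partial derivative exists and is continuous.           *)
Definition smooth (f : 'rV[R]_n -> R) : Prop :=
  forall s : seq 'I_n, let g := foldr partial f s in
    continuous g /\
    forall x i, derivable g x (delta_mx ord0 i : 'rV[R]_n).

Definition test_function (Omega : set 'rV[R]_n) (f : 'rV[R]_n -> R) : Prop :=
  let supp := closure [set x | f x != 0] in
  [/\ smooth f, compact supp & supp `<=` Omega].

Lemma test_function_continuous Omega f : test_function Omega f -> continuous f.
Proof. by move=> [sf _ _]; have [] := sf [::]. Qed.

Lemma test_function_partial_continuous Omega f i :
  test_function Omega f -> continuous (partial i f).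
Proof. by move=> [sf _ _]; have [] := sf [:: i]. Qed.

Lemma test_function_supp (f : 'rV[R]_n -> R) x : ~ closure [set x | f x != 0] x -> f x = 0.
Proof.
move=> xf; apply: contrapT => /eqP fx; apply: xf.
exact: subset_closure.
Qed.

Lemma partial_supp i (f : 'rV[R]_n -> R) x :
  ~ closure [set x | f x != 0] x -> partial i f x = 0.
Proof.
move=> xf; rewrite /partial (@near_eq_derive _ _ _ f (cst 0)).
- by rewrite derive_cst.
- have oC : open (~` closure [set x | f x != 0]).
    by apply: closed_openC; exact: closed_closure.
  have := open_nbhs_nbhs (conj oC xf).
  by apply: filterS => z /test_function_supp ->.
Qed.

End test_functions.

Section Lp.
Context {R : realType} {n : nat}.
Implicit Types (Omega : set 'rV[R]_n) (y z : 'rV[R]_n -> R) (p : exponent R).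
Local Notation lam := (@lebesgue_rV R n).

(* Functions on Omega are represented by functions on R^n whose values outside *)
(* Omega are irrelevant; f \_ Omega is the extension by zero.                  *)
Definition Lp Omega p y : Prop := y \_ Omega \in Lfun lam (p : R)%:E.

Definition Lp_norm Omega p y : R :=
  fine ('N[lam]_(p : R)%:E [EFin \o (y \_ Omega)])%E.

Let p_ge1 p : (1 <= (p : R)%:E)%E.
Proof. by rewrite lee_fin ltW// exponent_gt1. Qed.

Let restrictD Omega y z : (y + z) \_ Omega = y \_ Omega + z \_ Omega.
Proof.
apply/funext => x; rewrite !fctE/= /patch.
by case: ifPn => //; rewrite addr0.
Qed.

Let restrictZ Omega a y : (a *: y) \_ Omega = a *: (y \_ Omega).
Proof.
apply/funext => x; rewrite !fctE/= /patch.
by case: ifPn => //; rewrite scaler0.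
Qed.

Lemma Lp0 Omega p : Lp Omega p 0.
Proof.
rewrite /Lp (_ : _ \_ _ = 0); first exact: (Lfun_submod_closed lam (p_ge1 p)).1.
by apply/funext => x; rewrite /patch; case: ifP.
Qed.

Lemma LpD Omega p y z : Lp Omega p y -> Lp Omega p z -> Lp Omega p (y + z).
Proof.
rewrite /Lp restrictD => yL zL; rewrite -[y \_ Omega]scale1r.
exact: (Lfun_submod_closed lam (p_ge1 p)).2.
Qed.

Lemma LpZ Omega p a y : Lp Omega p y -> Lp Omega p (a *: y).
Proof.
rewrite /Lp restrictZ => yL; rewrite -[_ *: _]addr0.
apply: (Lfun_submod_closed lam (p_ge1 p)).2 => //.
exact: (Lfun_submod_closed lam (p_ge1 p)).1.
Qed.

Lemma Lp_normD Omega p y z : Lp Omega p y -> Lp Omega p z ->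
  Lp_norm Omega p (y + z) <= Lp_norm Omega p y + Lp_norm Omega p z.
Proof.
rewrite /Lp /Lp_norm restrictD => yL zL.
have := ler_LnormD (Lfun_Sub (p_ge1 p) yL) (Lfun_Sub (p_ge1 p) zL).
by [].
Qed.

Lemma Lp_normZ Omega p a y : Lp Omega p y ->
  Lp_norm Omega p (a *: y) = `|a| * Lp_norm Omega p y.
Proof.
rewrite /Lp /Lp_norm restrictZ => yL.
have := LnormZ (Lfun_Sub (p_ge1 p) yL) a.
rewrite -[X in (_ * X)%E](finite_norm_fine (Lfun_Sub (p_ge1 p) yL)) -EFinM.
by move=> /(congr1 fine).
Qed.

Lemma Lp_integrable_mul Omega p y (psi : 'rV[R]_n -> R) K : Lp Omega p y ->
  continuous psi -> compact K -> (forall x, ~ K x -> psi x = 0) ->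
  lam.-integrable setT (EFin \o ((y \_ Omega) \* psi)).
Proof.
move=> yL cpsi cK psiK.
have p1 := p_ge1 p.
have intK : lam.-integrable setT (EFin \o \1_K).
  have mK : measurable K.
    by apply: closed_measurable_rV; apply: compact_closed => //; exact: norm_hausdorff.
  apply/integrableP; split; first exact/measurable_EFinP.
  rewrite (eq_integral (fun x => (\1_K x)%:E)) ?integral_indic// ?setIT.
    exact: lebesgue_compact.
  by move=> x _; rewrite /= ger0_norm.
have [M [_ HM]] : bounded_set (psi @` K).
  apply: compact_bounded; apply: continuous_compact => //.
  exact: continuous_subspaceT.
have M0 : 0 <= `|M| + 1 by rewrite addr_ge0.
have ypL := Lfun_integrable (ltW (exponent_gt1 p)) yL.
have my : measurable_fun setT (y \_ Omega).
  by move: yL => /andP[/[!inE]].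
apply: (@le_integrable _ _ _ _ _ measurableT _
  (fun x => (`|M| + 1)%:E * ((`|(y \_ Omega) x| `^ p)%:E + (\1_K x)%:E))%E).
- apply/measurable_EFinP; apply: measurable_funM => //.
  exact: continuous_measurable_rV.
- move=> x _; rewrite /= lee_fin.
  rewrite [leRHS]ger0_norm; last by rewrite mulr_ge0// addr_ge0// powR_ge0.
  have [Kx|nKx] := pselect (K x); last first.
    by rewrite psiK// mulr0 normr0 mulr_ge0// addr_ge0// powR_ge0.
  rewrite normrM mulrC ler_pM//.
    apply: HM; last by exists x.
    by rewrite (le_lt_trans (ler_norm _))// ltrDl.
  rewrite indicE mem_set//.
  have [y1|/ltW y1] := leP `|(y \_ Omega) x| 1.
    by rewrite (le_trans y1)// lerDr powR_ge0.
  rewrite -[leLHS]powRr1// (@le_trans _ _ (`|(y \_ Omega) x| `^ p))//.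
    by rewrite ler_powR// ltW// exponent_gt1.
  by rewrite lerDl.
- apply: integrableZl => //.
  exact: integrableD.
Qed.

Lemma Rintegral_test Omega p y z (psi : 'rV[R]_n -> R) K a :
  Lp Omega p y -> Lp Omega p z ->
  continuous psi -> compact K -> (forall x, ~ K x -> psi x = 0) ->
  \int[lam]_(x in Omega) ((a *: y + z) x * psi x) =
  a * (\int[lam]_(x in Omega) (y x * psi x)) +
      \int[lam]_(x in Omega) (z x * psi x).
Proof.
move=> yL zL cpsi cK psiK.
have iy := Lp_integrable_mul yL cpsi cK psiK.
have iz := Lp_integrable_mul zL cpsi cK psiK.
have E (f : 'rV[R]_n -> R) : \int[lam]_(x in Omega) (f x * psi x) =
    \int[lam]_x ((f \_ Omega) x * psi x).
  rewrite Rintegral_mkcond; apply: eq_Rintegral => x _.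
  by rewrite /patch; case: ifP => //; rewrite mul0r.
rewrite !E -RintegralZl// -RintegralD//; last exact: (integrableZl measurableT a iy).
apply: eq_Rintegral => x _.
by rewrite restrictD restrictZ !fctE/= mulrDl mulrA.
Qed.

End Lp.

Section sobolev.
Context {R : realType} {n : nat}.
Variables (Omega : set 'rV[R]_n) (p : exponent R).
Local Notation lam := (@lebesgue_rV R n).

Definition weak_gradient (y : 'rV[R]_n -> R) (g : 'I_n -> 'rV[R]_n -> R) : Prop :=
  forall phi, test_function Omega phi -> forall i,
    \int[lam]_(x in Omega) (y x * partial i phi x) =
    - \int[lam]_(x in Omega) (g i x * phi x).

Definition sobolev_pair :
    {pred ('rV[R]_n -> R) * ('I_n -> 'rV[R]_n -> R)} :=
  [pred w | `[< [/\ Lp Omega p w.1, forall i, Lp Omega p (w.2 i) &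
                   weak_gradient w.1 w.2] >]].

Lemma sobolev_pair_submod_closed : submod_closed sobolev_pair.
Proof.
split.
  apply/asboolP; split=> [|i|phi _ i]; [exact: Lp0..|].
  by rewrite /Rintegral !integral0_eq ?oppr0//= => x _; rewrite mul0r.
move=> a [y g] [z h] /asboolP[/= yL gL yg] /asboolP[/= zL hL zh].
apply/asboolP; split=> /= [|i|phi tphi i].
- by apply: LpD => //; exact: LpZ.
- by apply: LpD => //; exact: LpZ.
- have [_ cK _] := tphi.
  have cphi := test_function_continuous tphi.
  have cdphi := @test_function_partial_continuous _ _ _ _ i tphi.
  rewrite (Rintegral_test _ yL zL cdphi cK (@partial_supp _ _ i _)).
  rewrite (Rintegral_test _ (gL i) (hL i) cphi cK (@test_function_supp _ _ _)).
  by rewrite yg// zh// mulrN opprD.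
Qed.

HB.instance Definition _ := GRing.isSubmodClosed.Build R _ sobolev_pair
  sobolev_pair_submod_closed.

(* A function in W^{1,p}(Omega) together with its weak gradient; both are only *)
(* determined almost everywhere, so W^{1,p}(Omega) is the quotient [sobolev];  *)
(* [sobolev0] is W^{1,p}_0(Omega).                                             *)
Record sobolev_fun := SobolevFun {
  sobolev_fun_val :> ('rV[R]_n -> R) * ('I_n -> 'rV[R]_n -> R) ;
  sobolev_funP : sobolev_fun_val \in sobolev_pair }.

HB.instance Definition _ := [isSub for sobolev_fun_val].
HB.instance Definition _ := [Choice of sobolev_fun by <:].
HB.instance Definition _ := [SubChoice_isSubLmodule of sobolev_fun by <:].

(* Sum norm, equivalent to (||y||_p^p + \sum_i ||d_i y||_p^p)^(1/p).           *)
Definition sobolev_norm (w : sobolev_fun) : R :=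
  Lp_norm Omega p w.1 + \sum_(i < n) Lp_norm Omega p (w.2 i).

Lemma sobolev_normD v w :
  sobolev_norm (v + w) <= sobolev_norm v + sobolev_norm w.
Proof.
move: v w => [[y g] yg] [[z h] zh]; rewrite /sobolev_norm/=.
have /asboolP[/= yL gL _] := yg; have /asboolP[/= zL hL _] := zh.
rewrite addrACA -big_split/= lerD ?Lp_normD// ler_sum// => i _.
exact: Lp_normD.
Qed.

Lemma sobolev_normZ a w : sobolev_norm (a *: w) = `|a| * sobolev_norm w.
Proof.
move: w => [[y g] yg]; rewrite /sobolev_norm/=.
have /asboolP[/= yL gL _] := yg.
rewrite mulrDr mulr_sumr Lp_normZ//; congr (_ + _).
by apply: eq_bigr => i _; exact: Lp_normZ.
Qed.

Definition sobolev_seminorm : seminorm sobolev_fun :=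
  Seminorm sobolev_normD sobolev_normZ.

Definition sobolev : normedModType R := seminorm_quot sobolev_seminorm.

(* The classes of test functions, with their classical gradient.               *)
Definition test_class : set sobolev :=
  [set w | exists2 v : sobolev_fun, w = seminorm_class _ v &
    test_function Omega v.1 /\ v.2 = partial^~ v.1].

Definition sobolev0_pred : {pred sobolev} := mem (closure test_class).

End sobolev.

Section test_functions_linear.
Context {R : realType} {n : nat}.
Implicit Types (f g : 'rV[R]_n -> R) (Omega : set 'rV[R]_n).

Lemma smooth_linear a f g : smooth f -> smooth g ->
  smooth (a *: f + g) /\
  forall s, foldr partial (a *: f + g) s =
            a *: foldr partial f s + foldr partial g s.
Proof.
move=> sf sg.
have E s : foldr partial (a *: f + g) s =
    a *: foldr partial f s + foldr partial g s.
  elim: s => //= i s ->.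
  have [_ df] := sf s; have [_ dg] := sg s.
  apply/funext => x; rewrite /partial deriveD//; last exact: derivableZ.
  by rewrite deriveZ.
split=> // s; rewrite E; have [cf df] := sf s; have [cg dg] := sg s; split.
  move=> x; exact: (continuousD (continuousZl_tmp (k := a) (cf x)) (cg x)).
by move=> x i; apply: derivableD; [exact: derivableZ|exact: dg].
Qed.

Lemma smooth0 : smooth (0 : 'rV[R]_n -> R).
Proof.
have E (s : seq 'I_n) : foldr partial (0 : 'rV[R]_n -> R) s = 0.
  by elim: s => //= i s ->; apply/funext => x; rewrite /partial derive_cst.
move=> s; rewrite /= E; split=> [x|x i]; last exact: derivable_cst.
exact: (@cst_continuous _ _ (0 : R)).
Qed.

Lemma test_function0 Omega : test_function Omega (0 : 'rV[R]_n -> R).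
Proof.
split; first exact: smooth0.
- rewrite (_ : [set _ | _] = set0) ?closure0; first exact: compact0.
  by apply/seteqP; split => // x /=; rewrite eqxx.
- rewrite (_ : [set _ | _] = set0) ?closure0//.
  by apply/seteqP; split => // x /=; rewrite eqxx.
Qed.

Lemma test_function_linear Omega a f g :
  test_function Omega f -> test_function Omega g ->
  test_function Omega (a *: f + g).
Proof.
move=> [sf cf fO] [sg cg gO].
have sub : closure [set x | (a *: f + g) x != 0] `<=`
    closure [set x | f x != 0] `|` closure [set x | g x != 0].
  rewrite -closureU; apply: closure_subset => x /= fgx.
  apply: contrapT => /not_orP[/negP/negPn/eqP fx /negP/negPn/eqP gx].
  by move: fgx; rewrite !fctE/= fx gx scaler0 addr0 eqxx.
split; first by have [] := smooth_linear a sf sg.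
- apply: (subclosed_compact _ (compactU cf cg) sub); exact: closed_closure.
- by apply: (subset_trans sub) => x [/fO|/gO].
Qed.

End test_functions_linear.

Section sobolev0.
Context {R : realType} {n : nat}.
Variables (Omega : set 'rV[R]_n) (p : exponent R).

Lemma test_class_linear a (v w : sobolev Omega p) :
  test_class v -> test_class w -> test_class (a *: v + w).
Proof.
move=> [f -> [tf ff]] [g -> [tg gg]].
exists (a *: f + g).
  by rewrite seminorm_classD seminorm_classZ.
rewrite /=; split; first exact: test_function_linear.
have [sf _ _] := tf; have [sg _ _] := tg.
have [_ E] := smooth_linear a sf sg.
apply/funext => i; rewrite [RHS](E [:: i]) /=.
have -> : partial i f.1 = f.2 i by rewrite ff.
by have -> : partial i g.1 = g.2 i by rewrite gg.
Qed.

Lemma sobolev0_submod_closed : submod_closed (@sobolev0_pred R n Omega p).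
Proof.
split.
  apply/mem_set/subset_closure; exists 0; first by rewrite seminorm_class0.
  split; first exact: test_function0.
  by apply/funext => i; apply/funext => x; rewrite /= /partial derive_cst.
move=> a v w /set_mem cv /set_mem cw; apply/mem_set => B.
have c : continuous (fun z : sobolev Omega p * sobolev Omega p => a *: z.1 + z.2).
  move=> z; exact: (cvgD (cvgZl_tmp (k := a) cvg_fst) cvg_snd).
move=> /(c (v, w)) [[U V] /= [Uv Vw] UV].
have [x [tx Ux]] := cv _ Uv; have [y [ty Vy]] := cw _ Vw.
exists (a *: x + y); split; first exact: test_class_linear.
exact: (UV (x, y)).
Qed.

HB.instance Definition _ := GRing.isSubmodClosed.Build R _
  (@sobolev0_pred R n Omega p) sobolev0_submod_closed.

Record sobolev0 := Sobolev0 {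
  sobolev0_val :> sobolev Omega p ;
  sobolev0P : sobolev0_val \in @sobolev0_pred R n Omega p }.

HB.instance Definition _ := [isSub for sobolev0_val].
HB.instance Definition _ := [Choice of sobolev0 by <:].
HB.instance Definition _ := [SubChoice_isSubLmodule of sobolev0 by <:].

Let norm (w : sobolev0) : R := `|sobolev0_val w|.

Let normD v w : norm (v + w) <= norm v + norm w.
Proof. exact: ler_normD. Qed.

Let normZ a w : norm (a *: w) = `|a| * norm w.
Proof. exact: normrZ. Qed.

Let norm_eq0 w : norm w = 0 -> w = 0.
Proof. by move=> /normr0_eq0 w0; exact: val_inj. Qed.

HB.instance Definition _ :=
  Lmodule_isNormed.Build R sobolev0 normD normZ norm_eq0.

Lemma sobolev0_normE (w : sobolev0) : `|w| = `|sobolev0_val w|.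
Proof. by []. Qed.

(* Representatives of an element and of its gradient, unique up to a null set. *)
Definition sobolev_value (w : sobolev0) : 'rV[R]_n -> R :=
  (sobolev_fun_val (seminorm_repr (sobolev0_val w))).1.

Definition sobolev_grad (w : sobolev0) : 'I_n -> 'rV[R]_n -> R :=
  (sobolev_fun_val (seminorm_repr (sobolev0_val w))).2.

End sobolev0.

Section lipschitz_domain.
Context {R : realType} {n : nat}.

(* Near each boundary point and in suitable orthonormal coordinates, Omega is *)
(* the part of space above the graph of a Lipschitz function of the remaining *)
(* n - 1 coordinates.                                                         *)
Definition lipschitz_boundary (Omega : set 'rV[R]_n) : Prop :=
  forall x0, (closure Omega `\` Omega) x0 ->
  exists (Q : 'M[R]_n) (k : 'I_n) (L : R) (phi : 'rV[R]_n.-1 -> R),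
    [/\ Q *m Q^T = 1%:M, L.-lipschitz phi &
        \forall x \near x0,
          Omega x <-> phi (col' k (x *m Q)) < (x *m Q) ord0 k].

Definition bounded_lipschitz_domain (Omega : set 'rV[R]_n) : Prop :=
  [/\ open Omega, connected Omega, Omega !=set0, bounded_set Omega &
      lipschitz_boundary Omega].

End lipschitz_domain.

Definition carried_by d (T : measurableType d) (R : realType) (X : set T)
    (mu : set T -> \bar R) : Prop :=
  forall A, measurable A -> A `<=` ~` X -> mu A = 0%E.

(* Finite signed Borel measures on X, as signed measures on the ambient space *)
(* that are carried by X.                                                     *)
Record signed_measure d (T : measurableType d) (R : realType) (X : set T) :=
  SignedMeasure {
    signed_measure_val :> {charge set T -> \bar R} ;
    signed_measureP : carried_by X signed_measure_val }.

Section charge_integral.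
Context d (T : measurableType d) (R : realType).
Variable nu : {charge set T -> \bar R}.

Definition charge_hahn : {PN : set T * set T | hahn_decomposition nu PN.1 PN.2} :=
  cid (let: ex_intro P (ex_intro N PN) := Hahn_decomposition nu in
       ex_intro (fun PN => hahn_decomposition nu PN.1 PN.2) (P, N) PN).

Definition charge_pos : {measure set T -> \bar R} :=
  jordan_pos (proj2_sig charge_hahn).

Definition charge_neg : {measure set T -> \bar R} :=
  jordan_neg (proj2_sig charge_hahn).

(* Integral with respect to a signed measure, by its Jordan decomposition,     *)
(* which does not depend on the chosen Hahn decomposition.                     *)
Definition charge_integral (D : set T) (f : T -> R) : R :=
  \int[charge_pos]_(x in D) f x - \int[charge_neg]_(x in D) f x.

End charge_integral.

Section state_equation.
Context {R : realType} {n : nat} (Omega : set 'rV[R]_n).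

Definition neg_laplacian (p : exponent R) (y : sobolev0 Omega p)
    (v : sobolev0 Omega (conjugate p)) : R :=
  \int[lebesgue_rV n]_(x in Omega)
    \sum_(i < n) sobolev_grad y i x * sobolev_grad v i x.

Definition weak_solution (p : exponent R)
    (f : sobolev0 Omega (conjugate p) -> R) (y : sobolev0 Omega p) : Prop :=
  forall v, neg_laplacian y v = f v.

(* For bounded open Omega, functions of C_0(Omega) are identified with the     *)
(* continuous functions on R^n that vanish outside Omega.                      *)
Definition C0_representative (p : exponent R) (v : sobolev0 Omega p)
    (w : 'rV[R]_n -> R) : Prop :=
  [/\ continuous w, forall x, ~ Omega x -> w x = 0 &
      {ae lebesgue_rV n, forall x, Omega x -> w x = sobolev_value v x}].

(* The representative is unique when Omega is open; by Sobolev's embedding     *)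
(* theorem it exists for bounded Omega and p > n (0 is a junk value).          *)
Definition embedding (p : exponent R) (v : sobolev0 Omega p) : 'rV[R]_n -> R :=
  xget 0 [set w | C0_representative v w].

Definition embedding_adjoint (q : exponent R) (omega1 : set 'rV[R]_n)
    (u : signed_measure R omega1) (v : sobolev0 Omega (conjugate q)) : R :=
  charge_integral u omega1 (embedding v).

(* 0 is a junk value: the solution exists and is unique as soon as the         *)
(* Dirichlet problem is uniquely solvable in W^{1,q}_0(Omega).                 *)
Definition solution_operator (q : exponent R) (omega1 : set 'rV[R]_n)
    (u : signed_measure R omega1) : sobolev0 Omega q :=
  xget 0 [set y | weak_solution (embedding_adjoint u) y].

End state_equation.

Section transport.
Context {R : realType} {d0 d1 : nat}.
Variables (omega0 : set 'rV[R]_d0) (omega1 : set 'rV[R]_d1).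
Variable c : 'rV[R]_d0 * 'rV[R]_d1 -> R.

Definition coupling (u0 : set 'rV[R]_d0 -> \bar R) (u : set 'rV[R]_d1 -> \bar R) :
    set {finite_measure set ('rV[R]_d0 * 'rV[R]_d1)%type -> \bar R} :=
  [set pi | [/\ carried_by (omega0 `*` omega1) pi,
    forall A, measurable A -> pushforward pi fst A = u0 A &
    forall A, measurable A -> pushforward pi snd A = u A]].

Definition transport_distance (u0 : set 'rV[R]_d0 -> \bar R)
    (u : set 'rV[R]_d1 -> \bar R) : \bar R :=
  ereal_inf [set (\int[pi]_(z in omega0 `*` omega1) (c z)%:E)%E
            | pi in coupling u0 u].

End transport.

Definition gateaux_differentiable (R : realType) (V : normedModType R)
    (J : V -> R) : Prop :=
  forall y, exists2 A : {linear V -> R},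
    continuous A & forall h, is_derive y h J (A h).

(* Main.v *)
(* The functional is minimized over pairs of a control [u] and a coupling [pi] *)
(* of [u0] and [u]; if there are none, it is infinite everywhere. All couplings *)
(* have the total mass of [u0], so Skorokhod's theorem represents a            *)
(* subsequence of a minimizing sequence by maps that converge almost           *)
(* everywhere on an interval. The law of the limit map is a coupling [pi] with *)
(* second marginal [u], and the transport costs converge by dominated          *)
(* convergence. As the embedded test functions are uniformly Hoelder           *)
(* continuous (Morrey, [conjugate q > d1]), the data [embedding_adjoint u_k]   *)
(* converge in the dual norm. The solution operator is bounded for that norm:  *)
(* solving the adjoint equation, at the exponent [conjugate q], shows that it  *)
(* is weakly bounded, and weakly bounded sets are bounded. So the states       *)
(* converge strongly, and continuity of [J] suffices.                          *)

From HB Require Import structures.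
Require Import Defs.
From mathcomp Require Import all_boot all_order all_algebra.
From mathcomp Require Import all_classical all_reals all_analysis.
From mathcomp Require Import measurable_realfun.
From mathcomp Require Import ring lra.
Set Implicit Arguments.
Unset Strict Implicit.
Unset Printing Implicit Defensive.
Import Order.TTheory GRing.Theory Num.Theory.
Import numFieldNormedType.Exports.
Local Open Scope classical_set_scope.
Local Open Scope ring_scope.

(** * Weakly bounded sets are bounded *)

(** The direct method applies to pairs [(u, pi)] rather than to controls, since compactness comes
    from the couplings: they all have the mass of [u0] and live on one compact product.
    [coupling_compactness] extracts a limit pair with converging costs and, decisively, with an
    error for the integrals of test functions that depends only on their Hoelder constant. By
    Morrey's inequality ([embedding_hoelder]) this constant is controlled by the Sobolev norm, so
    the right-hand sides converge uniformly on bounded sets of test functions.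

    [solution_operator_lipschitz] turns this into norm convergence of the states. It rests on
    [adjoint_solvable] and on [weakly_bounded_bounded], which in turn rests on Hahn-Banach. The
    objective thus converges along a subsequence of any sequence of pairs, so [attains_min] yields a
    minimal pair. Its control is optimal because the transport distance is the infimum of the cost
    over couplings. *)

Lemma linear_pack (R : realType) (V : lmodType R) (g : V -> R) :
  (forall a x y, g (a *: x + y) = a * g x + g y) ->
  exists G : {linear V -> R}, G =1 g.
Proof.
move=> glin.
have glin' : linear (g : V -> R^o) by move=> a x y; rewrite glin.
pose G : {linear V -> R} := HB.pack_for {linear V -> R} (g : V -> R)
  (GRing.isLinear.Build R V R *:%R g glin').
by exists G.
Qed.

Section hahn_banach.
Context {R : realType} {V : normedModType R}.
Implicit Types G : set (V * R).

(** Partial functionals are represented by their graphs, so that extension is inclusion and Zorn's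
    lemma applies to unions. *)
Let dominated_linear G :=
  (forall a u v, G u -> G v -> G (a *: u.1 + v.1, a * u.2 + v.2)) /\
  (forall v, G v -> v.2 <= `|v.1|).

Let line (x : V) : set (V * R) := [set z | exists a, z = (a *: x, a * `|x|)].

Let dominated_line x : dominated_linear (line x).
Proof.
split=> [a _ _ [b ->] [c ->]|_ [b ->]] /=.
  by exists (a * b + c); rewrite scalerDl mulrDl scalerA mulrA.
by rewrite normrZ ler_wpM2r// ler_norm.
Qed.

(** The value [c] in the new direction [w] has to lie above every [u.2 - |u.1 - w|] and below every
    [|v.1 + w| - v.2]. The triangle inequality separates the two families, and the supremum of the
    first is a possible choice. Dividing by [|t|] reduces domination to [t = 1] and [t = -1]. *)
Let dominated_extend G w : G !=set0 -> dominated_linear G ->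
  exists c, dominated_linear
    [set z | exists t u, G u /\ z = (u.1 + t *: w, u.2 + t * c)].
Proof.
move=> [u0 Gu0] [Glin Gdom].
have GZ a u : G u -> G (a *: u.1, a * u.2).
  move=> Gu; have := Glin a _ _ Gu (Glin (-1) _ _ Gu0 Gu0).
  by rewrite /= !scaleN1r !mulN1r !addNr !addr0.
have sep u v : G u -> G v -> u.2 - `|u.1 - w| <= `|v.1 + w| - v.2.
  move=> Gu Gv; have := Gdom _ (Glin 1 _ _ Gv Gu); rewrite /= scale1r mul1r.
  have := ler_normD (v.1 + w) (u.1 - w); rewrite addrACA subrr addr0.
  by move=> h1 h2; lra.
pose S := [set u.2 - `|u.1 - w| | u in G].
have Sub v : G v -> ubound S (`|v.1 + w| - v.2).
  by move=> Gv _ [u Gu <-]; exact: sep.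
have S0 : S !=set0 by exists (u0.2 - `|u0.1 - w|), u0.
have hS : has_sup S by split=> //; exists (`|u0.1 + w| - u0.2); exact: Sub.
have le1 u : G u -> u.2 - `|u.1 - w| <= sup S.
  by move=> Gu; apply: ub_le_sup; [exact: hS.2|exists u].
have le2 u : G u -> sup S <= `|u.1 + w| - u.2.
  by move=> Gu; apply: ge_sup => //; exact: Sub.
exists (sup S); split=> [a _ _ [t [u [Gu ->]]] [s [v [Gv ->]]]|_ [t [u [Gu ->]]]] /=.
  exists (a * t + s), (a *: u.1 + v.1, a * u.2 + v.2); split; first exact: Glin.
  congr pair => /=; last by ring.
  by rewrite scalerDr scalerDl scalerA addrACA.
have [t0|t0|->] := ltgtP t 0; last first.
- by rewrite scale0r mul0r !addr0; exact: Gdom.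
- have := le2 _ (GZ t^-1 _ Gu); rewrite /= => h.
  have -> : u.1 + t *: w = t *: (t^-1 *: u.1 + w).
    by rewrite scalerDr scalerA divff ?scale1r// gt_eqF.
  rewrite normrZ gtr0_norm// -(ler_pM2l t0) in h *.
  rewrite mulrBr mulrA divff ?gt_eqF// mul1r in h; lra.
- have := le1 _ (GZ (- t)^-1 _ Gu); rewrite /= => h.
  have -> : u.1 + t *: w = (- t) *: ((- t)^-1 *: u.1 - w).
    rewrite scalerBr scalerA divff ?oppr_eq0 ?lt_eqF// scale1r scaleNr opprK.
    by [].
  have t0' : 0 < - t by rewrite oppr_gt0.
  rewrite normrZ gtr0_norm// -(ler_pM2l t0') in h *.
  rewrite mulrBr mulrA divff ?gt_eqF// mul1r in h; lra.
Qed.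

Lemma hahn_banach_norming (x : V) :
  exists g : {linear V -> R}, (forall y, `|g y| <= `|y|) /\ g x = `|x|.
Proof.
(* Zorn's lemma also asks for the union of the empty chain, so [P] must admit the empty graph;
   maximality rules it out afterwards. *)
pose P G := dominated_linear G /\ (G !=set0 -> line x `<=` G).
have [F FP totF|A [[[Alin Adom] Aline] Amax]] := @Zorn_bigcup _ P.
  split; [split|].
  - move=> a u v [G1 FG1 G1u] [G2 FG2 G2v].
    have [s12|s21] := totF _ _ FG1 FG2.
    + by exists G2 => //; have [[h _] _] := FP _ FG2; apply: h => //; exact: s12.
    + by exists G1 => //; have [[h _] _] := FP _ FG1; apply: h => //; exact: s21.
  - by move=> v [G FG Gv]; have [[_ +] _] := FP _ FG; exact.
  - move=> [u [G FG Gu]] z lz; exists G => //.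
    by have [_ +] := FP _ FG; apply => //; exists u.
have Ax : line x `<=` A.
  apply: contrapT => nA; apply: (Amax (line x)).
    split=> [z Az|sub]; first by exfalso; apply: nA; apply: Aline; exists z.
    by apply: nA => z lz; apply: sub.
  by split=> [|_ z]; [exact: dominated_line|].
have A0 : A !=set0 by exists (1 *: x, 1 * `|x|); apply: Ax; exists 1.
have tot w : exists r, A (w, r).
  have [c Bdom] := dominated_extend w A0 (conj Alin Adom).
  set B := (X in dominated_linear X) in Bdom.
  have AB : A `<=` B.
    by move=> [u r] Au; exists 0, (u, r); rewrite scale0r mul0r !addr0.
  have BA : B `<=` A.
    apply: contrapT => nBA; apply: (Amax B) => //.
    by split=> // _; exact: (subset_trans Ax).
  have A00 : A (0, 0) by apply: Ax; exists 0; rewrite scale0r mul0r.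
  exists c; apply: BA; exists 1, (0, 0); split=> //=.
  by rewrite scale1r mul1r !add0r.
have [g gA] := choice tot.
have A00 : A (0, 0) by apply: Ax; exists 0; rewrite scale0r mul0r.
have AN u r : A (u, r) -> A (- u, - r).
  by move=> Au; have := Alin (-1) _ _ Au A00; rewrite /= scaleN1r mulN1r !addr0.
(* Two values at [u] put [(0, r - s)] into [A], where domination by [|0|] applies. *)
have uniq u r s : A (u, r) -> A (u, s) -> r = s.
  move=> Ar As; apply/eqP; rewrite eq_le -[_ <= _]subr_le0 -[s <= r]subr_le0.
  have h a b : A (u, a) -> A (u, b) -> a - b <= 0.
    move=> Aa /AN Ab; have := Adom _ (Alin 1 _ _ Aa Ab).
    by rewrite /= scale1r mul1r subrr normr0.
  by rewrite !h.
have glin a u v : g (a *: u + v) = a * g u + g v.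
  apply: uniq (gA _) _; exact: (Alin a _ _ (gA u) (gA v)).
have [G GE] := linear_pack glin.
exists G; split=> [y|]; rewrite GE.
  rewrite ler_norml -[_ <= g y]lerN2 opprK.
  have /= -> := Adom _ (gA y); rewrite andbT.
  by have := Adom _ (AN _ _ (gA y)); rewrite /= normrN.
by apply: uniq (gA _) _; apply: Ax; exists 1; rewrite scale1r mul1r.
Qed.

End hahn_banach.

(** With [e n] the tail of the geometric series, [u + e] decreases, [u - e] increases, and [e] tends
    to 0. The common limit is trapped between them, which gives the error bound as well. *)
Lemma geometric_increments_cvg (R : realType) (u : R^nat) (C rho : R) :
  0 <= rho < 1 -> (forall n, `|u n.+1 - u n| <= C * rho ^+ n) ->
  exists l, u @ \oo --> l /\
    forall n, `|u n - l| <= C * rho ^+ n / (1 - rho).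
Proof.
move=> /andP[rho0 rho1] uC.
pose e n := C * rho ^+ n / (1 - rho).
have r1 : 1 - rho != 0 by rewrite subr_eq0 eq_sym lt_eqF.
have eS n : e n - e n.+1 = C * rho ^+ n by rewrite /e exprS; field.
have vS n : u n.+1 + e n.+1 <= u n + e n.
  by have := uC n; rewrite ler_norml -eS => /andP[_ h]; lra.
have wS n : u n - e n <= u n.+1 - e n.+1.
  by have := uC n; rewrite ler_norml -eS => /andP[h _]; lra.
have e0 : e @ \oo --> 0.
  rewrite -[X in _ --> X](mul0r (1 - rho)^-1) -[X in X * _](mulr0 C).
  apply: cvgMl; apply: cvgMr; apply: cvg_expr.
  by rewrite ger0_norm.
have e_ge0 n : 0 <= e n.
  by apply: divr_ge0; [exact: le_trans (uC n)|rewrite subr_ge0 ltW].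
have vn : nonincreasing_seq (u \+ e) by apply/nonincreasing_seqP => n; exact: vS.
have wn : nondecreasing_seq (u \- e) by apply/nondecreasing_seqP => n; exact: wS.
have cv : cvgn (u \+ e).
  apply: nonincreasing_is_cvgn => //; exists (u 0%N - e 0%N) => _ [n _ <-].
  have := wn 0%N n (leq0n n); rewrite /= => h; have := e_ge0 n; lra.
have ul : u @ \oo --> limn (u \+ e).
  rewrite -[X in X @ _](_ : (u \+ e) \- e = _); last first.
    by apply/funext => n /=; rewrite addrK.
  by rewrite -[X in _ --> X]subr0; exact: cvgB.
exists (limn (u \+ e)); split=> // n.
have h1 := nonincreasing_cvgn_ge vn cv n.
have wl : (u \- e) @ \oo --> limn (u \+ e).
  by rewrite -[X in _ --> X]subr0; exact: cvgB.
have cw : cvgn (u \- e) by apply/cvg_ex; eexists; exact: wl.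
have := nondecreasing_cvgn_le wn cw n; rewrite (cvg_lim _ wl)//= => h2.
rewrite ler_norml; move: h1 => /= h1; rewrite -/(e n).
by apply/andP; split; lra.
Qed.

Lemma le_half_expn_le0 (R : realType) (x c : R) : (forall k, x <= c * 2^-1 ^+ k) -> x <= 0.
Proof.
move=> h; have c0 : (fun k => c * 2^-1 ^+ k) @ \oo --> c * 0.
  apply: cvgMr; apply: cvg_expr.
  by rewrite ger0_norm ?invr_ge0// invf_lt1 ?ltr1n.
rewrite mulr0 in c0.
by apply: (ler_cvg_to (cvg_cst x) c0); apply: nearW.
Qed.

Lemma lipschitz_linear_continuous (R : realType) (V : normedModType R)
  (g : {linear V -> R}) C : (forall x, `|g x| <= C * `|x|) -> continuous g.
Proof.
move=> gC; apply: bounded_linear_continuous; apply/bounded_funP => r.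
exists (`|C| * r) => x xr; rewrite (le_trans (gC x))//.
by rewrite (le_trans (ler_norm _))// normrM normr_id ler_wpM2l.
Qed.

(* Sokal's gliding hump: the signs keep each partial sum large at the next     *)
(* point, and the geometric tail is too small to cancel it.                    *)
Lemma weakly_bounded_bounded (R : realType) (V : normedModType R) (S : set V) :
  (forall g : {linear V -> R}, continuous g ->
    exists M, forall y, S y -> `|g y| <= M) ->
  exists M, forall y, S y -> `|y| <= M.
Proof.
move=> wb; apply: contrapT => nb.
(* The choice of signs gives [|s n.+1 (y n)| >= |y n| / 3 ^ n], and the remaining tail is at most
   half of this. Hence [|L (y n)| >= |y n| / (2 * 3 ^ n)], which the threshold makes larger than
   [n]. *)
have /choice[y yP] : forall n : nat, exists y, S y /\ 2 * n%:R * 3 ^+ n < `|y|.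
  move=> n; apply: contrapT => h; apply: nb; exists (2 * n%:R * 3 ^+ n) => y Sy.
  by rewrite leNgt; apply/negP => hy; apply: h; exists y.
have /choice[g gP] : forall n, exists g : {linear V -> R},
    (forall z, `|g z| <= `|z|) /\ g (y n) = `|y n|.
  by move=> n; exact: hahn_banach_norming.
pose e (s : V -> R) n : R := if 0 <= s (y n) then 1 else -1.
pose fix s n : V -> R :=
  if n is m.+1 then fun z => s m z + e (s m) m * (3^-1 ^+ m * g m z) else cst 0.
have slin n a u v : s n (a *: u + v) = a * s n u + s n v.
  elim: n => [|n ih] /=; first by rewrite mulr0 addr0.
  have -> : g n (a *: u + v) = a * g n u + g n v by rewrite linearP.
  by rewrite ih; ring.
have e1 t n : `|e t n| = 1 by rewrite /e; case: ifP; rewrite ?normrN normr1.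
have sS z n : `|s n.+1 z - s n z| <= `|z| * 3^-1 ^+ n.
  rewrite /= addrC addKr normrM e1 mul1r normrM ger0_norm ?exprn_ge0//.
  by rewrite mulrC ler_wpM2r ?exprn_ge0//; have [] := gP n.
have r3 : 0 <= (3^-1 : R) < 1 by lra.
have /choice[G GP] : forall z, exists l, (s ^~ z) @ \oo --> l /\
    forall n, `|s n z - l| <= `|z| * 3^-1 ^+ n / (1 - 3^-1).
  by move=> z; apply: geometric_increments_cvg => // n; exact: sS.
have Glin a u v : G (a *: u + v) = a * G u + G v.
  have [h _] := GP (a *: u + v); have [hu _] := GP u; have [hv _] := GP v.
  rewrite -(cvg_lim _ h)//; apply: cvg_lim => //.
  under eq_fun do rewrite slin.
  by apply: cvgD => //; exact: cvgMr.
have [L LE] := linear_pack Glin.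
have r32 : (1 - 3^-1 : R)^-1 = 3 / 2 by field.
have Lb z : `|L z| <= 2 * `|z|.
  have [_ /(_ 0%N)] := GP z; rewrite LE /= sub0r normrN expr0 r32; have := normr_ge0 z; lra.
have Lc : continuous L by exact: lipschitz_linear_continuous Lb.
have [M hM] := wb L Lc.
have [n nM] : exists n : nat, M < n%:R by exists (Num.truncn M).+1; exact: truncnS_gt.
have [Sy yn] := yP n; have := hM _ Sy.
apply/negP; rewrite -ltNge (lt_le_trans nM)//.
have [_ gn] := gP n.
have h1 : 3^-1 ^+ n * `|y n| <= `|s n.+1 (y n)|.
  rewrite /= gn /e; set a := s n (y n); set b := _ * `|_|.
  have b0 : 0 <= b by rewrite mulr_ge0// exprn_ge0//.
  case: ifPn => [a0|]; first by rewrite ger0_norm; lra.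
  rewrite -ltNge => a0; rewrite ler0_norm; lra.
have [_ /(_ n.+1)] := GP (y n); rewrite -LE exprS r32 => h2.
have h3 : n%:R * 2 <= 3^-1 ^+ n * `|y n|.
  rewrite exprVn ler_pdivlMl ?exprn_gt0//; move: yn => /ltW; congr (_ <= _); ring.
have h4 : `|s n.+1 (y n)| <= `|L (y n)| + `|s n.+1 (y n) - L (y n)|.
  by rewrite -{1}[s n.+1 (y n)](subrKC (L (y n))) ler_normD.
lra.
Qed.

(** * Lebesgue measure on row vectors *)

Section lebesgue_translation.
Context {R : realType}.
Local Notation leb := (@lebesgue_rV R).

Lemma lebesgue_measure_translation (a : R) A : measurable A ->
  pushforward lebesgue_measure (+%R^~ a : _ -> measurableTypeR R) A =
  lebesgue_measure A.
Proof.
move=> mA; apply/esym/lebesgue_measure_unique => //=.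
  by move=> _; apply: measurable_funD.
move=> mf _ [[x y]] _ <-.
rewrite /pushforward (_ : _ @^-1` _ = `](x - a), (y - a)]%classic); last first.
  by apply/seteqP; split => z /=; rewrite !in_itv/= ltrBlDr lerBrDr.
rewrite !lebesgue_measure_itv/= !lte_fin ltrD2r.
by case: ifPn => // _; congr (_%:E); ring.
Qed.

Lemma ge0_integral_translation (a : R) (f : R -> \bar R) :
  measurable_fun setT f -> (forall x, 0 <= f x)%E ->
  (\int[lebesgue_measure]_x f (x + a)%R = \int[lebesgue_measure]_x f x)%E.
Proof.
move=> mf f0.
transitivity (\int[pushforward lebesgue_measure
    (+%R^~ a : _ -> measurableTypeR R)]_x f x)%E.
  rewrite ge0_integral_pushforward ?preimage_setT//.
  exact: measurable_funD.
apply: eq_measure_integral => //= [_ A mA|_ A mA _].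
  exact: measurable_funD.
exact: lebesgue_measure_translation.
Qed.

Lemma ge0_integral_lebesgue_rVS n (f : 'rV[R]_n.+1 -> \bar R) :
  measurable_fun setT f -> (forall x, 0 <= f x)%E ->
  (\int[leb n.+1]_x f x =
   \int[lebesgue_measure]_x \int[leb n]_v f (cons_rV (x, v)))%E.
Proof.
move=> mf f0 /=.
rewrite ge0_integral_pushforward//; last exact: measurable_cons_rV.
rewrite preimage_setT fubini_tonelli1//.
- by apply: measurableT_comp => //; exact: measurable_cons_rV.
- by move=> x; exact: f0.
Qed.

Lemma measurable_addr_rV n (w : 'rV[R]_n) : measurable_fun setT (fun x : 'rV[R]_n => x + w).
Proof.
apply: measurable_fun_rV => i; under eq_fun do rewrite mxE.
by apply: measurable_funD => //; exact: measurable_coord.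
Qed.

(** Tonelli's theorem splits off the first coordinate, so induction on the dimension reduces this to
    translations of the line. *)
Lemma ge0_integral_rV_translation n (w : 'rV[R]_n) (f : 'rV[R]_n -> \bar R) :
  measurable_fun setT f -> (forall x, 0 <= f x)%E ->
  (\int[leb n]_x f (x + w)%R = \int[leb n]_x f x)%E.
Proof.
elim: n w f => [|n ih] w f mf f0.
  by apply: eq_integral => x _; rewrite [x + w]thinmx0 [x]thinmx0.
have mfw : measurable_fun setT (fun x : 'rV[R]_n.+1 => f (x + w)).
  by apply: (measurableT_comp mf); exact: measurable_addr_rV.
rewrite !ge0_integral_lebesgue_rVS//.
pose w' : 'rV[R]_n := \row_j w ord0 (lift ord0 j).
have E x v : cons_rV (x, v) + w = cons_rV (x + w ord0 ord0, v + w').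
  apply/rowP => i; rewrite !mxE.
  by case: unliftP => [j ->|->]; rewrite ?mxE.
have mfc : measurable_fun setT (fun z : R * 'rV[R]_n => f (cons_rV z)).
  by apply: (measurableT_comp mf); exact: measurable_cons_rV.
transitivity (\int[lebesgue_measure]_x \int[leb n]_v
    f (cons_rV ((x + w ord0 ord0)%R, v)))%E.
  apply: eq_integral => x _; under eq_integral do rewrite E.
  apply: (ih w' (fun v => f (cons_rV (x + w ord0 ord0, v)))) => //.
  exact: (measurableT_comp mfc).
apply: (ge0_integral_translation (w ord0 ord0)
  (f := fun x => (\int[leb n]_v f (cons_rV (x, v)))%E)).
  apply: (@measurable_fun_fubini_tonelli_F _ _ _ _ _ (leb n) (f \o cons_rV)) => // z; exact: f0.
by move=> x; apply: integral_ge0.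
Qed.

(** Averages over translated cubes replace averages over balls: the measure of a cube follows from
    the product structure, and in the max norm its points have norm at most [r]. *)
Definition cube n (r : R) : set 'rV[R]_n := [set v | forall i, v ord0 i \in `[0, r]].

Lemma measurable_cube n r : measurable (@cube n r).
Proof.
rewrite (_ : @cube n r = \bigcap_(i in [set: 'I_n])
   ((fun t : 'rV[R]_n => t ord0 i) @^-1` [set` `[0, r] : interval R])).
  apply: fin_bigcap_measurable => // i _.
  by rewrite -[X in measurable X]setTI; exact: measurable_coord.
by apply/seteqP; split => [t Ct i _|t Ct i]; [exact: Ct|exact: (Ct i I)].
Qed.

Lemma lebesgue_cube n r : 0 <= r -> leb n (@cube n r) = (r ^+ n)%:E.
Proof.
move=> r0; elim: n => [|n ih] /=.
  by rewrite diracE mem_set// => -[].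
rewrite /lebesgue_cons /pushforward.
have -> : cons_rV @^-1` @cube n.+1 r = [set` `[0, r] : interval R] `*` @cube n r.
  apply/seteqP; split => [[x v] /= xv|[x v] [/= xk vk] i]; last first.
    by rewrite mxE; case: unliftP.
  split; first by have := xv ord0; rewrite mxE unlift_none.
  by move=> j; have := xv (lift ord0 j); rewrite mxE liftK.
rewrite product_measure1E//; last exact: measurable_cube.
rewrite [X in (X * _)%E](@lebesgue_measure_itv R `[0, r])/=.
rewrite ih lte_fin; case: ltgtP r0 => // [r0 _|<- _]; last first.
  by rewrite mul0e exprS mul0r.
by rewrite sube0 -EFinM exprS.
Qed.

Lemma lebesgue_rV_translation n (w : 'rV[R]_n) A : measurable A ->
  leb n ((fun x : 'rV[R]_n => x + w) @^-1` A) = leb n A.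
Proof.
move=> mA.
have mA' : measurable ((fun x : 'rV[R]_n => x + w) @^-1` A).
  by rewrite -[X in measurable X]setTI; exact: measurable_addr_rV.
rewrite -[X in leb n X = _]setIT -[X in _ = leb n X]setIT -!integral_indic//.
rewrite -[RHS](ge0_integral_rV_translation w)//.
exact/measurable_EFinP/measurable_indic.
Qed.

(** A translated cube of side [e / 2] fits into a ball of radius [e]. This is what makes continuous
    representatives of Sobolev classes unique on an open set. *)
Lemma lebesgue_open_gt0 n (U : set 'rV[R]_n) x : open U -> U x ->
  (0 < leb n U)%E.
Proof.
move=> oU Ux; have mU := open_measurable_rV oU.
have /nbhs_ballP[e /= e0 eU] : nbhs x U by exact: open_nbhs_nbhs.
have e2 : 0 < e / 2 by rewrite divr_gt0.
rewrite (@lt_le_trans _ _ (leb n (@cube n (e / 2))))//.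
  by rewrite lebesgue_cube ?ltW// lte_fin exprn_gt0.
rewrite -(lebesgue_rV_translation x mU) le_measure ?inE//.
- exact: measurable_cube.
- by rewrite -[X in measurable X]setTI; exact: measurable_addr_rV.
move=> v cv /=; apply: eU; split=> // i j; rewrite ord1 /ball/= mxE.
have := cv j; rewrite in_itv/= => /andP[v0 ve].
rewrite opprD addrCA subrr addr0 normrN ger0_norm//.
by rewrite (le_lt_trans ve)// ltr_pdivrMr// ltr_pMr// ltrDl.
Qed.

End lebesgue_translation.

(** * Morrey's inequality *)

Section cube_averages.
Context {R : realType} {n : nat}.
Local Notation lam := (@lebesgue_rV R n).
Implicit Types (f g : 'rV[R]_n -> R) (r s : R) (w x : 'rV[R]_n).

Lemma lebesgue_cube_lty r : 0 <= r -> (lam (@cube _ n r) < +oo)%E.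
Proof. by move=> r0; rewrite lebesgue_cube// ltry. Qed.

Lemma continuous_translation f w : continuous f -> continuous (fun x => f (x + w)).
Proof.
move=> cf x; apply: (@continuous_comp _ _ _ (fun x => x + w) f); last exact: cf.
exact: cvgD (@cvg_id _ _) (cvg_cst _).
Qed.

Lemma bounded_cube_integrable f (M : R) r : 0 <= r ->
  measurable_fun setT f -> (forall x, `|f x| <= M) ->
  lam.-integrable (@cube _ n r) (EFin \o f).
Proof.
move=> r0 mf fM; apply: measurable_bounded_integrable.
- exact: measurable_cube.
- exact: lebesgue_cube_lty.
- exact: measurable_funTS.
- by exists M; split; [exact: num_real|move=> y My x _ /=; rewrite (le_trans (fM x))// ltW].
Qed.

Lemma Lnorm_translation (p : R) g w : measurable_fun setT g ->
  ('N[lam]_p%:E [EFin \o (fun x => g (x + w)%R)] = 'N[lam]_p%:E [EFin \o g])%E.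
Proof.
move=> mg; rewrite unlock /Lnorm; apply: (congr1 (fun z => z `^ _)%E).
apply: (ge0_integral_rV_translation w (f := fun x => `|(g x)%:E| `^ p)%E) => [|x].
  apply: (measurableT_comp (measurable_poweR p)).
  by apply: measurableT_comp => //; exact/measurable_EFinP.
exact: poweR_ge0.
Qed.

(** Hoelder's inequality against the indicator of the cube, whose norm at the conjugate exponent is
    [r ^ n] to the power [1 - 1 / p]. The power is split so that division by the volume leaves the
    second factor. *)
Lemma le_integral_cube_Lp (p : exponent R) g r w : 0 < r -> g \in Lfun lam (p : R)%:E ->
  \int[lam]_(x in @cube _ n r) `|g (x + w)| <=
  r ^+ n * (r ^+ n) `^ (- (p : R)^-1) * fine ('N[lam]_(p : R)%:E [EFin \o g])%E.
Proof.
move=> r0 Lg; have mg : measurable_fun setT g by move: Lg => /andP[/[!inE]].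
have p1 := exponent_gt1 p; have p0 : 0 < (p : R) by rewrite (lt_trans ltr01).
have rn0 : 0 < r ^+ n by rewrite exprn_gt0.
have [q q0 qE] : exists2 q : R, 0 < q & (p : R)^-1 + q^-1 = 1.
  have p10 : (p : R) - 1 != 0 by rewrite subr_eq0 gt_eqF.
  exists (conjugate p); first by rewrite (lt_trans ltr01)// exponent_gt1.
  by rewrite /= invf_div; field; rewrite gt_eqF.
have mgw : measurable_fun setT (fun x => g (x + w)).
  by apply: (measurableT_comp mg); exact: measurable_addr_rV.
have mC := @measurable_cube R n r.
have := @hoelder _ _ _ lam _ (\1_(@cube _ n r) : 'rV[R]_n -> R) _ _ mgw
  (measurable_indic mC) p0 q0 qE.
rewrite Lnorm1 Lnorm_translation//.
have -> : (\int[lam]_x `|((fun x => g (x + w)%R) \* \1_(@cube _ n r))%R x|%:E =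
    \int[lam]_(x in @cube _ n r) `|g (x + w)%R|%:E)%E.
  rewrite [RHS]integral_mkcond; apply: eq_integral => x _.
  rewrite /patch /= indicE; case: (x \in _); first by rewrite mulr1.
  by rewrite mulr0 normr0.
have -> : ('N[lam]_q%:E [EFin \o \1_(@cube _ n r)] = ((r ^+ n) `^ q^-1)%:E)%E.
  rewrite unlock /Lnorm (_ : (fun x => _) = EFin \o \1_(@cube _ n r)); last first.
    apply/funext => x /=; rewrite indicE normr_nat -poweR_EFin.
    by case: (x \in _) => /=; rewrite ?powR1// powR0// gt_eqF.
  rewrite integral_indic// setIT.
  exact: (congr1 (fun z => z `^ q^-1)%E (lebesgue_cube n (ltW r0))).
have fN : ('N[lam]_(p : R)%:E [EFin \o g] \is a fin_num)%E.
  have p1' : (1 <= (p : R)%:E)%E by rewrite lee_fin ltW.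
  by rewrite -(finite_norm_fine (Lfun_Sub p1' Lg)).
rewrite -{1}(fineK fN) -EFinM => h.
rewrite /Rintegral -lee_fin fineK.
  apply: (le_trans h); rewrite lee_fin mulrC ler_wpM2r//.
    by apply: fine_ge0; exact: Lnorm_ge0.
  rewrite -{2}[r ^+ n]powRr1 ?(ltW rn0)// -powRD ?(gt_eqF rn0) ?implybT//.
  by rewrite -qE addrAC subrr add0r.
rewrite ge0_fin_numE; first by rewrite (le_lt_trans h)// ltry.
by apply: integral_ge0 => x _; rewrite lee_fin.
Qed.

Variables (p : exponent R) (f : 'rV[R]_n -> R) (M : R).
Hypothesis f_cont : continuous f.
Hypothesis f_bnd : forall x, `|f x| <= M.
Hypothesis f_der : forall x (i : 'I_n), derivable f x (delta_mx ord0 i : 'rV[R]_n).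
Hypothesis pf_cont : forall i, continuous (partial i f).
Hypothesis pf_bnd : forall i x, `|partial i f x| <= M.
Hypothesis pf_Lp : forall i, partial i f \in Lfun lam (p : R)%:E.

Definition cube_integral r w := \int[lam]_(x in @cube _ n r) f (x + w).

Definition grad_norm := \sum_i fine ('N[lam]_(p : R)%:E [EFin \o partial i f])%E.

Let kappa r := (r ^+ n) `^ (- (p : R)^-1).

Let mcont (g : 'rV[R]_n -> R) w : continuous g ->
  measurable_fun setT (fun x => g (x + w)).
Proof.
by move=> cg; apply: continuous_measurable_rV; exact: continuous_translation.
Qed.

Let derivable_line w i s :
  is_derive s 1 (fun s => f (w + s *: delta_mx ord0 i))
    (partial i f (w + s *: delta_mx ord0 i)).
Proof.
pose v : 'rV[R]_n := delta_mx ord0 i.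
have E : (fun h => h^-1 *: (f (w + (h *: 1 + s) *: v) - f (w + s *: v))) =
   (fun h => h^-1 *: (f (h *: v + (w + s *: v)) - f (w + s *: v))).
  apply/funext => h; congr (_ *: (f _ - _)).
  by rewrite scaler1 scalerDl addrCA.
have d := @f_der (w + s *: v) i.
apply: DeriveDef; first by rewrite /derivable/= E; exact: d.
by rewrite /derive/= E.
Qed.

(** Differentiation under the integral along a coordinate line, the mean value theorem, and
    Hoelder's inequality for the derivative. The bound [M] only provides a dominating function and
    does not enter the estimate. *)
Lemma cube_integral_coordinate r w i (t : R) : 0 < r ->
  `|cube_integral r (w + t *: delta_mx ord0 i) - cube_integral r w| <=
  `|t| * (r ^+ n * kappa r * fine ('N[lam]_(p : R)%:E [EFin \o partial i f])%E).
Proof.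
move=> r0; set K := (X in _ * X).
pose v : 'rV[R]_n := delta_mx ord0 i.
pose F s := cube_integral r (w + s *: v).
have dF s : is_derive s 1 F
    (\int[lam]_(x in @cube _ n r) partial i f (x + (w + s *: v))).
  pose g s x := f (x + (w + s *: v)).
  have dg s' x : is_derive s' 1 (g ^~ x) (partial i f (x + (w + s' *: v))).
    rewrite /g; under eq_fun do rewrite addrA.
    by rewrite addrA; exact: derivable_line.
  have Is : `]s - 1, s + 1[%classic s by rewrite /= in_itv/= ltrBlDr ltrDl ltr01.
  have ig s' : `]s - 1, s + 1[%classic s' ->
      lam.-integrable (@cube _ n r) (EFin \o g s').
    move=> _; apply: (@bounded_cube_integrable _ M) => //; [exact: ltW|exact: mcont|].
    by move=> x; exact: f_bnd.
  have dg' t' x : `]s - 1, s + 1[%classic t' -> @cube _ n r x ->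
      derivable (g ^~ x) t' 1.
    by move=> _ _; have [] := dg t' x.
  have M0 : 0 <= M by rewrite (le_trans _ (f_bnd 0)).
  have iM : lam.-integrable (@cube _ n r) (EFin \o cst M).
    apply: (@bounded_cube_integrable _ M) => //; first exact: ltW.
    by move=> x; rewrite ger0_norm.
  have gM t' x : `]s - 1, s + 1[%classic t' -> @cube _ n r x ->
      `|partial1of2 g t' x| <= cst M x.
    by move=> _ _; rewrite partial1of2E; have [_ ->] := dg t' x.
  have mC := @measurable_cube R n r.
  apply: DeriveDef.
    exact: (derivable_under_integral mC Is ig dg' (fun=> M0) iM gM).
  rewrite -derive1E (differentiation_under_integral mC Is ig dg' (fun=> M0) iM gM).
  by apply: eq_Rintegral => x _; rewrite partial1of2E; have [_ ->] := dg s x.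
have Fb s : `|\int[lam]_(x in @cube _ n r) partial i f (x + (w + s *: v))| <= K.
  apply: (le_trans (le_normr_Rintegral (@measurable_cube R n r) _)).
    by apply: (@bounded_cube_integrable _ M) => //; [exact: ltW|exact: mcont].
  exact: le_integral_cube_Lp.
have Fc (a b : R) : {within `[a, b], continuous F}.
  apply: derivable_within_continuous => s _; by have [] := dF s.
have -> : cube_integral r w = F 0 by rewrite /F scale0r addr0.
rewrite -/(F t).
have [t0|t0|->] := ltgtP t 0; last by rewrite !subrr normr0 mul0r.
- have [c _] := @MVT _ F _ _ _ t0 (fun s _ => dF s) (Fc t 0).
  by rewrite distrC sub0r => ->; rewrite normrM normrN mulrC ler_wpM2l.
- have [c _ ->] := @MVT _ F _ _ _ t0 (fun s _ => dF s) (Fc 0 t).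
  by rewrite subr0 normrM mulrC ler_wpM2l.
Qed.

Lemma coord_norm_le (z : 'rV[R]_n) i : `|z ord0 i| <= `|z|.
Proof.
rewrite [leRHS]/Num.norm/= mx_normrE.
exact: (le_bigmax _ (fun ij => `|z ij.1 ij.2|) (ord0, i)).
Qed.

(** The translation is carried out one coordinate at a time; the base point is general in the
    induction because it moves along. *)
Lemma cube_integral_translation r w z : 0 < r ->
  `|cube_integral r (w + z) - cube_integral r w| <=
  `|z| * (r ^+ n * kappa r * grad_norm).
Proof.
move=> r0; pose K i := r ^+ n * kappa r * fine ('N[lam]_(p : R)%:E [EFin \o partial i f])%E.
have K0 i : 0 <= K i.
  rewrite mulr_ge0 ?fine_ge0 ?Lnorm_ge0// mulr_ge0 ?powR_ge0// exprn_ge0// ltW//.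
rewrite /grad_norm mulr_sumr mulr_sumr.
rewrite {1}(row_sum_delta z).
elim: (index_enum _) w => [|i s ih] w; first by rewrite !big_nil addr0 subrr normr0.
rewrite !big_cons addrA; set w' := w + _.
have h1 := ih w'; have h3 : `|cube_integral r w' - cube_integral r w| <= `|z| * K i.
  apply: (le_trans (cube_integral_coordinate _ _ _ r0)).
  by rewrite -/(K i) ler_wpM2r// coord_norm_le.
rewrite [leRHS]addrC.
exact: (le_trans (ler_distD (cube_integral r w') _ _) (lerD h1 h3)).
Qed.

Lemma continuous_cube_integral r : 0 < r -> continuous (cube_integral r).
Proof.
move=> r0 w; pose K := r ^+ n * kappa r * grad_norm.
have K0 : 0 <= K.
  rewrite mulr_ge0 ?sumr_ge0// => [|i _]; last by rewrite fine_ge0// Lnorm_ge0.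
  by rewrite mulr_ge0 ?powR_ge0// exprn_ge0// ltW.
have K1 : 0 < K + 1 by rewrite ltr_wpDl.
apply/(@cvgrPdist_lt _ _ _ (nbhs w)) => e e0.
apply: filterS (nbhsx_ballx w _ (divr_gt0 e0 K1)) => z.
rewrite -ball_normE /= distrC ltr_pdivlMr// => wz.
rewrite distrC -{1}(subrKC w z) (le_lt_trans (cube_integral_translation _ _ r0))//.
by rewrite -/K (le_lt_trans _ wz)// ler_wpM2l// lerDl.
Qed.

Lemma cube_integral_bounded r w : 0 < r -> `|cube_integral r w| <= M * r ^+ n.
Proof.
move=> r0; have mC := @measurable_cube R n r.
have M0 : 0 <= M by rewrite (le_trans _ (f_bnd 0)).
have iM : lam.-integrable (@cube _ n r) (EFin \o cst M).
  apply: (@bounded_cube_integrable _ M) => //; first exact: ltW.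
  by move=> x; rewrite ger0_norm.
have ig : lam.-integrable (@cube _ n r) (EFin \o (fun x => f (x + w))).
  by apply: (@bounded_cube_integrable _ M) => //; [exact: ltW|exact: mcont].
apply: (le_trans (le_normr_Rintegral mC ig)).
rewrite (@le_trans _ _ (\int[lam]_(x in @cube _ n r) cst M x))//.
  by apply: le_Rintegral => //; exact: integrable_norm.
rewrite Rintegral_cst//.
have -> : fine (lam (@cube _ n r)) = r ^+ n by rewrite (lebesgue_cube n (ltW r0)).
by [].
Qed.

(** By Fubini, averaging at two scales does not depend on the order. The double average is the
    intermediate quantity that compares the two scales. *)
Lemma cube_integral_exchange r s w : 0 < r -> 0 < s ->
  \int[lam]_(z in @cube _ n s) cube_integral r (z + w) =
  \int[lam]_(x in @cube _ n r) cube_integral s (x + w).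
Proof.
move=> r0 s0.
pose F (z : 'rV[R]_n * 'rV[R]_n) :=
  f (z.2 + (z.1 + w)) * \1_(@cube _ n s) z.1 * \1_(@cube _ n r) z.2.
have mF : measurable_fun setT F.
  apply: measurable_funM; first apply: measurable_funM.
  - apply: (measurableT_comp (continuous_measurable_rV f_cont)).
    apply: measurable_fun_rV => i; under eq_fun do rewrite !mxE.
    apply: measurable_funD; last apply: measurable_funD => //.
      exact: (measurableT_comp (measurable_coord i) measurable_snd).
    exact: (measurableT_comp (measurable_coord i) measurable_fst).
  - by apply: measurableT_comp => //; apply: measurable_indic; exact: measurable_cube.
  - by apply: measurableT_comp => //; apply: measurable_indic; exact: measurable_cube.
have M0 : 0 <= M by rewrite (le_trans _ (f_bnd 0)).
pose D := @cube R n s `*` @cube R n r.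
have mD : measurable D by apply: measurableX; exact: measurable_cube.
have iF : (lam \x lam)%E.-integrable setT (EFin \o F).
  have -> : EFin \o F = (EFin \o F) \_ D.
    apply/funext => -[z x]; rewrite /patch /= /F /=.
    case: ifPn => // /negP zx; congr _%:E.
    rewrite !indicE; case: (boolP (z \in _)) => [zs|]; last by rewrite mulr0 mul0r.
    case: (boolP (x \in _)) => [xr|]; last by rewrite mulr0.
    by exfalso; apply: zx; rewrite inE; split; rewrite -inE.
  apply/(integrable_mkcond _ mD); apply: measurable_bounded_integrable => //.
  - have E := @product_measure1E _ _ _ _ _ lam lam _ _
      (@measurable_cube R n s) (@measurable_cube R n r).
    apply: (@eq_ind_r _ _ (fun z => z < +oo)%E _ _ E).
    by rewrite lte_mul_pinfty ?ge0_fin_numE// lebesgue_cube_lty// ltW.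
  - exact: measurable_funTS.
  - exists M; split; [exact: num_real|move=> y My x _ /=].
    rewrite (le_trans _ (ltW My))// /F !normrM -[leRHS]mulr1 -[leRHS]mulr1.
    by rewrite !indicE !normr_nat !ler_pM ?mulr_ge0 ?ler_nat ?lern1 ?leq_b1.
have inner r' v : 0 < r' -> (\int[lam]_x (f (x + v) * \1_(@cube _ n r') x)%:E =
    (cube_integral r' v)%:E)%E.
  move=> r'0; rewrite /cube_integral /Rintegral fineK; last first.
    apply: integrable_fin_num; first exact: measurable_cube.
    by apply: (@bounded_cube_integrable _ M) => //; [exact: ltW|exact: mcont].
  rewrite [RHS]integral_mkcond; apply: eq_integral => x _.
  by rewrite /patch indicE; case: (x \in _); rewrite ?mulr1 ?mulr0.
rewrite /Rintegral; apply: (congr1 fine).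
transitivity (\int[lam]_z \int[lam]_x (F (z, x))%:E)%E.
  rewrite [LHS]integral_mkcond; apply: eq_integral => z _.
  rewrite /patch -[cube_integral r (z + w)]/(cube_integral r (z + w)).
  under eq_integral => x _ do rewrite /F /= mulrAC EFinM.
  rewrite /= indicE; case: (z \in _).
    by under eq_integral => x _ do rewrite mule1; rewrite inner.
  by under eq_integral => x _ do rewrite mule0; rewrite integral0.
rewrite (Fubini iF).
rewrite [RHS]integral_mkcond; apply: eq_integral => x _.
rewrite /patch; under eq_integral => z _ do rewrite /F /= EFinM addrCA.
rewrite /= indicE; case: (x \in _).
  by under eq_integral => z _ do rewrite mule1; rewrite inner.
by under eq_integral => z _ do rewrite mule0; rewrite integral0.
Qed.

Definition cube_average r w := cube_integral r w / r ^+ n.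

Lemma cube_norm_le r z : 0 <= r -> @cube R n r z -> `|z| <= r.
Proof.
move=> r0 zr; rewrite [leLHS]/Num.norm/= mx_normrE.
apply: bigmax_le => // -[i j] _ /=; rewrite ord1.
by have := zr j; rewrite in_itv/= => /andP[z0 ?]; rewrite ger0_norm.
Qed.

Let grad_norm_ge0 : 0 <= grad_norm.
Proof. by apply: sumr_ge0 => i _; rewrite fine_ge0// Lnorm_ge0. Qed.

Lemma cube_average_translation r w z : 0 < r ->
  `|cube_average r (w + z) - cube_average r w| <= `|z| * kappa r * grad_norm.
Proof.
move=> r0; have rn0 : 0 < r ^+ n by rewrite exprn_gt0.
rewrite -mulrBl normrM normfV (gtr0_norm rn0) ler_pdivrMr//.
apply: (le_trans (cube_integral_translation _ _ r0)).
by rewrite le_eqVlt; apply/orP; left; apply/eqP; ring.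
Qed.

Let double_average r s w : 0 < r -> 0 < s ->
  `|\int[lam]_(z in @cube _ n s) cube_integral r (z + w)
    - cube_integral r w * s ^+ n| <= s * (r ^+ n * kappa r * grad_norm) * s ^+ n.
Proof.
move=> r0 s0; have mC := @measurable_cube R n s.
have lC : fine (lam (@cube _ n s)) = s ^+ n by rewrite (lebesgue_cube n (ltW s0)).
have K0 : 0 <= r ^+ n * kappa r * grad_norm.
  by rewrite mulr_ge0// mulr_ge0 ?powR_ge0// exprn_ge0// ltW.
have ic c : lam.-integrable (@cube _ n s) (EFin \o cst c).
  by apply: (@bounded_cube_integrable _ `|c|) => //; exact: ltW.
have ii : lam.-integrable (@cube _ n s) (EFin \o (fun z => cube_integral r (z + w))).
  apply: (@bounded_cube_integrable _ (M * r ^+ n)); first exact: ltW.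
    exact: mcont (continuous_cube_integral r0).
  by move=> z; exact: cube_integral_bounded.
rewrite -lC -(Rintegral_cst lam mC) -(Rintegral_cst lam mC) -RintegralB//; last exact: ic.
have iB : lam.-integrable (@cube _ n s)
    (EFin \o (fun z => cube_integral r (z + w) - cube_integral r w)).
  by rewrite /comp; under eq_fun do rewrite EFinB; exact: integrableB (ic _).
apply: (le_trans (le_normr_Rintegral mC iB)).
apply: le_Rintegral => //; [exact: integrable_norm|exact: ic|].
move=> z zC; rewrite /= [z + w]addrC (le_trans (cube_integral_translation _ _ r0))//.
by rewrite ler_wpM2r// cube_norm_le// ltW.
Qed.

(** Both averages are compared with the double average: averaging the [r]-average over a cube of
    side [s] moves its base point by at most [s], and conversely. *)
Lemma cube_average_dist r s w : 0 < r -> 0 < s ->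
  `|cube_average r w - cube_average s w| <= (s * kappa r + r * kappa s) * grad_norm.
Proof.
move=> r0 s0; have rn0 : 0 < r ^+ n by rewrite exprn_gt0.
have sn0 : 0 < s ^+ n by rewrite exprn_gt0.
have h1 := double_average w r0 s0.
have h2 := double_average w s0 r0; rewrite -cube_integral_exchange// in h2.
have -> : cube_average r w - cube_average s w =
    (cube_integral r w * s ^+ n - cube_integral s w * r ^+ n) / (r ^+ n * s ^+ n).
  by rewrite /cube_average; field; rewrite !gt_eqF.
rewrite normrM normfV (gtr0_norm (mulr_gt0 rn0 sn0)) ler_pdivrMr ?mulr_gt0//.
set I := \int[_]_(_ in _) _ in h1 h2.
apply: (le_trans (ler_distD I _ _)); rewrite distrC.
apply: (le_trans (lerD h1 h2)).
by rewrite le_eqVlt; apply/orP; left; apply/eqP; ring.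
Qed.

Lemma cube_average_cvg (u : R^nat) w : (forall k, 0 < u k) -> u @ \oo --> 0 ->
  (fun k => cube_average (u k) w) @ \oo --> f w.
Proof.
move=> u0 cu; apply/cvgrPdist_le => e e0.
have /nbhs_ballP[d /= d0 de] : nbhs w [set y | `|f w - f y| <= e].
  by move/cvgrPdist_le : (f_cont (x := w)); apply.
have /cvgrPdist_lt/(_ d d0) cvu := cu.
near=> k.
have ud : u k < d.
  have : `|0 - u k| < d by near: k; exact: cvu.
  by rewrite sub0r normrN gtr0_norm.
have uk0 := u0 k; have un0 : 0 < u k ^+ n by rewrite exprn_gt0.
have mC := @measurable_cube R n (u k).
have lC : fine (lam (@cube _ n (u k))) = u k ^+ n.
  by rewrite (lebesgue_cube n (ltW uk0)).
have ic c : lam.-integrable (@cube _ n (u k)) (EFin \o cst c).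
  by apply: (@bounded_cube_integrable _ `|c|) => //; exact: ltW.
have ii : lam.-integrable (@cube _ n (u k)) (EFin \o (fun z => f (z + w))).
  by apply: (@bounded_cube_integrable _ M); [exact: ltW|exact: mcont|].
have -> : f w - cube_average (u k) w =
    (f w * u k ^+ n - cube_integral (u k) w) / u k ^+ n.
  by rewrite /cube_average; field; rewrite gt_eqF.
rewrite normrM normfV (gtr0_norm un0) ler_pdivrMr// -lC.
rewrite -(Rintegral_cst lam mC) -(Rintegral_cst lam mC) -RintegralB//; last exact: ic.
have iB : lam.-integrable (@cube _ n (u k)) (EFin \o (fun z => f w - f (z + w))).
  by rewrite /comp; under eq_fun do rewrite EFinB; exact: integrableB (ic _) ii.
apply: (le_trans (le_normr_Rintegral mC iB)).
apply: le_Rintegral => //; [exact: integrable_norm|exact: ic|].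
move=> z zC; apply: de; rewrite -ball_normE /= distrC addrK.
by rewrite (le_lt_trans (cube_norm_le _ zC))// ltW.
Unshelve. all: by end_near. Qed.

Hypothesis np : n%:R < (p : R).
Let rho : R := 2^-1 * (2 ^+ n) `^ (p : R)^-1.

Let p_gt0 : 0 < (p : R).
Proof. by rewrite (lt_trans ltr01)// exponent_gt1. Qed.

(** As [n < p], the power [1 / p] of [2 ^ n] is below 2. This is the only place where the dimension
    is compared with the exponent to get a contraction. *)
Lemma morrey_ratio_itv : 0 <= rho < 1.
Proof.
rewrite mulr_ge0 ?powR_ge0//= ltr_pdivrMl// mulr1.
have h : (2 : R) ^+ n < 2 `^ (p : R).
  rewrite -powR_mulrn// /powR gt_eqF// ltr_expR ltr_pM2r// ln_gt0//.
  by rewrite ltr1n.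
have := @gt0_ltr_powR R (p : R)^-1 _ _ _ _ _ h.
rewrite -powRrM divff ?gt_eqF// powRr1//; apply => //.
- by rewrite invr_gt0.
- by rewrite nnegrE exprn_ge0.
- by rewrite nnegrE powR_ge0.
Qed.

Let theta r := r * kappa r.

Let theta_half r : 0 < r -> theta (r / 2) = rho * theta r.
Proof.
move=> r0; rewrite /theta /kappa expr_div_n powRM ?exprn_ge0 ?invr_ge0 ?ltW//.
have -> : ((2 : R) ^- n) `^ (- (p : R)^-1) = (2 ^+ n) `^ (p : R)^-1.
  by rewrite -powR_inv1 ?exprn_ge0// -powRrM mulN1r opprK.
by rewrite /rho; ring.
Qed.

(** Halving the side repeatedly, the averages tend to [f w] by continuity, and their increments are
    geometric of ratio [rho], because [theta r] is the power [1 - n / p] of [r]. *)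
Lemma cube_average_approx r w : 0 < r ->
  `|cube_average r w - f w| <= 5 / 2 * theta r * grad_norm / (1 - rho).
Proof.
move=> r0; pose u k := r / 2 ^+ k.
have u0 k : 0 < u k by rewrite divr_gt0// exprn_gt0.
have uS k : u k.+1 = u k / 2 by rewrite /u exprS invfM; ring.
have thu k : theta (u k) = theta r * rho ^+ k.
  elim: k => [|k ih]; first by rewrite /u expr0 divr1 mulr1.
  by rewrite uS theta_half// ih exprS; ring.
have th0 k : 0 <= theta (u k) by rewrite mulr_ge0 ?powR_ge0// ltW.
have /andP[rho0 rho1] := morrey_ratio_itv.
have cu : u @ \oo --> 0.
  rewrite -[X in _ --> X](mulr0 r); apply: cvgMr.
  under eq_fun do rewrite -exprVn.
  by apply: cvg_expr; rewrite ger0_norm ?invr_ge0// invf_lt1 ?ltr1n.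
have inc k : `|cube_average (u k.+1) w - cube_average (u k) w| <=
    (5 / 2 * theta r * grad_norm) * rho ^+ k.
  rewrite distrC (le_trans (cube_average_dist _ (u0 k) (u0 k.+1)))//.
  rewrite [leRHS](_ : _ = 5 / 2 * theta (u k) * grad_norm); last by rewrite thu; ring.
  rewrite ler_wpM2r//.
  (* The two terms of [cube_average_dist] are [theta (u k) / 2] and at most [2 * theta (u k)],
     whence the factor 5 / 2. *)
  have -> : u k.+1 * kappa (u k) = theta (u k) / 2 by rewrite uS /theta; ring.
  have -> : u k * kappa (u k.+1) = 2 * theta (u k.+1) by rewrite uS /theta; field.
  have : theta (u k.+1) <= theta (u k).
    by rewrite uS theta_half// ler_piMl// ltW.
  lra.
have [l [cl /(_ 0%N)]] := geometric_increments_cvg morrey_ratio_itv inc.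
rewrite (cvg_unique _ cl (cube_average_cvg (w := w) u0 cu))//.
by rewrite /u expr0 divr1 mulr1.
Qed.

(** Both values are compared with the averages at scale [r = |x - y|], which costs 5 / 2 twice;
    moving the cube from [y] to [x] contributes the summand 1. *)
Lemma morrey_hoelder x y :
  `|f x - f y| <= (1 + 5 / (1 - rho)) * grad_norm * `|x - y| `^ (1 - n%:R / (p : R)).
Proof.
have /andP[rho0 rho1] := morrey_ratio_itv.
have [->|xy] := eqVneq x y.
  by rewrite subrr normr0 mulr_ge0 ?powR_ge0// mulr_ge0// addr_ge0// divr_ge0// subr_ge0 ltW.
have r0 : 0 < `|x - y| by rewrite normr_gt0 subr_eq0.
set r := `|x - y| in r0 *.
have -> : r `^ (1 - n%:R / (p : R)) = theta r.
  rewrite powRD ?(gt_eqF r0) ?implybT// powRr1 ?ltW// /theta /kappa.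
  by rewrite -[r ^+ n]powR_mulrn ?ltW// -powRrM mulrN.
have h1 := cube_average_approx x r0; have h2 := cube_average_approx y r0.
have h3 := cube_average_translation y (x - y) r0; rewrite subrKC -/r in h3.
have h4 : `|f x - f y| <= `|cube_average r x - f x| +
    `|cube_average r x - cube_average r y| + `|cube_average r y - f y|.
  rewrite (distrC _ (f x)) (le_trans (ler_distD (cube_average r y) _ _))// lerD2r.
  exact: ler_distD.
apply: (le_trans h4); rewrite (le_trans (lerD (lerD h1 h3) h2))//.
rewrite le_eqVlt; apply/orP; left; apply/eqP.
by rewrite -/(theta r); field; rewrite subr_eq0 gt_eqF.
Qed.

Hypothesis f_Lp : f \in Lfun lam (p : R)%:E.

(** At scale 1 the average is bounded by the Lp norm of [f], and its distance to [f x] by the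
    gradient. *)
Lemma morrey_sup x :
  `|f x| <= fine ('N[lam]_(p : R)%:E [EFin \o f])%E + 5 / 2 / (1 - rho) * grad_norm.
Proof.
have h1 := cube_average_approx x ltr01.
have t1 : theta 1 = 1 by rewrite /theta /kappa expr1n powR1 mulr1.
rewrite t1 in h1.
have h2 : `|cube_average 1 x| <= fine ('N[lam]_(p : R)%:E [EFin \o f])%E.
  rewrite /cube_average expr1n divr1.
  apply: (le_trans (le_normr_Rintegral (@measurable_cube R n 1) _)).
    by apply: (@bounded_cube_integrable _ M) => //; exact: mcont.
  have := le_integral_cube_Lp x ltr01 f_Lp.
  by rewrite expr1n powR1 !mul1r.
have h3 : `|f x| <= `|cube_average 1 x| + `|cube_average 1 x - f x|.
  rewrite -{1}(subKr (cube_average 1 x) (f x)).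
  exact: ler_normB.
apply: (le_trans h3); apply: lerD => //; apply: (le_trans h1).
by rewrite le_eqVlt; apply/orP; left; apply/eqP; ring.
Qed.

End cube_averages.

(** * The Sobolev embedding *)

Section sobolev_embedding.
Context {R : realType} {n : nat}.
Local Notation lam := (@lebesgue_rV R n).
Variables (Omega : set 'rV[R]_n) (p : exponent R).

Let p_ge1 : (1 <= (p : R)%:E)%E.
Proof. by rewrite lee_fin ltW// exponent_gt1. Qed.

Let p_gt0 : 0 < (p : R).
Proof. by rewrite (lt_trans ltr01)// exponent_gt1. Qed.

Lemma Lp_norm_eq0 g : Lp Omega p g -> Lp_norm Omega p g = 0 ->
  {ae lam, forall x, Omega x -> g x = 0}.
Proof.
move=> gL g0.
have : (Lfun_Sub p_ge1 gL : 'rV[R]_n -> R) = 0 %[ae lam].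
  exact: fine_Lnormr_eq0.
apply: filterS => x /(_ Logic.I) + Ox.
by rewrite /= /patch mem_set.
Qed.

(** It turns uniform convergence into Lp convergence on a domain of finite measure. *)
Lemma bounded_Lp (g : 'rV[R]_n -> R) e : measurable Omega -> (lam Omega < +oo)%E ->
  measurable_fun setT g -> (forall x, `|g x| <= e) ->
  Lp Omega p g /\ Lp_norm Omega p g <= e * fine (lam Omega) `^ (p : R)^-1.
Proof.
move=> mO fO mg ge.
have e0 : 0 <= e by rewrite (le_trans _ (ge 0)).
have mgO : measurable_fun setT (g \_ Omega).
  apply/(measurable_restrictT _ mO); exact: measurable_funTS.
have lO0 : 0 <= fine (lam Omega) by exact: fine_ge0.
have N : ('N[lam]_(p : R)%:E [EFin \o (g \_ Omega)] <=
    (e * fine (lam Omega) `^ (p : R)^-1)%:E)%E.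
  have E : e * fine (lam Omega) `^ (p : R)^-1 =
      (e `^ (p : R) * fine (lam Omega)) `^ (p : R)^-1.
    by rewrite powRM ?powR_ge0// -powRrM divff ?gt_eqF// powRr1.
  rewrite E unlock /Lnorm -poweR_EFin.
  apply: gt0_ler_poweR => /=; rewrite ?invr_ge0 ?(ltW p_gt0)// ?in_itv/= ?leey ?andbT.
  - by apply: integral_ge0 => x _; rewrite lee_fin powR_ge0.
  - by rewrite lee_fin mulr_ge0// powR_ge0.
  apply: (@le_trans _ _ (\int[lam]_x ((cst (e `^ (p : R))%:E \_ Omega) x))%E).
    apply: ge0_le_integral => //.
    - apply/measurable_EFinP; apply: (measurableT_comp (measurable_powR _)) => //.
      exact: measurableT_comp.
    - by apply/(measurable_restrictT _ mO).
    - move=> x _; rewrite /patch; case: ifP => xO /=.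
        by rewrite lee_fin ge0_ler_powR// ?nnegrE// ltW.
      by rewrite normr0 powR0// gt_eqF.
  rewrite -integral_mkcond integral_cst//.
  by rewrite EFinM fineK// ge0_fin_numE.
have L : Lp Omega p g.
  rewrite /Lp; apply/andP; split; rewrite inE//=.
  by rewrite /finite_norm (le_lt_trans N)// ltry.
split=> //; rewrite /Lp_norm -lee_fin fineK//.
by rewrite ge0_fin_numE ?Lnorm_ge0// (le_lt_trans N)// ltry.
Qed.

Lemma sobolev_fun_ae (s : sobolev_fun Omega p) (v : sobolev0 Omega p) :
  seminorm_class _ s = sobolev0_val v ->
  {ae lam, forall x, Omega x -> s.1 x = sobolev_value v x}.
Proof.
rewrite -[sobolev0_val v]seminorm_reprK => /seminorm_classP /= h.
set r := seminorm_repr _ in h.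
have : Lp_norm Omega p (s - r).1 = 0.
  apply/eqP; rewrite eq_le fine_ge0 ?Lnorm_ge0// andbT.
  rewrite -h /sobolev_norm lerDl sumr_ge0// => i _.
  by rewrite fine_ge0// Lnorm_ge0.
have /asboolP[L _ _] := sobolev_funP (s - r).
move=> /(Lp_norm_eq0 L); apply: filterS => x /[apply] /=.
by rewrite /sobolev_value -/r => /eqP; rewrite subr_eq0 => /eqP.
Qed.

(* The geometric series bounds the differences of averages over cubes of       *)
(* halving side; its ratio is [2 ^ (n / p - 1)].                               *)
Definition morrey_cst : R := 1 + 5 / (1 - 2^-1 * (2 ^+ n) `^ (p : R)^-1).

Hypothesis np : n%:R < (p : R).

Lemma morrey_cst_ge0 : 0 <= morrey_cst.
Proof.
have /andP[_ h] := morrey_ratio_itv np.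
by rewrite addr_ge0// divr_ge0// subr_ge0 ltW.
Qed.

(** Compact support in [Omega] makes the extension by zero harmless and bounds the function and its
    derivatives by some [M]. The constants in the conclusion do not depend on this [M], so the
    estimates survive passage to the closure. *)
Lemma test_function_morrey (s : sobolev_fun Omega p) :
  test_function Omega s.1 -> s.2 = partial^~ s.1 ->
  [/\ 0 <= morrey_cst,
   forall x, `|s.1 x| <= morrey_cst * sobolev_norm s &
   forall x y, `|s.1 x - s.1 y| <=
     morrey_cst * sobolev_norm s * `|x - y| `^ (1 - n%:R / (p : R))].
Proof.
move: s => [[f g] s] /= tf gE; rewrite {}gE in s *.
have /asboolP[/= fL dL _] := s.
have [sf cK KO] := tf.
set K := closure _ in cK KO.
have bnd (h : 'rV[R]_n -> R) : continuous h -> (forall x, ~ K x -> h x = 0) ->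
    exists M, forall x, `|h x| <= M.
  move=> ch hK.
  have [M [_ HM]] : bounded_set (h @` K).
    apply: compact_bounded; apply: continuous_compact => //.
    exact: continuous_subspaceT.
  exists (`|M| + 1) => x; have [Kx|nKx] := pselect (K x).
    by apply: HM; [rewrite (le_lt_trans (ler_norm _))// ltrDl|exists x].
  by rewrite hK// normr0 addr_ge0.
have cf := test_function_continuous tf.
have cdf i := @test_function_partial_continuous _ _ _ _ i tf.
have f0 := @test_function_supp R n f.
have df0 i := @partial_supp R n i f.
have [M0 fM0] := bnd _ cf f0.
have /choice[M1 dfM1] := fun i => bnd _ (cdf i) (df0 i).
pose M := `|M0| + \sum_i `|M1 i|.
have fM x : `|f x| <= M.
  rewrite (le_trans (fM0 x))// (le_trans (ler_norm _))// lerDl.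
  exact: sumr_ge0.
have dfM i x : `|partial i f x| <= M.
  rewrite (le_trans (dfM1 i x))// (le_trans (ler_norm _))// /M (bigD1 i)//=.
  by rewrite addrCA lerDl addr_ge0// sumr_ge0.
have df x i : derivable f x (delta_mx ord0 i : 'rV[R]_n).
  by have [_] := sf [::]; apply.
have res (h : 'rV[R]_n -> R) : (forall x, ~ K x -> h x = 0) -> h \_ Omega = h.
  move=> hK; apply/funext => x; rewrite /patch; case: ifPn => // /negP xO.
  by rewrite hK// => Kx; apply: xO; rewrite inE; exact: KO.
have fLp : f \in Lfun lam (p : R)%:E by move: fL; rewrite /Lp res.
have dfLp i : partial i f \in Lfun lam (p : R)%:E.
  by move: (dL i); rewrite /Lp res//; exact: df0.
have NE : sobolev_norm (SobolevFun s) =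
    fine ('N[lam]_(p : R)%:E [EFin \o f])%E + grad_norm p f.
  rewrite /sobolev_norm /= /Lp_norm res// /grad_norm; congr (_ + _).
  by apply: eq_bigr => i _; rewrite res//; exact: df0.
have N0 : 0 <= fine ('N[lam]_(p : R)%:E [EFin \o f])%E by rewrite fine_ge0// Lnorm_ge0.
have G0 : 0 <= grad_norm p f by apply: sumr_ge0 => i _; rewrite fine_ge0// Lnorm_ge0.
have /andP[_ h] := morrey_ratio_itv np.
split=> [|x|x y]; first exact: morrey_cst_ge0.
  apply: (le_trans (morrey_sup cf fM df cdf dfM dfLp np fLp x)).
  rewrite NE /morrey_cst; set c := (1 - _)^-1.
  have c0 : 0 <= c by rewrite invr_ge0 subr_ge0 ltW.
  rewrite mulrDr lerD//.
    by rewrite ler_peMl// lerDl mulr_ge0.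
  by rewrite ler_wpM2r// -[leLHS]add0r lerD// ler_wpM2r//; lra.
apply: (le_trans (morrey_hoelder cf fM df cdf dfM dfLp np x y)).
rewrite NE ler_wpM2r ?powR_ge0// ler_wpM2l ?lerDr//.
exact: morrey_cst_ge0.
Qed.

Lemma bounded_set_lebesgue_lty (A : set 'rV[R]_n) : measurable A -> bounded_set A ->
  (lam A < +oo)%E.
Proof.
move=> mA [M [_ AM]].
have [k Mk] : exists k : nat, M < k%:R.
  by exists (Num.truncn M).+1; exact: truncnS_gt.
apply: (le_lt_trans _ (lebesgue_box_rV n k)).
apply: le_measure; rewrite ?inE//; first exact: measurable_box_rV.
move=> v Av i; rewrite in_itv/= -ler_norml.
by rewrite (le_trans (coord_norm_le v i))//; exact: AM.
Qed.

Hypothesis oOmega : open Omega.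
Hypothesis bOmega : bounded_set Omega.

Let mOmega : measurable Omega. Proof. exact: open_measurable_rV. Qed.

Let fOmega : (lam Omega < +oo)%E. Proof. exact: bounded_set_lebesgue_lty. Qed.

Lemma hoelder_continuous (w : 'rV[R]_n -> R) (K : R) :
  (forall x y, `|w x - w y| <= K * `|x - y| `^ (1 - n%:R / (p : R))) ->
  continuous w.
Proof.
set a := 1 - _; have a0 : 0 < a by rewrite subr_gt0 ltr_pdivrMr// mul1r.
move=> wK x; apply/(@cvgrPdist_lt _ _ _ (nbhs x)) => e e0.
have K1 : 0 < `|K| + 1 by rewrite ltr_wpDl.
pose d := (e / (`|K| + 1)) `^ a^-1.
have d0 : 0 < d by rewrite powR_gt0// divr_gt0.
apply: filterS (nbhsx_ballx x _ d0) => y; rewrite -ball_normE /= => xy.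
apply: (le_lt_trans (wK x y)).
apply: (@le_lt_trans _ _ ((`|K| + 1) * `|x - y| `^ a)).
  by rewrite ler_wpM2r ?powR_ge0// (le_trans (ler_norm K))// lerDl.
rewrite -ltr_pdivlMl// mulrC.
have -> : e / (`|K| + 1) = d `^ a.
  by rewrite /d -powRrM mulVf ?gt_eqF// powRr1// ltW// divr_gt0.
by apply: gt0_ltr_powR => //; rewrite nnegrE// ltW.
Qed.

(** Test functions at distance [2 ^ - k] from [v] converge uniformly by the sup estimate. Their
    limit inherits both estimates and the zero values outside [Omega]. *)
Lemma exists_C0_representative (v : sobolev0 Omega p) :
  exists w, [/\ C0_representative v w,
    forall x, `|w x| <= morrey_cst * `|v| &
    forall x y, `|w x - w y| <=
      morrey_cst * `|v| * `|x - y| `^ (1 - n%:R / (p : R))].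
Proof.
have C0 := morrey_cst_ge0.
have : closure (@test_class R n Omega p) (sobolev0_val v).
  by have := sobolev0P v; rewrite inE.
move=> cv.
have /choice[s sP] : forall k : nat, exists s : sobolev_fun Omega p,
    [/\ test_function Omega s.1, s.2 = partial^~ s.1 &
     `|seminorm_class _ s - sobolev0_val v| <= 2^-1 ^+ k].
  move=> k; have e0 : 0 < (2^-1 : R) ^+ k by rewrite exprn_gt0.
  have [_ [[s -> [ts gs]] sv]] := cv _ (nbhsx_ballx (sobolev0_val v) _ e0).
  by exists s; split=> //; rewrite -ball_normE /= in sv; rewrite distrC ltW.
pose f k := (s k).1.
(* Consecutive approximations differ in norm by at most [2 ^ - k.+1 + 2 ^ - k], hence by at most
   [2 * 2 ^ - k]. *)
have inc k x : `|f k.+1 x - f k x| <= morrey_cst * 2 * 2^-1 ^+ k.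
  have [tk gk nk] := sP k; have [tk1 gk1 nk1] := sP k.+1.
  pose d := (-1 : R) *: s k + s k.+1.
  have td : test_function Omega d.1 by rewrite /d /=; exact: test_function_linear.
  have gd : d.2 = partial^~ d.1.
    apply/funext => i; have [sfk _ _] := tk; have [sfk1 _ _] := tk1.
    have [_ E] := smooth_linear (-1) sfk sfk1.
    rewrite [RHS](E [:: i]) /=.
    have -> : partial i (s k).1 = (s k).2 i by rewrite gk.
    by have -> : partial i (s k.+1).1 = (s k.+1).2 i by rewrite gk1.
  have [_ /(_ x) h _] := test_function_morrey td gd.
  have -> : f k.+1 x - f k x = d.1 x.
    by rewrite /d /= !fctE /= scaleN1r addrC.
  apply: (le_trans h); rewrite -mulrA ler_wpM2l//.
  have -> : sobolev_norm d = `|seminorm_class (sobolev_seminorm Omega p) d|.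
    by rewrite norm_seminorm_class.
  rewrite seminorm_classD seminorm_classZ scaleN1r addrC.
  apply: (le_trans (ler_distD (sobolev0_val v) _ _)).
  rewrite (distrC (sobolev0_val v)) (le_trans (lerD nk1 nk))// exprS.
  have : 0 <= (2^-1 : R) ^+ k by rewrite exprn_ge0.
  lra.
have half01 : 0 <= (2^-1 : R) < 1 by lra.
have half2 : (1 - 2^-1 : R)^-1 = 2 by field.
have e0 k : 0 <= (2^-1 : R) ^+ k by rewrite exprn_ge0.
have /choice[w wP] : forall x, exists l, (f ^~ x) @ \oo --> l /\
    forall k, `|f k x - l| <= morrey_cst * 2 * 2^-1 ^+ k / (1 - 2^-1).
  by move=> x; apply: geometric_increments_cvg => // k; exact: inc.
have fw k x : `|f k x - w x| <= morrey_cst * 4 * 2^-1 ^+ k.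
  have [_ /(_ k)] := wP x; rewrite half2 => /le_trans -> //.
  by rewrite le_eqVlt; apply/orP; left; apply/eqP; ring.
have sN k : sobolev_norm (s k) <= `|v| + 2^-1 ^+ k.
  have -> : sobolev_norm (s k) = `|seminorm_class (sobolev_seminorm Omega p) (s k)|.
    by rewrite norm_seminorm_class.
  have [_ _ nk] := sP k.
  by rewrite -[X in `|X| <= _](subrKC (sobolev0_val v)) (le_trans (ler_normD _ _))// lerD2l.
have wh x y : `|w x - w y| <= morrey_cst * `|v| * `|x - y| `^ (1 - n%:R / (p : R)).
  set P := _ `^ _; have P0 : 0 <= P by exact: powR_ge0.
  rewrite -subr_le0.
  (* One error comes from the norm of [s k], which exceeds that of [v] by at most [2 ^ - k]; the
     other two are the uniform distances of [f k] and [w] at [x] and [y]. *)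
  apply: (@le_half_expn_le0 _ _ (morrey_cst * P + morrey_cst * 8)) => k.
  have [tk gk _] := sP k; have [_ _ /(_ x y) h] := test_function_morrey tk gk.
  have h1 := fw k x; have h2 := fw k y.
  have h3 : morrey_cst * sobolev_norm (s k) * P <= morrey_cst * (`|v| + 2^-1 ^+ k) * P.
    by rewrite ler_wpM2r// ler_wpM2l.
  have h4 : `|w x - w y| <= `|f k x - w x| + `|f k x - f k y| + `|f k y - w y|.
    rewrite (distrC _ (w x)) (le_trans (ler_distD (f k y) _ _))// lerD2r.
    exact: ler_distD.
  rewrite -/P in h.
  have -> : (morrey_cst * P + morrey_cst * 8) * 2^-1 ^+ k =
    morrey_cst * (`|v| + 2^-1 ^+ k) * P + morrey_cst * 4 * 2^-1 ^+ k +
    morrey_cst * 4 * 2^-1 ^+ k - morrey_cst * `|v| * P by ring.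
  move: h h1 h2 h3 h4; rewrite -/(f k x); lra.
exists w; split=> //; last first.
  move=> x; rewrite -subr_le0; apply: (@le_half_expn_le0 _ _ (morrey_cst * 5)) => k.
  have [tk gk _] := sP k; have [_ /(_ x) h _] := test_function_morrey tk gk.
  have h1 := fw k x.
  have h3 : morrey_cst * sobolev_norm (s k) <= morrey_cst * (`|v| + 2^-1 ^+ k).
    by rewrite ler_wpM2l.
  have h4 : `|w x| <= `|f k x - w x| + `|f k x|.
    by rewrite -{1}(subKr (f k x) (w x)) [leRHS]addrC; exact: ler_normB.
  move: h h1 h3 h4; rewrite -/(f k x); lra.
have cw : continuous w by exact: hoelder_continuous wh.
split=> [//|x nOx|].
  apply/normr0_eq0/le_anti; rewrite normr_ge0 andbT.
  apply: (@le_half_expn_le0 _ _ (morrey_cst * 4)) => k.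
  have [[_ _ sub] _ _] := sP k; have := fw k x.
  rewrite (test_function_supp (f := f k)) ?sub0r ?normrN//.
  by move=> /sub.
pose r := seminorm_repr (sobolev0_val v).
have rL : Lp Omega p r.1 by have /asboolP[] := sobolev_funP r.
have mu0 : 0 <= fine (lam Omega) `^ (p : R)^-1 by exact: powR_ge0.
(* Both [w] and the chosen representative of [v] are limits of [f k] in Lp, so they agree almost
   everywhere on [Omega]. *)
have wf k : Lp Omega p (w - f k) /\ Lp_norm Omega p (w - f k) <=
    morrey_cst * 4 * 2^-1 ^+ k * fine (lam Omega) `^ (p : R)^-1.
  have [tk _ _] := sP k.
  apply: bounded_Lp => // [|x].
    apply: measurable_funB; first exact: continuous_measurable_rV.
    by apply: continuous_measurable_rV; exact: test_function_continuous tk.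
  by rewrite /= distrC.
have fr k : Lp Omega p (f k - r.1) /\ Lp_norm Omega p (f k - r.1) <= 2^-1 ^+ k.
  pose d := (-1 : R) *: r + s k.
  have dE : d.1 = f k - r.1 by rewrite /d /= scaleN1r addrC.
  have /asboolP[dL _ _] := sobolev_funP d; rewrite dE in dL; split=> //.
  have [_ _ nk] := sP k; rewrite -dE; apply: le_trans nk.
  have -> : seminorm_class (sobolev_seminorm Omega p) (s k) - sobolev0_val v =
      seminorm_class (sobolev_seminorm Omega p) d.
    by rewrite seminorm_classD seminorm_classZ scaleN1r addrC seminorm_reprK.
  rewrite norm_seminorm_class /= /sobolev_norm lerDl sumr_ge0// => i _.
  by rewrite fine_ge0// Lnorm_ge0.
have wr : w - r.1 = (w - f 0%N) + (f 0%N - r.1) by rewrite addrA subrK.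
have wrL : Lp Omega p (w - r.1).
  by rewrite wr; apply: LpD; [have [] := wf 0%N|have [] := fr 0%N].
have : Lp_norm Omega p (w - r.1) = 0.
  apply/eqP; rewrite eq_le fine_ge0 ?Lnorm_ge0// andbT.
  apply: (@le_half_expn_le0 _ _
    (morrey_cst * 4 * fine (lam Omega) `^ (p : R)^-1 + 1)) => k.
  have [wL wN] := wf k; have [fL fN] := fr k.
  have -> : w - r.1 = (w - f k) + (f k - r.1) by rewrite addrA subrK.
  apply: (le_trans (Lp_normD wL fL)); apply: (le_trans (lerD wN fN)).
  by rewrite le_eqVlt; apply/orP; left; apply/eqP; ring.
move=> /(Lp_norm_eq0 wrL); apply: filterS => x /[apply] /=.
by rewrite /sobolev_value -/r => /eqP; rewrite subr_eq0 => /eqP.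
Qed.

Lemma continuous_ae_eq0 (w : 'rV[R]_n -> R) : continuous w ->
  {ae lam, forall x, Omega x -> w x = 0} -> forall x, Omega x -> w x = 0.
Proof.
move=> cw w0 x Ox; apply: contrapT => /eqP wx.
pose U := Omega `&` w @^-1` [set~ 0].
have oU : open U.
  apply: openI => //; move/continuousP : cw; apply.
  exact/closed_openC/closed_eq.
have mU : measurable U by exact: open_measurable_rV.
have := lebesgue_open_gt0 oU (conj Ox (elimN eqP wx)).
suff U0 : lam U = 0 by rewrite [X in (0 < X)%E -> _]U0 ltxx.
apply/(negligibleP _ mU); apply: negligibleS w0 => y [Oy /= wy].
by move=> /(_ Oy).
Qed.

Lemma C0_representative_eq (v : sobolev0 Omega p) w w' :
  C0_representative v w -> C0_representative v w' -> w = w'.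
Proof.
move=> [cw w0 wv] [cw' w0' wv'].
apply/funext => x; have [Ox|nOx] := pselect (Omega x); last by rewrite w0// w0'.
apply/eqP; rewrite -subr_eq0; apply/eqP.
apply: (@continuous_ae_eq0 (w - w')) => //.
  by move=> y; apply: continuousB; [exact: cw|exact: cw'].
apply: filterS2 wv wv' => y vy v'y Oy.
by rewrite !fctE vy// -v'y// subrr.
Qed.

Lemma embeddingP (v : sobolev0 Omega p) : C0_representative v (embedding v).
Proof.
by apply: xgetPex; have [w [wv _ _]] := exists_C0_representative v; exists w.
Qed.

Lemma embedding_sup (v : sobolev0 Omega p) x :
  `|embedding v x| <= morrey_cst * `|v|.
Proof.
have [w [wv h _]] := exists_C0_representative v.
by rewrite (C0_representative_eq (embeddingP v) wv).
Qed.

Lemma embedding_hoelder (v : sobolev0 Omega p) x y :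
  `|embedding v x - embedding v y| <=
    morrey_cst * `|v| * `|x - y| `^ (1 - n%:R / (p : R)).
Proof.
have [w [wv _ h]] := exists_C0_representative v.
by rewrite (C0_representative_eq (embeddingP v) wv).
Qed.

Lemma embedding_linear a (v v' : sobolev0 Omega p) :
  embedding (a *: v + v') = a *: embedding v + embedding v'.
Proof.
have [cw w0 wv] := embeddingP v; have [cw' w0' wv'] := embeddingP v'.
apply: C0_representative_eq (embeddingP _) _; split.
- by move=> x; apply: continuousD; [apply: continuousZl_tmp; exact: cw|exact: cw'].
- by move=> x nOx; rewrite !fctE /= w0// w0'// scaler0 addr0.
pose r := seminorm_repr (sobolev0_val v); pose r' := seminorm_repr (sobolev0_val v').
have := @sobolev_fun_ae (a *: r + r') (a *: v + v').
rewrite seminorm_classD seminorm_classZ !seminorm_reprK => /(_ erefl).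
apply: filterS3 wv wv' => x vx v'x vv'x Ox.
by rewrite !fctE /= vx// v'x// -vv'x.
Qed.

End sobolev_embedding.

(** * Schoenberg's space-filling curve *)

Section schoenberg_curve.
Context {R : realType}.

Let half01 : 0 <= (2^-1 : R) < 1. Proof. lra. Qed.
Let third01 : 0 <= (3^-1 : R) < 1. Proof. lra. Qed.

(* The digit reader of Schoenberg's space-filling curve, whose coordinates are *)
(* [\sum_k pulse (3 ^+ (k * n + i) * t) / 2 ^+ k.+1]; any even, 2-periodic *)
(* continuous function to [0, 1] that is 0 on [0, 1/3] and 1 on [2/3, 1] does. *)
Definition pulse (t : R) : R :=
  Num.max 0 (Num.min 1 (2^-1 - cos (pi * t) / (2 * cos (pi / 3)))).

Let pi3_gt0 : 0 < cos (pi / 3 : R).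
Proof. by apply: cos_gt0_pihalf; have := pi_gt0 R; lra. Qed.

Lemma continuous_pulse : continuous pulse.
Proof.
pose g t : R := 2^-1 - cos (pi * t) / (2 * cos (pi / 3)).
have cg : continuous g.
  move=> t; apply: cvgB; first exact: cvg_cst.
  apply: cvgMl; apply: (@continuous_comp _ _ _ ( *%R pi) cos).
    exact: mulrl_continuous.
  exact: continuous_cos.
move=> t; apply: (@continuous_max _ _ (cst 0) (cst 1 \min g)).
  exact: cst_continuous.
by apply: continuous_min; [exact: cst_continuous|exact: cg].
Qed.

Lemma pulse_ge0 t : 0 <= pulse t.
Proof. by rewrite /pulse le_max lexx. Qed.

Lemma pulse_le1 t : pulse t <= 1.
Proof. by rewrite /pulse ge_max ler01 ge_min lexx. Qed.

Lemma pulse_periodic t (k : nat) : pulse (t + 2 * k%:R) = pulse t.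
Proof.
rewrite /pulse; congr (Num.max _ (Num.min _ (_ - _ / _))).
elim: k => [|k ih]; first by rewrite mulr0 addr0.
rewrite -ih -[RHS](cosD2pi (pi * (t + 2 * k%:R))); congr cos.
by rewrite -natr1; ring.
Qed.

Lemma pulse0 t : 0 <= t <= 3^-1 -> pulse t = 0.
Proof.
move=> /andP[t0 t3]; have pi0 := pi_gt0 R.
apply/max_idPl; rewrite ge_min subr_le0; apply/orP; right.
rewrite ler_pdivlMr ?mulr_gt0//.
have : cos (pi / 3) <= cos (pi * t).
  rewrite leNgt ltr_cos ?in_itv/= -?leNgt; [nra| |nra].
  by apply/andP; split; lra.
lra.
Qed.

Lemma pulse1 t : 2 / 3 <= t <= 1 -> pulse t = 1.
Proof.
move=> /andP[t0 t1]; have pi0 := pi_gt0 R.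
rewrite /pulse; have -> : Num.min 1 (2^-1 - cos (pi * t) / (2 * cos (pi / 3))) = 1.
  apply/min_idPl.
  have h : cos (pi * t) <= - cos (pi / 3).
    have -> : - cos (pi / 3) = cos (- (pi / 3) + pi) :> R by rewrite cosDpi cosN.
    have h1 : pi * (2 / 3) <= pi * t by rewrite ler_wpM2l// ltW.
    have h2 : pi * t <= pi by rewrite ler_piMr// ltW.
    rewrite leNgt ltr_cos ?in_itv/= -?leNgt; first lra.
      by apply/andP; split; lra.
    by apply/andP; split; lra.
  have -> : 2^-1 - cos (pi * t) / (2 * cos (pi / 3)) =
      (cos (pi / 3) - cos (pi * t)) / (2 * cos (pi / 3)).
    by field; rewrite gt_eqF.
  rewrite ler_pdivlMr ?mulr_gt0//; lra.
by rewrite maxC; apply/max_idPl.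
Qed.

Implicit Types a : nat -> bool.

Definition ternary_sum a N : R := \sum_(i < N) 2 * (a i)%:R / 3 ^+ i.+1.

(** The point of the Cantor set with ternary digits [2 * a i]. *)
Definition ternary_code a : R := limn (ternary_sum a).

Lemma ternary_sum_cvg a : ternary_sum a @ \oo --> ternary_code a.
Proof.
have [|l [cl _]] := @geometric_increments_cvg _ (ternary_sum a) 1 _ third01.
  move=> N; rewrite /ternary_sum big_ord_recr /= addrAC subrr add0r.
  rewrite ger0_norm ?divr_ge0 ?mulr_ge0 ?exprn_ge0// mul1r exprS invfM exprVn mulrA.
  by rewrite ler_piMl ?invr_ge0 ?exprn_ge0//; case: (a N); rewrite ?mulr1n ?mulr0n; lra.
by rewrite /ternary_code (cvg_lim _ cl).
Qed.

Lemma ternary_codeS a :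
  ternary_code a = (2 * (a 0%N)%:R + ternary_code (a \o succn)) / 3.
Proof.
have h := ternary_sum_cvg (a := a); rewrite -cvg_shiftS in h.
apply/esym; apply: cvg_unique h => //.
have -> : (fun N => ternary_sum a N.+1) =
    (fun N => (2 * (a 0%N)%:R + ternary_sum (a \o succn) N) / 3).
  apply/funext => N; rewrite /ternary_sum big_ord_recl /= [RHS]mulrDl; congr (_ + _).
  by rewrite mulr_suml; apply: eq_bigr => i _; rewrite /bump leq0n add1n exprS invfM; ring.
apply: cvgMl; apply: cvgD; first exact: cvg_cst.
exact: ternary_sum_cvg.
Qed.

Lemma ternary_code_ge0 a : 0 <= ternary_code a.
Proof.
apply: (ler_cvg_to (cvg_cst 0) (ternary_sum_cvg (a := a))).
by apply: nearW => N; apply: sumr_ge0 => i _; rewrite divr_ge0 ?exprn_ge0 ?mulr_ge0.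
Qed.

Lemma ternary_code_le1 a : ternary_code a <= 1.
Proof.
apply: (ler_cvg_to (@ternary_sum_cvg a) (cvg_cst (1 : R))).
apply: nearW => N; suff : ternary_sum a N <= 1 - 3^-1 ^+ N.
  by move/le_trans; apply; rewrite lerBlDr lerDl exprn_ge0.
elim: N => [|N ih]; first by rewrite /ternary_sum big_ord0 expr0 subrr.
rewrite /ternary_sum big_ord_recr /= -/(ternary_sum a N) exprSr exprSr invfM -exprVn.
have : 0 <= (3^-1 : R) ^+ N by rewrite exprn_ge0.
by case: (a N); rewrite ?mulr1n ?mulr0n; lra.
Qed.

(** Multiplying by 3 yields an even integer plus the code of the shifted sequence, and the even
    integer is absorbed by periodicity. The first digit of a code decides between [[0, 1/3]] and
    [[2/3, 1]], where [pulse] is constant. *)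
Lemma pulse_ternary_code a k : pulse (3 ^+ k * ternary_code a) = (a k)%:R.
Proof.
elim: k a => [|k ih] a.
  rewrite expr0 mul1r ternary_codeS.
  have := ternary_code_ge0 (a \o succn); have := ternary_code_le1 (a \o succn).
  case: (a 0%N) => h1 h2; first by rewrite pulse1// ?mulr1n; lra.
  by rewrite pulse0// mulr0n; lra.
have -> : 3 ^+ k.+1 * ternary_code a =
    3 ^+ k * ternary_code (a \o succn) + 2 * (3 ^ k * a 0%N)%:R.
  by rewrite (ternary_codeS a) exprS natrM natrX; field.
by rewrite pulse_periodic ih.
Qed.

Definition bit (k : nat) (x : R) : bool :=
  2^-1 <= iter k (fun r => 2 * r - (2^-1 <= r)%R%:R) x.

(** The remainder after [N] binary digits is the iterate [r N] in [[0, 1]] divided by [2 ^ N]. The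
    point 1 is covered, with all digits equal to one. *)
Lemma bit_sum x N : 0 <= x <= 1 ->
  0 <= x - \sum_(k < N) (bit k x)%:R / 2 ^+ k.+1 <= 2^-1 ^+ N.
Proof.
move=> /andP[x0 x1]; pose r k := iter k (fun r => 2 * r - (2^-1 <= r)%R%:R) x.
have rb k : 0 <= r k <= 1.
  elim: k => [|k /andP[r0 r1]]; first by rewrite /r /= x0.
  by rewrite /r /= -/(r k); case: (leP 2^-1 (r k)) => h; rewrite ?mulr1n ?mulr0n; lra.
have -> : x - \sum_(k < N) (bit k x)%:R / 2 ^+ k.+1 = r N * 2^-1 ^+ N.
  elim: N => [|N ih]; first by rewrite big_ord0 subr0 /r /= mulr1.
  rewrite big_ord_recr /= opprD addrA ih /bit -/(r N) /r /= -/(r N) !exprS invfM exprVn.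
  by field.
have /andP[r0 r1] := rb N.
have h : 0 <= (2^-1 : R) ^+ N by rewrite exprn_ge0.
by rewrite mulr_ge0//= ler_piMl.
Qed.

Lemma measurable_bit k : measurable_fun setT (fun x : R => ((bit k x)%:R : R)).
Proof.
have m (f : R -> R) : measurable_fun setT f ->
    measurable_fun setT (fun x => ((2^-1 <= f x)%R%:R : R)).
  move=> mf; have -> : (fun x => ((2^-1 <= f x)%R%:R : R)) = \1_(f @^-1` `[2^-1, +oo[).
    apply/funext => x; rewrite indicE; congr ((nat_of_bool _)%:R).
    by apply/idP/idP; rewrite inE /= in_itv/= andbT.
  apply: measurable_indic; rewrite -[X in measurable X]setTI; exact: mf.
apply: (m (iter k _)); elim: k => [|k ih] /=; first exact: measurable_id.
by apply: measurable_funB; [exact: measurable_funM|exact: m].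
Qed.

(** One coordinate of the curve: the frequencies [s k] select the ternary digits that are read as
    binary digits. *)
Definition bit_series (s : nat -> R) : R -> R := fun t =>
  limn (fun N => \sum_(k < N) pulse (s k * t) / 2 ^+ k.+1).

Lemma bit_series_cvg (s : nat -> R) t :
  (fun N => \sum_(k < N) pulse (s k * t) / 2 ^+ k.+1) @ \oo --> bit_series s t /\
  forall N, `|\sum_(k < N) pulse (s k * t) / 2 ^+ k.+1 - bit_series s t| <= 2^-1 ^+ N.
Proof.
have [|l [cl lb]] := @geometric_increments_cvg _
    (fun N => \sum_(k < N) pulse (s k * t) / 2 ^+ k.+1) 2^-1 _ half01.
  move=> N; rewrite big_ord_recr /= addrAC subrr add0r.
  rewrite ger0_norm ?divr_ge0 ?exprn_ge0 ?pulse_ge0//.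
  by rewrite exprS invfM exprVn ler_piMl ?pulse_le1//.
rewrite /bit_series (cvg_lim _ cl)//; split=> // N.
by rewrite (le_trans (lb N))// le_eqVlt; apply/orP; left; apply/eqP; field.
Qed.

Lemma continuous_bit_series s : continuous (bit_series s).
Proof.
move=> t; apply/cvgrPdist_lt => e e0.
have e3 : 0 < e / 3 by rewrite divr_gt0.
have [N Ne] : exists N, (2^-1 : R) ^+ N < e / 3.
  have : (fun N => (2^-1 : R) ^+ N) @ \oo --> 0.
    by apply: cvg_expr; rewrite ger0_norm ?invr_ge0// invf_lt1 ?ltr1n.
  move=> /cvgrPdist_lt/(_ _ e3)[N _ /(_ N (leqnn N))].
  by rewrite sub0r normrN ger0_norm ?exprn_ge0// => ?; exists N.
pose F u := \sum_(k < N) pulse (s k * u) / 2 ^+ k.+1.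
have cF : {for t, continuous F}.
  rewrite /F; elim: (N) => [|m ih].
    by under [X in {for _, continuous X}]eq_fun do rewrite big_ord0; exact: cst_continuous.
  under [X in {for _, continuous X}]eq_fun do rewrite big_ord_recr /=.
  apply: cvgD; first exact: ih.
  apply: cvgMl; apply: (@continuous_comp _ _ _ ( *%R (s m)) pulse).
    exact: mulrl_continuous.
  exact: continuous_pulse.
have /cvgrPdist_lt/(_ _ e3) := cF; apply: filterS => u hu.
have [_ /(_ N) h1] := bit_series_cvg s t; have [_ /(_ N) h2] := bit_series_cvg s u.
rewrite -/(F t) in h1; rewrite -/(F u) in h2.
have h4 : `|bit_series s t - bit_series s u| <=
    `|F t - bit_series s t| + `|F t - F u| + `|F u - bit_series s u|.
  rewrite (distrC _ (bit_series s t)) (le_trans (ler_distD (F u) _ _))// lerD2r.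
  exact: ler_distD.
lra.
Qed.

End schoenberg_curve.

Section schoenberg_rV.
Context {R : realType}.

Lemma continuous_rV (T : topologicalType) n (f : T -> 'rV[R]_n) :
  (forall i, continuous (fun t => f t ord0 i)) -> continuous f.
Proof.
move=> cf t A [P nP PA]; apply: (filterS (P := [set u | forall i j, P i j (f u i j)])).
  by move=> u h; exact: PA.
apply: filter_forall => i; apply: filter_forall => j.
by rewrite ord1 in nP *; exact: (cf j t _ (nP ord0 j)).
Qed.

(* [s x] interleaves the binary digits of the coordinates of [x], as ternary    *)
(* digits 0 and 2.                                                             *)
Lemma schoenberg_rV n (M : R) : 0 < M ->
  exists (phi : R -> 'rV[R]_n) (s : 'rV[R]_n -> R),
    [/\ continuous phi, measurable_fun setT s, forall x, 0 <= s x <= 1 &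
        forall x : 'rV[R]_n, (forall i, `|x ord0 i| <= M) -> phi (s x) = x].
Proof.
move=> M0.
pose scale (x : 'rV[R]_n) i := (x ord0 i + M) / (2 * M).
(* Digit [m] is bit [m %/ n] of the rescaled coordinate [m %% n]. The default [false] occurs only
   for [n = 0]. *)
pose a (x : 'rV[R]_n) m :=
  oapp (fun i : 'I_n => bit (m %/ n) (scale x i)) false (insub (m %% n)%N).
pose e (i : 'I_n) k : R := 3 ^+ (k * n + i).
exists (fun t => \row_i (2 * M * bit_series (e i) t - M)), (fun x => ternary_code (a x)).
split.
- apply: continuous_rV => i; under eq_fun do rewrite mxE.
  move=> t; apply: cvgB; last exact: cvg_cst.
  by apply: cvgMr; exact: continuous_bit_series.
- apply: (@measurable_fun_cvg _ _ _ _ (fun N x => ternary_sum (a x) N)); last first.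
    by move=> x _; exact: ternary_sum_cvg.
  move=> N; apply: measurable_sum => m; apply: measurable_funM => //.
  apply: measurable_funM => //; rewrite /a; case: insub => [i|] //=.
  apply: (measurableT_comp (measurable_bit (m %/ n)) (g := scale ^~ i)).
  by apply: measurable_funM => //; apply: measurable_funD => //; exact: measurable_coord.
- by move=> x; rewrite ternary_code_ge0 ternary_code_le1.
move=> x xM; apply/rowP => i; rewrite mxE.
have x01 : 0 <= scale x i <= 1.
  have := xM i; rewrite ler_norml => /andP[h1 h2].
  by rewrite divr_ge0 ?ler_pdivrMr ?mulr_gt0//=; lra.
suff -> : bit_series (e i) (ternary_code (a x)) = scale x i.
  by rewrite /scale; field; rewrite gt_eqF.
(* The constant 2 counts the tail of the series and the binary remainder, each at most [2 ^ - N]. *)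
apply/eqP; rewrite -subr_eq0 -normr_le0; apply/(@le_half_expn_le0 _ _ 2) => N.
have [_ /(_ N)] := bit_series_cvg (e i) (ternary_code (a x)).
have -> : \sum_(k < N) pulse (e i k * ternary_code (a x)) / 2 ^+ k.+1 =
    \sum_(k < N) (bit k (scale x i))%:R / 2 ^+ k.+1.
  apply: eq_bigr => k _; rewrite pulse_ternary_code; congr ((nat_of_bool _)%:R / _).
  have n0 : (0 < n)%N by exact: leq_ltn_trans (leq0n i) (ltn_ord i).
  rewrite /a modnMDl modn_small// divnMDl// divn_small// addn0.
  by rewrite (insubT (fun k => (k < n)%N) (ltn_ord i)) /=; congr (bit _ (scale _ _)); apply/val_inj.
have /andP[h1 h2] := bit_sum N x01 => h3.
rewrite distrC in h3.
rewrite (le_trans (ler_distD (\sum_(k < N) (bit k (scale x i))%:R / 2 ^+ k.+1) _ _))//.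
by rewrite [X in _ + X]distrC (ger0_norm h1) mulr_natl mulr2n lerD.
Qed.

Lemma schoenberg_prod n m (M : R) : 0 < M ->
  exists (phi : R -> 'rV[R]_n * 'rV[R]_m) (s : 'rV[R]_n * 'rV[R]_m -> R),
    [/\ continuous phi, measurable_fun setT s, forall x, 0 <= s x <= 1 &
        forall x : 'rV[R]_n * 'rV[R]_m, (forall i, `|x.1 ord0 i| <= M) -> (forall i, `|x.2 ord0 i| <= M) ->
          phi (s x) = x].
Proof.
move=> /(@schoenberg_rV (n + m))[phi [s [cphi ms s01 phiK]]].
exists (fun t => (lsubmx (phi t), rsubmx (phi t))), (fun x => s (row_mx x.1 x.2)).
have cc i : continuous (fun t => phi t ord0 i).
  move=> t; apply: (@continuous_comp _ _ _ phi (fun v => v ord0 i)); first exact: cphi.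
  exact: coord_continuous.
split=> //.
- have cl : continuous (fun t => lsubmx (phi t)).
    by apply: continuous_rV => i; under eq_fun do rewrite mxE; exact: cc.
  have cr : continuous (fun t => rsubmx (phi t)).
    by apply: continuous_rV => i; under eq_fun do rewrite mxE; exact: cc.
  move=> t; exact: (cvg_pair (cl t) (cr t)).
- apply: (measurableT_comp ms); apply: measurable_fun_rV => i.
  under eq_fun do rewrite mxE; case: splitP => j _.
    exact: (measurableT_comp (measurable_coord j) measurable_fst).
  exact: (measurableT_comp (measurable_coord j) measurable_snd).
move=> [x y] /= xM yM; rewrite phiK ?row_mxKl ?row_mxKr// => i.
by rewrite mxE; case: splitP => j _.
Qed.

End schoenberg_rV.

(** * Skorokhod representation along a subsequence *)

Section helly.
Context {R : realType}.

(** A monotone function has one-sided limits that enclose its value; where they agree, it is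
    continuous. *)
Lemma nondecreasing_not_discontinuity (G : R -> R) (a b t e : R) :
  nondecreasing_fun G -> t \in `]a, b[ -> ~ discontinuity G t -> 0 < e ->
  exists d, [/\ 0 < d, forall x, t - d < x < t -> G t - e < G x &
     forall x, t < x < t + d -> G x < G t + e].
Proof.
move=> ndG tab nd e0.
have cl : cvg (G x @[x --> t^'-]).
  apply: nondecreasing_at_left_is_cvgr.
    by apply: nearW => u x y _ _; exact: ndG.
  apply: nearW => u; exists (G t) => _ [y /= + <-].
  by rewrite in_itv /= => /andP[_ /ltW yt]; exact: ndG.
have cr : cvg (G x @[x --> t^'+]).
  apply: nondecreasing_at_right_is_cvgr.
    by apply: nearW => u x y _ _; exact: ndG.
  apply: nearW => u; exists (G t) => _ [y /= + <-].
  by rewrite in_itv /= => /andP[/ltW yt _]; exact: ndG.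
have lr : lim (G x @[x --> t^'-]) = lim (G x @[x --> t^'+]).
  by apply: contrapT => /eqP h; apply: nd.
have l1 : lim (G x @[x --> t^'-]) <= G t.
  apply: limr_le => //; near=> x; apply: ndG; apply: ltW.
  by near: x; exact: nbhs_left_lt.
have l2 : G t <= lim (G x @[x --> t^'+]).
  apply: limr_ge => //; near=> x; apply: ndG; apply: ltW.
  by near: x; exact: nbhs_right_gt.
have l3 : lim (G x @[x --> t^'-]) = G t by apply/le_anti; rewrite l1 lr l2.
have l4 : lim (G x @[x --> t^'+]) = G t by rewrite -lr.
have /cvgrPdist_lt/(_ _ e0) hl : G x @[x --> t^'-] --> G t by rewrite -l3.
have /cvgrPdist_lt/(_ _ e0) hr : G x @[x --> t^'+] --> G t by rewrite -l4.
have [d1 /= d10 h1] := hl; have [d2 /= d20 h2] := hr.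
exists (Num.min d1 d2); split; first by rewrite lt_min d10.
  move=> x /andP[tx xt]; have : `|G t - G x| < e.
    apply: h1 => //=; rewrite gtr0_norm ?subr_gt0//.
    have : Num.min d1 d2 <= d1 by rewrite ge_min lexx.
    lra.
  by rewrite ltr_norml => /andP[? ?]; lra.
move=> x /andP[tx xt]; have : `|G t - G x| < e.
  apply: h2 => //=; rewrite distrC gtr0_norm ?subr_gt0//.
  have : Num.min d1 d2 <= d2 by rewrite ge_min lexx orbT.
  lra.
by rewrite ltr_norml => /andP[? ?]; lra.
Unshelve. all: by end_near. Qed.

(* Limits along an ultrafilter define [G] everywhere; matching [G] within       *)
(* [j.+1%:R^-1] at the first [j] rationals then extracts a subsequence that    *)
(* converges wherever [G] is continuous.                                       *)
Lemma helly (X : nat -> R -> R) (c : R) :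
  (forall k, nondecreasing_fun (X k)) -> (forall k t, 0 <= X k t <= 1) ->
  exists (kappa : nat -> nat) (G : R -> R),
    [/\ forall j, (j <= kappa j)%N, nondecreasing_fun G &
      {ae lebesgue_measure, forall t, `]0, c[%classic t ->
         (fun j => X (kappa j) t) @ \oo --> G t}].
Proof.
move=> ndX X01.
have [U [UU oU]] := ultraFilterLemma (F := \oo : set_system nat) _.
have limU : forall t : R, exists g : R, (fun k => X k t) @ U --> g.
  move=> t; have UI : ((fun k => X k t) @ U) `[0, 1]%classic.
    suff : U [set k | `[0, 1]%classic (X k t)] by [].
    by apply: filterE => k /=; rewrite in_itv/=; exact: X01.
  have [g [_ cg]] := @segment_compact R 0 1 _ (fmap_proper_filter (fun k => X k t) _) UI.
  exists g => A Ag; have [//|nA] := in_ultra_setVsetC ((fun k => X k t) @^-1` A) UU.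
  by have [x [nAx Ax]] := cg (~` A) A nA Ag.
have [G GP] := choice limU.
have ndG : nondecreasing_fun G.
  move=> s t st; apply: (ler_cvg_to (GP s) (GP t)).
  by apply: filterE => k; exact: ndX.
pose r (i : nat) : R := if unpickle i is Some q then ratr q else 0.
have /choice[kappa kP] : forall j : nat, exists k, (j <= k)%N /\
    forall i : 'I_j, `|G (r i) - X k (r i)| < j.+1%:R^-1.
  move=> j; apply: (@filter_ex _ U _); apply: filterI.
    by apply: oU; exists j.
  apply: filter_forall => i.
  by have /cvgrPdist_lt := GP (r i); apply; rewrite invr_gt0.
exists kappa, G; split=> //; first by move=> j; have [] := kP j.
pose D := [set x | x \in (`]0, c[) /\ discontinuity G x].
have cD : countable D by apply: discontinuity_countable => x y _ _; exact: ndG.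
have mD : measurable D by exact: countable_measurable.
exists D; split; [exact: mD|exact: countable_lebesgue_measure0|].
move=> t /= /not_implyP[t0 nt]; split=> //; apply: contrapT => ncD; apply: nt.
apply/cvgrPdist_lt => e e0; have e2 : 0 < e / 2 by rewrite divr_gt0.
have [d [d0 dl dr]] := nondecreasing_not_discontinuity ndG t0 ncD e2.
have [q1 q1P] : exists q : rat, t - d < ratr q < t.
  have /rat_in_itvoo[q] : t - d < t by rewrite ltrBlDr ltrDl.
  by rewrite in_itv /=; exists q.
have [q2 q2P] : exists q : rat, t < ratr q < t + d.
  have /rat_in_itvoo[q] : t < t + d by rewrite ltrDl.
  by rewrite in_itv /=; exists q.
have r1 : r (pickle q1) = ratr q1 by rewrite /r pickleK.
have r2 : r (pickle q2) = ratr q2 by rewrite /r pickleK.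
have := dl _ q1P; have := dr _ q2P; rewrite -r1 -r2 => G2 G1.
(* By monotonicity the value at [t] lies between those at the two rationals, where [X (kappa j)] is
   close to [G] once [j] exceeds both codes. *)
near=> j.
have j1 : (pickle q1 < j)%N by near: j; exact: nbhs_infty_gt.
have j2 : (pickle q2 < j)%N by near: j; exact: nbhs_infty_gt.
have je : j.+1%:R^-1 < e / 2 by near: j; exact: near_infty_natSinv_lt (PosNum e2).
have [_ h] := kP j.
have := h (Ordinal j1); have := h (Ordinal j2) => /=.
rewrite !ltr_norml => /andP[a1 a2] /andP[b1 b2].
have X1 : X (kappa j) (r (pickle q1)) <= X (kappa j) t.
  by apply: ndX; rewrite r1; case/andP: q1P => _ /ltW.
have X2 : X (kappa j) t <= X (kappa j) (r (pickle q2)).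
  by apply: ndX; rewrite r2; case/andP: q2P => /ltW.
move: je a1 a2 b1 b2; move: (j.+1%:R^-1) => i je a1 a2 b1 b2.
by apply/andP; split; lra.
Unshelve. all: by end_near. Qed.

End helly.

(** * Quantile functions of measures on the unit interval *)

Section quantile.
Context {R : realType}.
Variables (nu : {finite_measure set (measurableTypeR R) -> \bar R}) (c : R).
Hypothesis nuT : nu setT = c%:E.
Hypothesis nu01 : nu (~` `[0, 1]%classic) = 0%E.

Let cdf x := fine (nu `]-oo, x]%classic).

(** Admitting [x = 1] keeps the set nonempty for every [t], so the quantile is monotone with values
    in [[0, 1]] on the whole line. *)
Definition quantile (t : R) : R :=
  inf [set x | 0 <= x <= 1 /\ (t <= cdf x \/ x = 1)].

Let mray (x : R) : measurable (`]-oo, x]%classic : set (measurableTypeR R)).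
Proof. exact: measurable_itv. Qed.

Let cdfE x : (cdf x)%:E = nu `]-oo, x]%classic.
Proof. by rewrite /cdf fineK// fin_num_measure. Qed.

Let cdf_nd x y : x <= y -> cdf x <= cdf y.
Proof.
move=> xy; rewrite -lee_fin !cdfE; apply: le_measure; rewrite ?inE//.
by apply: subset_itvl; rewrite bnd_simp.
Qed.

Let cdf_ge0 x : 0 <= cdf x. Proof. exact: fine_ge0. Qed.

Let cdf_le x : cdf x <= c.
Proof. by rewrite -lee_fin cdfE -nuT; apply: le_measure; rewrite ?inE. Qed.

Let nu_out (A : set (measurableTypeR R)) : measurable A -> A `<=` ~` `[0, 1]%classic -> nu A = 0%E.
Proof.
move=> mA A01; apply/eqP; rewrite eq_le measure_ge0 andbT -nu01.
by apply: le_measure; rewrite ?inE//; apply: measurableC; exact: measurable_itv.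
Qed.

Let cdf_lt0 x : x < 0 -> cdf x = 0.
Proof.
move=> x0; apply: EFin_inj; rewrite cdfE; apply: nu_out => // y /=.
by rewrite !in_itv/= => yx /andP[y0 _]; have := le_lt_trans yx x0; rewrite ltNge y0.
Qed.

Let nu_oray x : nu `]x, +oo[%classic = (c - cdf x)%:E.
Proof.
rewrite EFinB -nuT cdfE.
have -> : [set: measurableTypeR R] = `]-oo, x]%classic `|` `]x, +oo[%classic.
  apply/seteqP; split => // y _.
  by have [yx|xy] := leP y x; [left|right]; rewrite /= in_itv/= ?andbT.
have mo : measurable (`]x, +oo[%classic : set (measurableTypeR R)).
  exact: measurable_itv.
rewrite (measureU nu (mray x) mo); last first.
  apply/seteqP; split => // y [/=]; rewrite !in_itv/= andbT => yx xy.
  by have := le_lt_trans yx xy; rewrite ltxx.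
by rewrite addeAC subee ?add0e// fin_num_measure.
Qed.

Let cdf1 x : 1 <= x -> cdf x = c.
Proof.
move=> x1; have : nu `]x, +oo[%classic = 0%E.
  apply: nu_out => [|y /=]; first exact: measurable_itv.
  by rewrite !in_itv/= andbT => xy /andP[_ y1]; have := le_lt_trans y1 (le_lt_trans x1 xy); rewrite ltxx.
by rewrite nu_oray => -[/eqP]; rewrite subr_eq0 => /eqP.
Qed.

Let S t := [set x | 0 <= x <= 1 /\ (t <= cdf x \/ x = 1)].

Let S1 t : S t 1. Proof. by split; [rewrite ler01 lexx|right]. Qed.

Let hS t : has_inf (S t).
Proof. by split; [exists 1; exact: S1|exists 0 => x [/andP[]]]. Qed.

Lemma quantile_itv t : 0 <= quantile t <= 1.
Proof.
apply/andP; split; last by apply: ge_inf; [exact: (hS t).2|exact: S1].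
by apply: lb_le_inf; [exact: (hS t).1|move=> x [/andP[]]].
Qed.

Lemma nondecreasing_quantile : nondecreasing_fun quantile.
Proof.
move=> s t st; apply: lb_le_inf; first exact: (hS t).1.
move=> x [x01 xt]; apply: ge_inf; first exact: (hS s).2.
by split=> //; case: xt => [tx|->]; [left; exact: le_trans tx|right].
Qed.

Let cdf_right x t : (forall k : nat, t <= cdf (x + k.+1%:R^-1)) -> t <= cdf x.
Proof.
move=> h; pose I (k : nat) : set (measurableTypeR R) := `]-oo, x + k.+1%:R^-1]%classic.
have capI : \bigcap_k I k = `]-oo, x]%classic.
  apply/seteqP; split => [y yI|y /= + k _].
    rewrite /= in_itv/= leNgt; apply/negP => xy.
    have [k ky] := ltr_add_invr xy.
    by have := yI k Logic.I; rewrite /I /= in_itv/= leNgt ky.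
  by rewrite /I /= !in_itv/= => /le_trans -> //; rewrite lerDl invr_ge0.
have mI k : measurable (I k) by exact: mray.
have : nu \o I @ \oo --> nu (\bigcap_k I k).
  apply: nonincreasing_cvg_mu => //.
  - by rewrite ltey_eq fin_num_measure.
  - by rewrite capI; exact: mray.
  - move=> i j ij; apply/subsetPset; apply: subset_itvl; rewrite bnd_simp lerD2l.
    by rewrite lef_pV2 ?posrE// ler_nat.
rewrite capI -cdfE => /fine_cvgP[_ cv].
apply: (ler_cvg_to (cvg_cst t) cv); apply: nearW => k; exact: h.
Qed.

(** The Galois connection between quantile and distribution function. One direction needs
    right-continuity of the latter, since the infimum is approached from above. *)
Lemma quantile_le t x : 0 < t < c -> (quantile t <= x) = (t <= cdf x).
Proof.
move=> /andP[t0 tc]; apply/idP/idP => [qx|tx].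
  apply: cdf_right => k.
  have : quantile t < x + k.+1%:R^-1 by rewrite (le_lt_trans qx)// ltrDl invr_gt0.
  move=> /(inf_lt (hS t).1) [y [_ yt] yx].
  apply: (@le_trans _ _ (cdf y)); last by apply: cdf_nd; exact: ltW.
  by case: yt => // ->; rewrite cdf1// ltW.
have [x0|x0] := ltP x 0; first by move: tx; rewrite cdf_lt0// leNgt t0.
have [x1|x1] := leP x 1.
  by apply: ge_inf; [exact: (hS t).2|split; [rewrite x0|left]].
by have /andP[_ /le_trans] := quantile_itv t; apply; exact: ltW.
Qed.

(** Measures that agree on open rays agree. By [quantile_le] the preimage of the ray above [x] is
    the interval from [cdf x] to [c], whose length is the mass of that ray. *)
Lemma quantile_pushforward (A : set (measurableTypeR R)) : measurable A ->
  lebesgue_measure (`]0, c[%classic `&` quantile @^-1` A) = nu A.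
Proof.
have mq : measurable_fun setT (quantile : measurableTypeR R -> measurableTypeR R).
  by apply: nondecreasing_measurable => //; exact: nondecreasing_quantile.
have mI : measurable (`]0, c[%classic : set (measurableTypeR R)) by exact: measurable_itv.
move=> mA; rewrite setIC.
apply: (@measure_unique _ R (measurableTypeR R) (@RGenOInfty.G R)
  (fun k => `](- k%:R), +oo[%classic) _ _ _ _
  (pushforward (mrestr lebesgue_measure mI) (quantile : measurableTypeR R -> measurableTypeR R)) nu) => //.
- exact: RGenOInfty.measurableE.
- move=> _ _ [x ->] [y ->]; exists (Num.max x y); apply/seteqP; split => z /=.
    by rewrite !in_itv/= !andbT gt_max => -[-> ->].
  by rewrite !in_itv/= !andbT gt_max => /andP[].
- by move=> k; exists (- k%:R).
- apply/seteqP; split => // y _; exists (Num.truncn (- y)).+1 => //=.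
  by rewrite in_itv/= andbT ltrNl; exact: truncnS_gt.
- move=> _ [x ->]; transitivity (c - cdf x)%:E; last exact: (esym (nu_oray x)).
  rewrite /pushforward /mrestr.
  transitivity (lebesgue_measure (`]cdf x, c[%classic : set (measurableTypeR R))).
    apply: (congr1 lebesgue_measure); apply/seteqP; split => t /=; rewrite !in_itv/= ?andbT.
      by move=> [xt t0c]; move: xt; rewrite ltNge quantile_le// -ltNge => ->; case/andP: t0c.
    move=> /andP[xt tc]; have t0c : 0 < t < c by rewrite tc (le_lt_trans (cdf_ge0 x) xt).
    by rewrite ltNge quantile_le// -ltNge.
  rewrite lebesgue_measure_itv/= lte_fin; case: ltP => // h.
  by congr (_%:E); apply/eqP; rewrite eq_sym subr_eq0 eq_le h cdf_le.
- move=> k; apply: (@le_lt_trans _ _ (lebesgue_measure (`]0, c[%classic : set (measurableTypeR R)))).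
    apply: le_measure; rewrite ?inE//; first apply: measurableI => //.
    by rewrite -[X in measurable X]setTI; apply: mq => //; exact: measurable_itv.
  by rewrite lebesgue_measure_itv/=; case: ifP => _; rewrite ltry.
Qed.

End quantile.

Section finite_measure_of_measure.
Context d (T : measurableType d) (R : realType).
Variable nu : {measure set T -> \bar R}.

(** The finiteness proof is an argument so that the structure instances below can recover it from
    the term. *)
Definition finite_measure_of of fin_num_fun nu : set T -> \bar R := nu.

Hypothesis fin : fin_num_fun nu.
Local Notation k := (finite_measure_of fin).

Let k0 : k set0 = 0%E. Proof. exact: measure0. Qed.

Let k_ge0 A : (0 <= k A)%E. Proof. exact: measure_ge0. Qed.

Let k_sigma_additive : semi_sigma_additive k.
Proof. exact: measure_semi_sigma_additive. Qed.

HB.instance Definition _ := isMeasure.Build _ _ _ k k0 k_ge0 k_sigma_additive.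
HB.instance Definition _ := @Measure_isFinite.Build _ _ _ k fin.

Lemma exists_finite_measure :
  exists nu' : {finite_measure set T -> \bar R}, forall A, nu' A = nu A.
Proof. by exists k. Qed.

End finite_measure_of_measure.

Lemma exists_finite_pushforward d1 d2 (T1 : measurableType d1)
  (T2 : measurableType d2) (R : realType)
  (mu : {finite_measure set T1 -> \bar R}) (f : T1 -> T2) : measurable_fun setT f ->
  exists nu : {finite_measure set T2 -> \bar R}, forall A, nu A = mu (f @^-1` A).
Proof.
move=> mf; pose nu : {measure set T2 -> \bar R} := pushforward mu f.
apply: (exists_finite_measure (nu := nu mf)) => A mA; apply: fin_num_measure.
by rewrite -[X in measurable X]setTI; exact: mf.
Qed.

Lemma measure_eq_on_carrier d (T : measurableType d) (R : realType)
  (mu : {finite_measure set T -> \bar R}) (K A B : set T) :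
  (forall C, measurable C -> C `<=` ~` K -> mu C = 0%E) ->
  measurable A -> measurable B -> (forall z, K z -> (A z <-> B z)) -> mu A = mu B.
Proof.
move=> muK mA mB AB.
have E C D : measurable C -> measurable D -> (forall z, K z -> C z -> D z) ->
    mu C = mu (C `&` D).
  move=> mC mD CD.
  have -> : mu C = (mu (C `\` D) + mu (C `&` D))%E by exact: measureDI.
  rewrite muK ?add0e//; first exact: measurableD.
  by move=> z [Cz nDz] Kz; apply: nDz; exact: CD.
rewrite (E A B)// ?(E B A) ?(setIC B)// => z Kz; first by case: (AB z Kz).
by case: (AB z Kz).
Qed.

Section skorokhod.
Context {R : realType} {n m : nat}.
Local Notation T := ('rV[R]_n * 'rV[R]_m)%type.

Definition box_prod (M : R) : set T :=
  [set z : T | (forall i, `|z.1 ord0 i| <= M) /\ (forall i, `|z.2 ord0 i| <= M)].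

Lemma measurable_fun_continuous_prod (phi : R -> T) :
  continuous phi -> measurable_fun setT (phi : measurableTypeR R -> T).
Proof.
move=> cphi; rewrite (_ : phi = fun t => ((phi t).1, (phi t).2)); last first.
  by apply/funext => t; case: (phi t).
have c1 : continuous (fun t => (phi t).1).
  by move=> t; apply: (@continuous_comp _ _ _ phi fst); [exact: cphi|exact: cvg_fst].
have c2 : continuous (fun t => (phi t).2).
  by move=> t; apply: (@continuous_comp _ _ _ phi snd); [exact: cphi|exact: cvg_snd].
apply: measurable_fun_pair; apply: measurable_fun_rV => i.
  apply: continuous_measurable_fun => t.
  apply: (@continuous_comp _ _ _ (fun t => (phi t).1) (fun v => v ord0 i)); first exact: c1.
  exact: coord_continuous.
apply: continuous_measurable_fun => t.
apply: (@continuous_comp _ _ _ (fun t => (phi t).2) (fun v => v ord0 i)); first exact: c2.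
exact: coord_continuous.
Qed.

(* Pushing the measures to [0, 1] by a section of a space-filling curve leaves  *)
(* the one-dimensional case, where quantile functions represent them.          *)
Lemma skorokhod (mu : nat -> {finite_measure set T -> \bar R}) (c M : R) :
  0 < M -> (forall k, mu k setT = c%:E) ->
  (forall k A, measurable A -> A `<=` ~` box_prod M -> mu k A = 0%E) ->
  exists (kappa : nat -> nat) (P : {finite_measure set (measurableTypeR R) -> \bar R})
    (Y : nat -> measurableTypeR R -> T) (Z : measurableTypeR R -> T),
    [/\ forall j, (j <= kappa j)%N,
        forall j, measurable_fun setT (Y j),
        measurable_fun setT Z,
        forall j A, measurable A -> mu (kappa j) A = P (Y j @^-1` A) &
        {ae P, forall t, (fun j => Y j t) @ \oo --> Z t}].
Proof.
move=> M0 muT mu0.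
have [phi [s [cphi ms s01 phiK]]] := schoenberg_prod n m M0.
have mphi := measurable_fun_continuous_prod cphi.
have /choice[nu nuE] : forall k, exists nu : {finite_measure set (measurableTypeR R) -> \bar R},
    forall A, nu A = mu k (s @^-1` A).
  by move=> k; exact: exists_finite_pushforward.
have nuT k : nu k setT = c%:E by rewrite nuE preimage_setT muT.
have nu01 k : nu k (~` `[0, 1]%classic) = 0%E.
  rewrite nuE (_ : _ @^-1` _ = set0) ?measure0//.
  apply/seteqP; split => // z /=; apply.
  by rewrite in_itv/=; exact: s01.
pose X k := quantile (nu k).
have [kappa [G [kj ndG [N [mN N0 NG]]]]] := @helly _ X c
  (fun k => @nondecreasing_quantile _ (nu k)) (fun k => @quantile_itv _ (nu k)).
have mI : measurable (`]0, c[%classic : set (measurableTypeR R)) by exact: measurable_itv.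
have [P PE] : exists P : {finite_measure set (measurableTypeR R) -> \bar R},
    forall A, P A = lebesgue_measure (A `&` `]0, c[).
  apply: (exists_finite_measure (nu := mrestr lebesgue_measure mI)) => A mA.
  rewrite ge0_fin_numE//; apply: (@le_lt_trans _ _ (lebesgue_measure
      (`]0, c[%classic : set (measurableTypeR R)))).
    by apply: le_measure; rewrite ?inE//; exact: measurableI.
  by rewrite lebesgue_measure_itv/=; case: ifP => _; rewrite ltry.
have mX k : measurable_fun setT (X k : measurableTypeR R -> measurableTypeR R).
  by apply: nondecreasing_measurable => //; exact: nondecreasing_quantile.
exists kappa, P, (fun j => phi \o X (kappa j)), (phi \o G); split => //.
- by move=> j; exact: (measurableT_comp mphi (mX _)).
- by apply: (measurableT_comp mphi); apply: nondecreasing_measurable.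
- move=> j A mA; have mpA : measurable (phi @^-1` A).
    by rewrite -[X in measurable X]setTI; exact: mphi.
  rewrite PE comp_preimage setIC (quantile_pushforward (nuT _) (nu01 _))// nuE.
  have msA : measurable (s @^-1` (phi @^-1` A)).
    by rewrite -[X in measurable X]setTI; exact: ms.
  (* [phi] inverts [s] only on the box, which carries the measures. *)
  apply: measure_eq_on_carrier (mu0 (kappa j)) _ _ _ => // z [z1 z2].
  by rewrite /preimage /= phiK.
apply: (negligibleS (A := N `|` ~` `]0, c[)); last first.
  exists (N `|` ~` `]0, c[%classic); split=> //.
    by apply: measurableU => //; exact: measurableC.
  transitivity (lebesgue_measure ((N `|` ~` `]0, c[%classic) `&` `]0, c[%classic)); first exact: PE.
  rewrite setIUl setICl setU0; apply/eqP; rewrite eq_le measure_ge0 andbT.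
  by rewrite -N0; apply: le_measure; rewrite ?inE//; exact: measurableI.
move=> t /= nt; have [tI|] := pselect (`]0, c[%classic t); last by right.
left; apply: NG => /= /(_ tI) cXt; apply: nt.
exact: (cvg_comp _ _ cXt (cphi (G t))).
Qed.

End skorokhod.

(** * Marginals of almost sure limits *)

Section measurable_prod.
Context {R : realType} {n m : nat}.
Local Notation T := ('rV[R]_n * 'rV[R]_m)%type.

(** The product sigma-algebra contains the open sets of the product: concatenation of rows is
    measurable into the Borel sets of the larger row space, and splitting a row is continuous. *)
Lemma open_measurable_prod (W : set T) : open W -> measurable W.
Proof.
move=> oW; pose sp (v : 'rV[R]_(n + m)) : T := (lsubmx v, rsubmx v).
have csp : continuous sp.
  have cl : continuous (fun v : 'rV[R]_(n + m) => lsubmx v).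
    by apply: continuous_rV => i; under eq_fun do rewrite mxE; exact: coord_continuous.
  have cr : continuous (fun v : 'rV[R]_(n + m) => rsubmx v).
    by apply: continuous_rV => i; under eq_fun do rewrite mxE; exact: coord_continuous.
  by move=> v; exact: (cvg_pair (cl v) (cr v)).
have mrow : measurable_fun setT (fun z : T => row_mx z.1 z.2).
  apply: measurable_fun_rV => i.
  under eq_fun do rewrite mxE; case: splitP => j _.
    exact: (measurableT_comp (measurable_coord j) measurable_fst).
  exact: (measurableT_comp (measurable_coord j) measurable_snd).
have -> : W = (fun z : T => row_mx z.1 z.2) @^-1` (sp @^-1` W).
  by apply/seteqP; split => -[x y]; rewrite /preimage /sp /= row_mxKl row_mxKr.
rewrite -[X in measurable X]setTI; apply: mrow => //.
by apply: open_measurable_rV; move/continuousP : csp; apply.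
Qed.

Lemma within_continuous_measurable (K : set T) (f : T -> R) :
  measurable K -> {within K, continuous f} -> measurable_fun setT (f \_ K).
Proof.
move=> mK cf; apply/(measurable_restrictT _ mK).
apply: (measurability (@RGenOInfty.G R)); first exact: RGenOInfty.measurableE.
move=> _ [_ [a ->] <-].
have /open_subspaceP[V oV VK] : open ((f : subspace K -> R) @^-1` `]a, +oo[%classic).
  by move/continuousP : cf; apply; exact: rray_open.
rewrite setIC -VK; apply: measurableI => //.
exact: open_measurable_prod.
Qed.

End measurable_prod.

Section limit_law.
Context d (T : measurableType d) {R : realType} {n : nat}.
Variable P : {finite_measure set T -> \bar R}.
Local Notation V := 'rV[R]_n.

Lemma bounded_finite_integrable (g : T -> R) (M : R) :
  measurable_fun setT g -> (forall t, `|g t| <= M) -> P.-integrable setT (EFin \o g).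
Proof.
move=> mg gM; apply: measurable_bounded_integrable => //.
  by rewrite ltey_eq fin_num_measure.
by exists M; split; [exact: num_real|move=> y My x _ /=; rewrite (le_trans (gM x))// ltW].
Qed.

(** The infimum is a distance only if the complement of [U] is nonempty; the whole space is treated
    separately below. *)
Definition setC_distance (U : set V) (x : V) : R := inf [set `|x - y| | y in ~` U].

Lemma setC_distance_lipschitz (U : set V) x z : U != setT ->
  setC_distance U x <= `|x - z| + setC_distance U z.
Proof.
move=> UT; have S0 w : [set `|w - y| | y in ~` U] !=set0.
  have [y nUy] : ~` U !=set0.
    by apply/set0P; apply: contra_neq UT => h; rewrite -[U]setCK h setC0.
  by exists `|w - y|, y.
have hS w : has_lbound [set `|w - y| | y in ~` U] by exists 0 => _ [y _ <-].
rewrite -lerBlDl; apply: lb_le_inf => // _ [y nUy <-].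
rewrite lerBlDl (@le_trans _ _ `|x - y|)//; last exact: ler_distD.
by apply: ge_inf => //; exists y.
Qed.

Lemma setC_distance_cont (U : set V) : U != setT -> continuous (setC_distance U).
Proof.
move=> UT x; apply/(@cvgrPdist_lt _ _ _ (nbhs x)) => e e0.
apply: filterS (nbhsx_ballx x _ e0) => y; rewrite -ball_normE /= => xy.
have h1 := setC_distance_lipschitz x y UT; have h2 := setC_distance_lipschitz y x UT.
by rewrite distrC in h2; rewrite ltr_norml; apply/andP; split; lra.
Qed.

Lemma setC_distance_gt0 (U : set V) x : U != setT -> open U -> U x ->
  0 < setC_distance U x.
Proof.
move=> UT oU Ux.
have /nbhs_ballP[e /= e0 eU] : nbhs x U by exact: open_nbhs_nbhs.
apply: (lt_le_trans e0); apply: lb_le_inf.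
  have [y nUy] : ~` U !=set0.
    by apply/set0P; apply: contra_neq UT => h; rewrite -[U]setCK h setC0.
  by exists `|x - y|, y.
move=> _ [y nUy <-]; rewrite leNgt; apply/negP => xy; apply: nUy; apply: eU.
by rewrite -ball_normE.
Qed.

Lemma setC_distance_eq0 (U : set V) x : ~ U x -> setC_distance U x = 0.
Proof.
move=> nUx; apply/le_anti/andP; split.
  by apply: ge_inf; [exists 0 => _ [y _ <-]|exists x => //; rewrite subrr normr0].
by apply: lb_le_inf; [exists `|x - x|, x|move=> _ [y _ <-]].
Qed.

Lemma setC_distance_ge0 (U : set V) x : U != setT -> 0 <= setC_distance U x.
Proof.
move=> UT; apply: lb_le_inf; last by move=> _ [y _ <-].
have [y nUy] : ~` U !=set0.
  by apply/set0P; apply: contra_neq UT => h; rewrite -[U]setCK h setC0.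
by exists `|x - y|, y.
Qed.

(* The tents [min 1 (k d(x, ~U))] increase to the indicator of U. *)
Lemma eq_law_of_continuous (f g : T -> V) :
  measurable_fun setT f -> measurable_fun setT g ->
  (forall h : V -> R, continuous h -> (forall x, `|h x| <= 1) ->
    (\int[P]_t (h (f t))%:E = \int[P]_t (h (g t))%:E)%E) ->
  forall A, measurable A -> P (f @^-1` A) = P (g @^-1` A).
Proof.
move=> mf mg fg.
have mpre (f' : T -> V) A : measurable_fun setT f' -> measurable A -> measurable (f' @^-1` A).
  by move=> mf' mA; rewrite -[X in measurable X]setTI; exact: mf'.
have openE U : open U -> P (f @^-1` U) = P (g @^-1` U).
  move=> oU; have [->|UT] := eqVneq U setT; first by [].
  have mU := open_measurable_rV oU.
  pose h (k : nat) x := Num.min 1 (k%:R * setC_distance U x).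
  have h01 k x : `|h k x| <= 1.
    rewrite ger0_norm; first by rewrite /h ge_min lexx.
    by rewrite /h le_min ler01 mulr_ge0// setC_distance_ge0.
  have ch k : continuous (h k).
    move=> x; apply: (@continuous_min _ _ (cst 1) (fun x => k%:R * setC_distance U x)).
      exact: cst_continuous.
    by apply: continuousM; [exact: cst_continuous|exact: (@setC_distance_cont U UT x)].
  have lim f' : measurable_fun setT f' ->
      (fun k => \int[P]_t (h k (f' t))%:E)%E @ \oo --> P (f' @^-1` U).
    move=> mf'.
    have mh k : measurable_fun setT (fun t => (h k (f' t))%:E).
      apply/measurable_EFinP; apply: (measurableT_comp (g := f')) => //.
      exact: continuous_measurable_rV.
    have mi : measurable_fun setT (fun t => (\1_(f' @^-1` U) t)%:E : \bar R).
      by apply/measurable_EFinP; apply: measurable_indic; exact: mpre.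
    have cv : {ae P, forall t, [set: T] t ->
        (fun k => (h k (f' t))%:E) @ \oo --> (\1_(f' @^-1` U) t)%:E}.
      apply: aeW => t _; apply: cvg_EFin; first exact: nearW.
      rewrite indicE; have [Ut|nUt] := pselect (U (f' t)); last first.
        rewrite memNset// /comp /h /=; under eq_fun do rewrite setC_distance_eq0// mulr0 min_r//.
        exact: cvg_cst.
      rewrite mem_set//; have d0 := setC_distance_gt0 UT oU Ut.
      apply: cvg_near_cst; near=> k; rewrite /= /h; apply/min_idPl.
      rewrite -ler_pdivrMr// mul1r; near: k; exact: nbhs_infty_ger.
    have i1 : P.-integrable setT (cst 1%:E).
      by apply: (@bounded_finite_integrable (cst 1) 1) => // t; rewrite normr1.
    have dom : {ae P, forall t k, [set: T] t -> (`|(h k (f' t))%:E| <= cst 1%:E t)%E}.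
      by apply: aeW => t k _; rewrite lee_fin.
    have [_ _] := dominated_convergence measurableT mh mi cv i1 dom.
    by rewrite integral_indic// ?setIT//; exact: mpre.
  apply: (cvg_unique _ (lim f mf)) => //.
  have -> : (fun k => \int[P]_t (h k (f t))%:E)%E = (fun k => \int[P]_t (h k (g t))%:E)%E.
    by apply/funext => k; exact: fg.
  exact: lim.
move=> A mA.
pose nf : {measure set V -> \bar R} := pushforward P f.
pose ng : {measure set V -> \bar R} := pushforward P g.
apply: (@measure_unique _ R V (@open V) (fun=> setT) _ _ _ _ (nf mf) (ng mg)) => //.
- by move=> B C oB oC; exact: openI.
- by move=> _; exact: openT.
- by apply/seteqP; split => // x _; exists 0%N.
- have PT : (P setT < +oo)%E by rewrite ltey_eq fin_num_measure.
  by move=> _; exact: PT.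
Unshelve. all: by end_near. Qed.

(** For bounded continuous [h] the integrals of [h] along [f_] do not depend on the index, as the
    laws are equal. Dominated convergence passes this to the limit, and such integrals determine the
    law. *)
Lemma limit_law (f_ : nat -> T -> V) (f : T -> V) (u : set V -> \bar R) :
  (forall j, measurable_fun setT (f_ j)) -> measurable_fun setT f ->
  {ae P, forall t, (fun j => f_ j t) @ \oo --> f t} ->
  (forall j A, measurable A -> P (f_ j @^-1` A) = u A) ->
  forall A, measurable A -> P (f @^-1` A) = u A.
Proof.
move=> mf_ mf cf lf A mA; rewrite -(lf 0%N A mA); apply: eq_law_of_continuous => // h ch h1.
have mh (f' : T -> V) : measurable_fun setT f' -> measurable_fun setT (fun t => (h (f' t))%:E).
  move=> mf'; apply/measurable_EFinP; apply: (measurableT_comp (g := f')) => //.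
  exact: continuous_measurable_rV.
have mhV : measurable_fun setT (fun x : V => (h x)%:E).
  by apply/measurable_EFinP; exact: continuous_measurable_rV.
have hE j : (\int[P]_t (h (f_ j t))%:E = \int[P]_t (h (f_ 0%N t))%:E)%E.
  have pf k : (\int[P]_t (h (f_ k t))%:E = \int[pushforward P (f_ k)]_x (h x)%:E)%E.
    have ih : P.-integrable (f_ k @^-1` setT) (EFin \o (fun t => h (f_ k t))).
      apply: (@bounded_finite_integrable (fun t => h (f_ k t)) 1) => //.
      by apply/measurable_EFinP; exact: mh.
    by rewrite (integral_pushforward (mf_ k) mhV ih measurableT).
  rewrite !pf; apply: eq_measure_integral => B mB _.
  by transitivity (u B); [exact: lf|apply/esym; exact: lf].
have cv : {ae P, forall t, [set: T] t ->
    (fun j => (h (f_ j t))%:E) @ \oo --> (h (f t))%:E}.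
  apply: filterS cf => t ct _; apply: cvg_EFin; first exact: nearW.
  exact: (cvg_comp _ _ ct (ch (f t))).
have i1 : P.-integrable setT (cst 1%:E).
  by apply: (@bounded_finite_integrable (cst 1) 1) => // t; rewrite normr1.
have dom : {ae P, forall t j, [set: T] t -> (`|(h (f_ j t))%:E| <= cst 1%:E t)%E}.
  by apply: aeW => t j _; rewrite lee_fin.
have [_ _ L] := dominated_convergence measurableT (fun j => mh _ (mf_ j)) (mh _ mf) cv i1 dom.
apply: (cvg_unique _ L) => //=.
under eq_fun do rewrite hE; exact: cvg_cst.
Qed.

End limit_law.

(** * The solution operator *)

(** If the charge is nonnegative, its negative set in any Hahn decomposition is null, so the Jordan
    parts are the measure itself and 0. *)
Lemma charge_integral_measure d (T : measurableType d) (R : realType)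
  (nu : {charge set T -> \bar R}) (rho : {finite_measure set T -> \bar R})
  (D : set T) (f : T -> R) : measurable D ->
  (forall A, measurable A -> rho A = nu A) ->
  charge_integral nu D f = \int[rho]_(x in D) f x.
Proof.
move=> mD rhoE; rewrite /charge_integral.
set H := charge_hahn nu; have HH := proj2_sig H.
have [[mP posP] [mN negN] PNT PN0] := HH.
have nuN A : measurable A -> nu (A `&` (proj1_sig H).2) = 0%E.
  move=> mA; have mAN : measurable (A `&` (proj1_sig H).2) by exact: measurableI.
  apply/le_anti/andP; split; first by apply: negN => //; exact: subIsetr.
  by rewrite -(rhoE _ mAN) measure_ge0.
have nuP A : measurable A -> nu (A `&` (proj1_sig H).1) = rho A.
  move=> mA; have mAP : measurable (A `&` (proj1_sig H).1) by exact: measurableI.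
  have mAN : measurable (A `&` (proj1_sig H).2) by exact: measurableI.
  rewrite -(rhoE _ mAP) -{2}[A]setIT -PNT setIUr.
  have E : rho ((A `&` (proj1_sig H).1) `|` (A `&` (proj1_sig H).2)) =
     (rho (A `&` (proj1_sig H).1) + rho (A `&` (proj1_sig H).2))%E.
    by apply: measureU => //; rewrite setIACA PN0 setI0.
  by rewrite E (rhoE _ mAN) nuN// adde0.
have pE A : measurable A -> charge_pos nu A = rho A.
  move=> mA; change (crestr0 nu mP A = rho A); rewrite /crestr0 mem_set//.
  by rewrite /crestr nuP.
have nE A : measurable A -> charge_neg nu A = 0%E.
  move=> mA; change ((-1)%:E * crestr0 nu mN A = 0)%E.
  rewrite /crestr0 mem_set//.
  by rewrite /crestr nuN// mule0.
have -> : \int[charge_neg nu]_(x in D) f x = 0.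
  rewrite /Rintegral (_ : (\int[charge_neg nu]_(x in D) (f x)%:E)%E = 0%E)//.
  rewrite (eq_measure_integral mzero); last by move=> A mA _; exact: nE.
  by rewrite integral_measure_zero.
rewrite subr0 /Rintegral; congr fine.
by apply: eq_measure_integral => A mA _; exact: pE.
Qed.

(** Boundedness from below is a consequence: a sequence with values below [- n] would have a limit
    value below every [- N]. The condition [j <= kappa j] suffices in place of strict monotonicity,
    since the minimizing property is a rate in the index. *)
Lemma attains_min (R : realType) (X : Type) (V : X -> R) (x0 : X) :
  (forall x_ : nat -> X, exists (xb : X) (kappa : nat -> nat),
    (forall j, (j <= kappa j)%N) /\ (fun j => V (x_ (kappa j))) @ \oo --> V xb) ->
  exists xb, forall x, V xb <= V x.
Proof.
move=> H; pose A := range V.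
have A0 : A !=set0 by exists (V x0), x0.
have [bA|nbA] := pselect (has_lbound A).
  have hA : has_inf A by [].
  have /choice[x_ xP] : forall n : nat, exists x, V x < inf A + n.+1%:R^-1.
    move=> n; have : inf A < inf A + n.+1%:R^-1 by rewrite ltrDl invr_gt0.
    by move=> /(inf_lt A0)[_ [x _ <-] h]; exists x.
  have [xb [kappa [kj cV]]] := H x_.
  exists xb => x; apply: (@le_trans _ _ (inf A)); last by apply: ge_inf => //; exists x.
  have cI : (fun j : nat => inf A + j.+1%:R^-1) @ \oo --> inf A.
    by rewrite -[X in _ --> X]addr0; apply: cvgD; [exact: cvg_cst|exact: cvg_harmonic].
  apply: (ler_cvg_to cV cI); apply: nearW => j.
  apply: (le_trans (ltW (xP _))); rewrite lerD2l lef_pV2 ?posrE// ler_nat ltnS.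
  exact: kj.
exfalso.
have /choice[x_ xP] : forall n : nat, exists x, V x < - n%:R.
  move=> n; apply: contrapT => h; apply: nbA; exists (- n%:R) => _ [x _ <-].
  by rewrite leNgt; apply/negP => hx; apply: h; exists x.
have [xb [kappa [kj cV]]] := H x_.
have [N hN] : exists N : nat, - V xb < N%:R.
  by exists (Num.truncn (- V xb)).+1; exact: truncnS_gt.
have : V xb <= - N%:R.
  apply: (ler_cvg_to cV (cvg_cst (- N%:R : R))); near=> j.
  apply: (le_trans (ltW (xP _))); rewrite lerN2 ler_nat (leq_trans _ (kj j))//.
  by near: j; exact: nbhs_infty_ge.
lra.
Unshelve. all: by end_near. Qed.

Section conjugate_exponents.
Context {R : realType}.
Implicit Types p q : exponent R.

Lemma exponent_eq p q : (p : R) = q -> p = q.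
Proof.
case: p q => [p p1] [q q1] /= pq; rewrite -pq in q1 *.
by congr Exponent; exact: bool_irrelevance.
Qed.

Lemma conjugateK q : conjugate (conjugate q) = q.
Proof.
apply: exponent_eq => /=; have q1 := exponent_gt1 q.
have q0 : (q : R) - 1 != 0 by rewrite subr_eq0 gt_eqF.
have -> : (q : R) / ((q : R) - 1) - 1 = ((q : R) - 1)^-1 by field.
by rewrite invrK divfK.
Qed.

Lemma conjugate_lt p q : (conjugate q : R) < (p : R) -> (conjugate p : R) < (q : R).
Proof.
move=> /=; have p1 := exponent_gt1 p; have q1 := exponent_gt1 q.
rewrite ltr_pdivrMr ?subr_gt0// ltr_pdivrMr ?subr_gt0//; lra.
Qed.

End conjugate_exponents.

Section solution_operator_bound.
Context {R : realType} {n : nat} (Omega : set 'rV[R]_n) (omega1 : set 'rV[R]_n).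
Variables (pOmega q : exponent R).
Hypothesis solvable : forall p : exponent R,
  (conjugate pOmega : R) < (p : R) < (pOmega : R) ->
  forall f : {linear sobolev0 Omega (conjugate p) -> R}, continuous f ->
  exists! y : sobolev0 Omega p, weak_solution f y.
Hypothesis n2 : (2 <= n)%N.
Hypothesis hq : n%:R < (conjugate q : R) < (pOmega : R).

(** Because the conjugate of [q] exceeds 2, [q] is below 2 and [pOmega] above it. Hence both [q] and
    its conjugate lie in the range of solvability. *)
Let q'_gt2 : 2 < (conjugate q : R).
Proof.
by case/andP: hq => h _; apply: le_lt_trans h; rewrite ler_nat.
Qed.

Let q_range : (conjugate pOmega : R) < (q : R) < (pOmega : R).
Proof.
case/andP: hq => _ h; rewrite conjugate_lt//=.
move: q'_gt2; rewrite /= ltr_pdivlMr ?subr_gt0 ?exponent_gt1// => h2.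
have := lt_trans q'_gt2 h; lra.
Qed.

Let q'_range : (conjugate pOmega : R) < (conjugate q : R) < (pOmega : R).
Proof.
case/andP: hq => _ h; rewrite h andbT.
apply: lt_trans q'_gt2; have P2 := lt_trans q'_gt2 h.
by rewrite /= ltr_pdivrMr ?subr_gt0 ?exponent_gt1//; lra.
Qed.

Let np : n%:R < (conjugate q : R). Proof. by case/andP: hq. Qed.

(** The bilinear form is symmetric, so the adjoint equation is the Dirichlet problem at the
    conjugate exponent. *)
Lemma adjoint_solvable (g : {linear sobolev0 Omega q -> R}) : continuous g ->
  exists z : sobolev0 Omega (conjugate q), forall y : sobolev0 Omega q,
    neg_laplacian y z = g y.
Proof.
(* The form is written out because [conjugate (conjugate q)] equals [q] only propositionally: with
   [neg_laplacian z y], rewriting this exponent would not be well typed. *)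
have : forall g : {linear sobolev0 Omega (conjugate (conjugate q)) -> R}, continuous g ->
    exists z : sobolev0 Omega (conjugate q),
    forall y : sobolev0 Omega (conjugate (conjugate q)),
    \int[lebesgue_rV n]_(x in Omega)
      \sum_(i < n) sobolev_grad z i x * sobolev_grad y i x = g y.
  by move=> h /(solvable q'_range)[z [zh _]]; exists z.
rewrite conjugateK => h /h[z zP]; exists z => y; rewrite -zP.
apply: eq_Rintegral => x _; apply: eq_bigr => i _; exact: mulrC.
Qed.

(** It certifies that [solution_operator] returns a genuine solution and not its default value 0. *)
Definition solvable_data (u : signed_measure R omega1) : Prop :=
  weak_solution (embedding_adjoint u) (solution_operator Omega q u).

Lemma solvable_dataP (u : signed_measure R omega1)
  (f : {linear sobolev0 Omega (conjugate q) -> R}) :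
  continuous f -> f =1 embedding_adjoint u -> solvable_data u.
Proof.
move=> cf fE; have [y [ys _]] := solvable q_range cf.
rewrite /solvable_data /solution_operator.
apply: (@xgetPex _ 0 [set y | weak_solution (embedding_adjoint u) y]).
by exists y => v; rewrite ys fE.
Qed.

(* With [z] the solution of the adjoint equation for a functional [g],         *)
(* [g (S u - S u')] is the difference of the data tested with [z], so the     *)
(* quotients below are weakly bounded.                                        *)
Lemma solution_operator_lipschitz : exists C, forall u u' : signed_measure R omega1,
  solvable_data u -> solvable_data u' -> forall e, 0 < e ->
  (forall v : sobolev0 Omega (conjugate q),
    `|embedding_adjoint u v - embedding_adjoint u' v| <= e * `|v|) ->
  `|solution_operator Omega q u - solution_operator Omega q u'| <= C * e.
Proof.
pose S := [set y : sobolev0 Omega q | exists u u' : signed_measure R omega1,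
  [/\ solvable_data u, solvable_data u' & exists e, [/\ 0 < e,
   (forall v : sobolev0 Omega (conjugate q),
    `|embedding_adjoint u v - embedding_adjoint u' v| <= e * `|v|) &
   y = e^-1 *: (solution_operator Omega q u - solution_operator Omega q u')]]].
have [|C SC] := @weakly_bounded_bounded R (sobolev0 Omega q) S.
  move=> g cg; have [z zP] := adjoint_solvable cg.
  exists `|z| => _ [u [u' [su su' [e [e0 ue ->]]]]].
  rewrite linearZ linearB /= -!zP su su' -[_ *: _]/(e^-1 * _) normrM.
  by rewrite gtr0_norm ?invr_gt0// ler_pdivrMl.
exists C => u u' su su' e e0 ue.
have := SC (e^-1 *: (solution_operator Omega q u - solution_operator Omega q u')).
rewrite normrZ gtr0_norm ?invr_gt0// ler_pdivrMl// mulrC; apply.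
by exists u, u'; split=> //; exists e.
Qed.

End solution_operator_bound.

Section transfer.
Context d1 d2 (T1 : measurableType d1) (T2 : measurableType d2) {R : realType}.

Lemma integral_transfer (P : {finite_measure set T1 -> \bar R})
  (rho : {finite_measure set T2 -> \bar R}) (Y : T1 -> T2) (K : set T2)
  (g : T2 -> R) (B : R) :
  measurable_fun setT Y -> (forall A, measurable A -> rho A = P (Y @^-1` A)) ->
  measurable_fun setT (g \_ K) -> (forall z, `|(g \_ K) z| <= B) ->
  (\int[rho]_(z in K) (g z)%:E = \int[P]_t ((g \_ K) (Y t))%:E)%E.
Proof.
move=> mY rhoE mg gB.
rewrite [LHS]integral_mkcond.
have -> : (fun z => (g z)%:E) \_ K = EFin \o (g \_ K).
  by apply/funext => z; rewrite /patch /=; case: ifP.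
have ig : P.-integrable (Y @^-1` setT) ((EFin \o (g \_ K)) \o Y).
  apply: (@bounded_finite_integrable _ _ _ P ((g \_ K) \o Y) B) => [|t].
    exact: measurableT_comp.
  exact: gB.
transitivity (\int[pushforward P Y]_z ((g \_ K) z)%:E)%E.
  by apply: eq_measure_integral => A mA _; exact: rhoE.
rewrite (integral_pushforward mY _ ig)//.
exact/measurable_EFinP.
Qed.

End transfer.

Section embedding_functional.
Context {R : realType} {n : nat} (Omega : set 'rV[R]_n) (omega1 : set 'rV[R]_n).
Variable q : exponent R.
Hypothesis np : n%:R < (conjugate q : R).
Hypothesis oOmega : open Omega.
Hypothesis bOmega : bounded_set Omega.
Hypothesis omega1_cpt : compact omega1.

Let m1 : measurable omega1.
Proof.
by apply: closed_measurable_rV; apply: compact_closed => //; exact: norm_hausdorff.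
Qed.

(** Linearity is read off from the integral with respect to the positive measure [rho], and
    boundedness from the sup estimate for the embedding. *)
Lemma embedding_adjoint_functional (u : signed_measure R omega1)
  (rho : {finite_measure set 'rV[R]_n -> \bar R}) :
  (forall A, measurable A -> rho A = u A) ->
  exists2 f : {linear sobolev0 Omega (conjugate q) -> R},
    continuous f & f =1 embedding_adjoint u.
Proof.
move=> rhoE; pose ev (v : sobolev0 Omega (conjugate q)) := embedding v.
have E (v : sobolev0 Omega (conjugate q)) : embedding_adjoint u v = \int[rho]_(x in omega1) ev v x.
  exact: charge_integral_measure.
have mev v : measurable_fun setT (ev v).
  by apply: continuous_measurable_rV; have [] := embeddingP np oOmega bOmega v.
have iev v : rho.-integrable omega1 (EFin \o ev v).
  apply: measurable_bounded_integrable => //.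
  - by rewrite ltey_eq fin_num_measure.
  - exact: measurable_funTS.
  - exists (@morrey_cst R n (conjugate q) * `|v|); split; first exact: num_real.
    move=> y My x _ /=; apply: le_trans (ltW My).
    exact: (embedding_sup np oOmega bOmega).
have lin a (v w : sobolev0 Omega (conjugate q)) : embedding_adjoint u (a *: v + w) =
    a * embedding_adjoint u v + embedding_adjoint u w.
  rewrite !E -RintegralZl// -RintegralD//; last exact: (integrableZl m1 a (iev v)).
  by apply: eq_Rintegral => x _; rewrite /ev (embedding_linear np oOmega bOmega).
have [f fE] := linear_pack lin.
exists f => //.
apply: (@lipschitz_linear_continuous _ _ f
  (@morrey_cst R n (conjugate q) * fine (rho omega1))) => v.
rewrite fE E; apply: (le_trans (le_normr_Rintegral m1 (iev v))).
have ic : rho.-integrable omega1 (EFin \o cst (@morrey_cst R n (conjugate q) * `|v|)).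
  exact: finite_measure_integrable_cst.
apply: (@le_trans _ _ (\int[rho]_(x in omega1) cst (@morrey_cst R n (conjugate q) * `|v|) x)).
  apply: le_Rintegral => //; first exact: integrable_norm.
  by move=> x _; exact: (embedding_sup np oOmega bOmega).
by rewrite Rintegral_cst// mulrAC.
Qed.

End embedding_functional.

(** * Compactness of the couplings *)

Lemma compact_coord_bounded (R : realType) n (K : set 'rV[R]_n) : compact K ->
  exists M, forall x, K x -> forall i, `|x ord0 i| <= M.
Proof.
move=> /compact_bounded[M [_ KM]]; exists (`|M| + 1) => x Kx i.
rewrite (le_trans (coord_norm_le x i))//; apply: KM => //.
by rewrite (le_lt_trans (ler_norm M))// ltrDl.
Qed.

Section coupling_compactness.
Context {R : realType} {d0 d1 : nat}.
Variables (omega0 : set 'rV[R]_d0) (omega1 : set 'rV[R]_d1).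
Hypothesis omega0_cpt : compact omega0.
Hypothesis omega1_cpt : compact omega1.
Variable c : 'rV[R]_d0 * 'rV[R]_d1 -> R.
Hypothesis c_cont : {within omega0 `*` omega1, continuous c}.
Local Notation T := ('rV[R]_d0 * 'rV[R]_d1)%type.
Local Notation K := (omega0 `*` omega1).

Let mcompact n (A : set 'rV[R]_n) : compact A -> measurable A.
Proof.
by move=> cA; apply: closed_measurable_rV; apply: compact_closed => //; exact: norm_hausdorff.
Qed.

Let m0 : measurable omega0 := mcompact omega0_cpt.
Let m1 : measurable omega1 := mcompact omega1_cpt.
Let mK : measurable K. Proof. exact: measurableX. Qed.

Let Kclosed : closed K.
Proof.
by apply: compact_closed; [exact: norm_hausdorff|exact: compact_setX].
Qed.

Let mcK : measurable_fun setT (c \_ K).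
Proof. exact: within_continuous_measurable. Qed.

Lemma cost_bounded : exists B, forall z, `|(c \_ K) z| <= B.
Proof.
have [M [_ HM]] : bounded_set (c @` K).
  apply: compact_bounded; apply: continuous_compact => //.
  exact: compact_setX.
exists (`|M| + 1) => z; rewrite /patch; case: ifPn => [zK|_].
  apply: HM; first by rewrite (le_lt_trans (ler_norm _))// ltrDl.
  by exists z => //; rewrite -inE.
by rewrite normr0 addr_ge0.
Qed.

Definition transport_cost (pi : set T -> \bar R) : R :=
  fine (\int[pi]_(z in K) (c z)%:E)%E.

Lemma transport_costE (pi : {finite_measure set T -> \bar R}) :
  (\int[pi]_(z in K) (c z)%:E)%E = (transport_cost pi)%:E.
Proof.
rewrite /transport_cost fineK//; apply: integrable_fin_num => //.
apply/(integrable_mkcond _ mK).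
have -> : (fun z => (c z)%:E) \_ K = EFin \o (c \_ K).
  by apply/funext => z; rewrite /patch /=; case: ifP.
have [B cB] := cost_bounded.
exact: bounded_finite_integrable cB.
Qed.

Variable u0 : set 'rV[R]_d0 -> \bar R.

Lemma powR_cvg0_seq (x : R^nat) (a : R) : 0 < a -> (forall j, 0 <= x j) ->
  x @ \oo --> 0 -> (fun j => x j `^ a) @ \oo --> 0.
Proof.
move=> a0 x0 cx; apply/cvgrPdist_lt => e e0.
have ea0 : 0 < e `^ a^-1 by rewrite powR_gt0.
move/cvgrPdist_lt : cx => /(_ _ ea0); apply: filterS => j.
rewrite !sub0r !normrN ger0_norm// ger0_norm ?powR_ge0// => xd.
have -> : e = (e `^ a^-1) `^ a by rewrite -powRrM mulVf ?gt_eqF// powRr1// ltW.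
by apply: gt0_ltr_powR => //; rewrite nnegrE// ltW.
Qed.

(* [eps] is independent of [w], so that dual norms of the controls converge.   *)
Lemma coupling_compactness (a : R) (u_ : nat -> signed_measure R omega1)
  (pi_ : nat -> {finite_measure set T -> \bar R}) : 0 < a ->
  (forall k, coupling omega0 omega1 u0 (u_ k) (pi_ k)) ->
  exists (u : signed_measure R omega1) (pi : {finite_measure set T -> \bar R})
    (kappa : nat -> nat) (eps : R^nat),
    [/\ coupling omega0 omega1 u0 u pi,
        forall j, (j <= kappa j)%N,
        (fun j => transport_cost (pi_ (kappa j))) @ \oo --> transport_cost pi,
        (forall j, 0 <= eps j) /\ eps @ \oo --> 0 &
        forall j (w : 'rV[R]_d1 -> R) (L : R), 0 <= L -> continuous w ->
          (forall x y, `|w x - w y| <= L * `|x - y| `^ a) ->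
          `|charge_integral (u_ (kappa j)) omega1 w - charge_integral u omega1 w|
            <= L * eps j].
Proof.
move=> a0 cpl.
have [M0 oM0] := compact_coord_bounded omega0_cpt.
have [M1 oM1] := compact_coord_bounded omega1_cpt.
pose M := `|M0| + `|M1| + 1.
have M_gt0 : 0 < M by rewrite ltr_wpDl// addr_ge0.
have KM z : K z -> box_prod M z.
  move=> [z0 z1]; split=> i.
    rewrite (le_trans (oM0 _ z0 i))// (le_trans (ler_norm _))// /M -addrA lerDl.
    by rewrite addr_ge0.
  rewrite (le_trans (oM1 _ z1 i))// (le_trans (ler_norm _))// /M addrAC lerDr.
  by rewrite addr_ge0.
have piT k : pi_ k setT = u0 setT by have [_ <- // _] := cpl k; rewrite /pushforward preimage_setT.
have piT' k : pi_ k setT = (fine (u0 setT))%:E.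
  by rewrite -(piT k) fineK// fin_num_measure.
have pi0 k A : measurable A -> A `<=` ~` box_prod M -> pi_ k A = 0%E.
  move=> mA AM; have [h _ _] := cpl k; apply: h => // z Az Kz.
  exact: (AM z Az (KM z Kz)).
have [kappa [P [Y [Z [kj mY mZ YP cYZ]]]]] := skorokhod M_gt0 piT' pi0.
have aeY : {ae P, forall t j, K (Y j t)}.
  apply: ae_foralln => j; exists (Y j @^-1` (~` K)); split => //.
    by rewrite -[X in measurable X]setTI; apply: mY => //; exact: measurableC.
  have [h _ _] := cpl (kappa j).
  transitivity (pi_ (kappa j) (~` K)); first by apply/esym/YP; exact: measurableC.
  by apply: h => //; exact: measurableC.
(* The limit stays in [K] because [K] is closed. *)
have aeZ : {ae P, forall t, K (Z t)}.
  apply: filterS2 aeY cYZ => t YK cY.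
  apply: (@closed_cvg _ _ _ _ (fun j => Y j t) K Kclosed _ _ cY).
  by apply: nearW => j; exact: YK.
have [pi piE] := exists_finite_pushforward P mZ.
have [nu nuE] := exists_finite_pushforward pi (@measurable_snd _ _ 'rV[R]_d0 'rV[R]_d1).
have piK : carried_by K pi.
  move=> A mA AK; rewrite piE.
  have mZA : measurable (Z @^-1` A) by rewrite -[X in measurable X]setTI; exact: mZ.
  by apply/(negligibleP _ mZA); apply: negligibleS aeZ => t /= At Kt; exact: AK At Kt.
have nu1 : carried_by omega1 (charge_of_finite_measure nu).
  move=> A mA A1; rewrite /charge_of_finite_measure nuE; apply: piK.
    by rewrite -[X in measurable X]setTI; exact: measurable_snd.
  by move=> z Az [_ z1]; exact: A1 Az z1.
pose u : signed_measure R omega1 := @SignedMeasure _ _ _ omega1 (charge_of_finite_measure nu) nu1.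
(* The truncation provides a bound for all [t]. It is inactive when both points lie in [K], where
   second coordinates differ by at most [2 * M]. *)
pose D (j : nat) t := Num.min ((2 * M) `^ a) (`|(Y j t).2 - (Z t).2| `^ a).
have msnd (f : measurableTypeR R -> T) : measurable_fun setT f ->
    measurable_fun setT (fun t => (f t).2).
  by move=> mf; exact: (measurableT_comp measurable_snd mf).
have mfst (f : measurableTypeR R -> T) : measurable_fun setT f ->
    measurable_fun setT (fun t => (f t).1).
  by move=> mf; exact: (measurableT_comp measurable_fst mf).
have mD j : measurable_fun setT (D j).
  apply: measurable_minr => //; apply: (measurableT_comp (measurable_powR _)) => //.
  apply: (measurableT_comp (continuous_measurable_rV (@norm_continuous _ _))).
  apply: measurable_fun_rV => i; under eq_fun do rewrite !mxE.
  by apply: measurable_funB; apply: (measurableT_comp (measurable_coord i)); exact: msnd.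
have D0 j t : 0 <= D j t by rewrite le_min !powR_ge0.
have DM j t : `|D j t| <= (2 * M) `^ a by rewrite ger0_norm// ge_min lexx.
have iD j : P.-integrable setT (EFin \o D j) by exact: bounded_finite_integrable (DM j).
pose eps j := fine (\int[P]_t (D j t)%:E)%E.
exists u, pi, kappa, eps; split => //.
- split => // [A mA|A mA].
    rewrite /pushforward piE.
    apply: (@limit_law _ _ _ _ P (fun j t => (Y j t).1) (fun t => (Z t).1) u0) => //.
    + by move=> j; exact: mfst.
    + exact: mfst.
    + by apply: filterS cYZ => t cY; apply: (cvg_comp _ _ cY); exact: cvg_fst.
    + move=> j B mB; have [_ h _] := cpl (kappa j); rewrite -(h B mB) /pushforward YP//.
      by rewrite -[X in measurable X]setTI; exact: measurable_fst.
  by rewrite /pushforward /u /= /charge_of_finite_measure nuE.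
- have [B cB] := cost_bounded.
  have E (rho : {finite_measure set T -> \bar R}) (f : measurableTypeR R -> T) : measurable_fun setT f ->
      (forall A, measurable A -> rho A = P (f @^-1` A)) ->
      (\int[rho]_(z in K) (c z)%:E = \int[P]_t ((c \_ K) (f t))%:E)%E.
    by move=> mf rhoE; exact: integral_transfer mf rhoE mcK cB.
  apply: fine_cvg; rewrite -transport_costE (E pi Z mZ)//.
  under eq_fun do rewrite (E _ _ (mY _) (YP _)).
  have mcf (f : measurableTypeR R -> T) : measurable_fun setT f ->
      measurable_fun setT (fun t => ((c \_ K) (f t))%:E).
    by move=> mf; apply/measurable_EFinP; exact: (measurableT_comp mcK mf).
  have cv : {ae P, forall t, [set: measurableTypeR R] t ->
      (fun j => ((c \_ K) (Y j t))%:E) @ \oo --> ((c \_ K) (Z t))%:E}.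
    apply: filterS3 aeY aeZ cYZ => t YK ZK cY _; apply: cvg_EFin; first exact: nearW.
    rewrite /comp /= {2}/patch mem_set//.
    rewrite [X in X @ _ --> _](_ : _ = fun j => c (Y j t)); last first.
      by apply/funext => j; rewrite /patch mem_set.
    (* Continuity within [K] controls [c] only at points of [K], and almost every trajectory stays
       there. *)
    move/subspace_continuousP : c_cont => /(_ (Z t) ZK) h V /h hV.
    have hV' : nbhs (Z t) [set z | K z -> V (c z)] := hV.
    have hj : \forall j \near \oo, K (Y j t) -> V (c (Y j t)) := cY _ hV'.
    by apply: (filterS _ hj) => j; apply; exact: YK.
  have i1 : P.-integrable setT (cst B%:E) by exact: finite_measure_integrable_cst.
  have dom : {ae P, forall t j, [set: measurableTypeR R] t ->
      (`|((c \_ K) (Y j t))%:E| <= cst B%:E t)%E}.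
    by apply: aeW => t j _; rewrite lee_fin.
  have [_ _] := dominated_convergence measurableT (fun j => mcf _ (mY j)) (mcf _ mZ) cv i1 dom.
  exact.
- split; first by move=> j; apply: fine_ge0; apply: integral_ge0 => t _; rewrite lee_fin.
  apply: fine_cvg.
  have mDE j : measurable_fun setT (fun t => (D j t)%:E) by apply/measurable_EFinP.
  have m0E : measurable_fun setT (fun _ : measurableTypeR R => 0%:E : \bar R) by [].
  have cv : {ae P, forall t, [set: measurableTypeR R] t ->
      (fun j => (D j t)%:E) @ \oo --> 0%:E}.
    apply: filterS cYZ => t cY _; apply: cvg_EFin; first exact: nearW.
    have c2 : (fun j => `|(Y j t).2 - (Z t).2|) @ \oo --> 0.
      have h : (fun j => (Y j t).2) @ \oo --> (Z t).2.
        by apply: (cvg_comp _ _ cY); exact: cvg_snd.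
      apply/cvgrPdist_lt => e e0; move/cvgrPdist_lt : h => /(_ _ e0).
      by apply: filterS => j; rewrite sub0r normrN normr_id distrC.
    have := powR_cvg0_seq a0 (fun j => normr_ge0 _) c2.
    move=> /cvgrPdist_lt h; apply/cvgrPdist_lt => e e0; move: (h _ e0).
    apply: filterS => j; rewrite !sub0r !normrN ger0_norm ?powR_ge0// => hj.
    rewrite /= ger0_norm//; apply: le_lt_trans hj; rewrite /D.
    by rewrite ge_min lexx orbT.
  have i1 : P.-integrable setT (cst ((2 * M) `^ a)%:E) by exact: finite_measure_integrable_cst.
  have dom : {ae P, forall t j, [set: measurableTypeR R] t ->
      (`|(D j t)%:E| <= cst ((2 * M) `^ a)%:E t)%E}.
    by apply: aeW => t j _; rewrite lee_fin.
  have [_ _] := dominated_convergence measurableT mDE m0E cv i1 dom.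
  by rewrite integral0.
move=> j w L L0 cw wL.
have [B wB] : exists B, forall x, `|(w \_ omega1) x| <= B.
  have [N [_ HN]] : bounded_set (w @` omega1).
    apply: compact_bounded; apply: continuous_compact => //.
    exact: continuous_subspaceT.
  exists (`|N| + 1) => x; rewrite /patch; case: ifPn => [xO|_].
    apply: HN; first by rewrite (le_lt_trans (ler_norm _))// ltrDl.
    by exists x => //; rewrite -inE.
  by rewrite normr0 addr_ge0.
have mw : measurable_fun setT (w \_ omega1).
  by apply/(measurable_restrictT _ m1); apply: measurable_funTS; exact: continuous_measurable_rV.
have mwf (f : measurableTypeR R -> T) : measurable_fun setT f ->
    measurable_fun setT (fun t => (w \_ omega1) (f t).2).
  by move=> mf; exact: (measurableT_comp mw (msnd _ mf)).
(* Both charge integrals become integrals over the same space [P], so that the Hoelder bound can be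
   applied pointwise. *)
have charge_P (v : signed_measure R omega1) (rho : {finite_measure set 'rV[R]_d1 -> \bar R})
    (f : measurableTypeR R -> T) : measurable_fun setT f ->
    (forall A, measurable A -> rho A = v A) ->
    (forall A, measurable A -> rho A = P ((fun t => (f t).2) @^-1` A)) ->
    charge_integral v omega1 w = \int[P]_t ((w \_ omega1) (f t).2).
  move=> mf vE fE; rewrite (charge_integral_measure w m1 vE) /Rintegral.
  by rewrite (integral_transfer (msnd _ mf) fE mw wB).
have [rho rhoE] := exists_finite_pushforward (pi_ (kappa j)) (@measurable_snd _ _ 'rV[R]_d0 'rV[R]_d1).
have msA (A : set 'rV[R]_d1) : measurable A -> measurable ((@snd 'rV[R]_d0 'rV[R]_d1) @^-1` A).
  by move=> mA; rewrite -[X in measurable X]setTI; exact: measurable_snd.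
rewrite (charge_P _ rho (Y j))//; last 2 first.
- by move=> A mA; rewrite rhoE; have [_ _ h] := cpl (kappa j); rewrite -(h A mA).
- by move=> A mA; rewrite rhoE YP//; exact: msA.
rewrite (charge_P u nu Z)//; last by move=> A mA; rewrite nuE piE.
have iw (f : measurableTypeR R -> T) : measurable_fun setT f ->
    P.-integrable setT (EFin \o (fun t => (w \_ omega1) (f t).2)).
  move=> mf; apply: (@bounded_finite_integrable _ _ _ P
    (fun t => (w \_ omega1) (f t).2) B) => [|t]; [exact: mwf|exact: wB].
rewrite -RintegralB//; [|exact: iw|exact: iw].
have iwB : P.-integrable setT
    (EFin \o (fun t => (w \_ omega1) (Y j t).2 - (w \_ omega1) (Z t).2)).
  apply: (@bounded_finite_integrable _ _ _ P
    (fun t => (w \_ omega1) (Y j t).2 - (w \_ omega1) (Z t).2) (B + B)).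
    by apply: measurable_funB; exact: mwf.
  by move=> t; rewrite (le_trans (ler_normB _ _))// lerD.
apply: (le_trans (le_normr_Rintegral measurableT iwB)).
have -> : L * eps j = \int[P]_t (L * D j t).
  by rewrite RintegralZl//; exact: iD.
have iLD : P.-integrable setT (EFin \o (fun t => L * D j t)).
  exact: (integrableZl measurableT L (iD j)).
rewrite /Rintegral; apply: fine_le.
- by apply: integrable_fin_num => //; exact: integrable_norm.
- exact: integrable_fin_num.
apply: ae_ge0_le_integral => //.
- apply/measurable_EFinP; apply: measurableT_comp => //.
  by apply: measurable_funB; exact: mwf.
- by move=> t _; rewrite lee_fin mulr_ge0.
- by apply/measurable_EFinP; apply: measurable_funM.
have normM (x : 'rV[R]_d1) : (forall i, `|x ord0 i| <= M) -> `|x| <= M.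
  move=> xM; rewrite [leLHS]/Num.norm/= mx_normrE.
  by apply: bigmax_le => [|[i k] _ /=]; [exact: ltW|rewrite ord1].
apply: filterS2 aeY aeZ => t YK ZK _; rewrite lee_fin.
have [_ Y1] := YK j; have [_ Z1] := ZK.
have [_ YM] := KM _ (YK j); have [_ ZM] := KM _ ZK.
rewrite /patch !mem_set//; apply: (le_trans (wL _ _)); rewrite ler_wpM2l//.
have YZM : `|(Y j t).2 - (Z t).2| <= 2 * M.
  by apply: (le_trans (ler_normB _ _)); rewrite mulrDl mul1r; apply: lerD; exact: normM.
rewrite /D le_min lexx andbT; apply: ge0_ler_powR => //; first exact: ltW.
- by rewrite nnegrE.
- by rewrite nnegrE mulr_ge0// ltW.
Qed.

End coupling_compactness.

(** * Existence of an optimal control *)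

Theorem theorem3p2 (R : realType) (d0 d1 : nat)
    (hd1 : d1 = 2%N \/ d1 = 3%N)
    (Omega : set 'rV[R]_d1) (hOmega : bounded_lipschitz_domain Omega)
    (omega0 : set 'rV[R]_d0) (omega1 : set 'rV[R]_d1)
    (omega0_ne : omega0 !=set0) (omega0_cpt : compact omega0)
    (omega1_ne : omega1 !=set0) (omega1_cpt : compact omega1)
    (omega1_sub : omega1 `<=` closure Omega)
    (u0 : signed_measure R omega0)
    (u0_ge0 : forall A, measurable A -> (0 <= u0 A)%E)
    (c : 'rV[R]_d0 * 'rV[R]_d1 -> R)
    (c_cont : {within omega0 `*` omega1, continuous c})
    (alpha : R) (alpha_gt0 : 0 < alpha)
    (pOmega : exponent R) (pOmega_gt : d1%:R < (pOmega : R))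
    (pOmega_solvable : forall p : exponent R,
      (conjugate pOmega : R) < (p : R) < (pOmega : R) ->
      forall f : {linear sobolev0 Omega (conjugate p) -> R}, continuous f ->
      exists! y : sobolev0 Omega p, weak_solution f y)
    (q : exponent R)
    (hq : d1%:R < (conjugate q : R) < (pOmega : R))
    (hq3 : d1 = 3%N -> (conjugate q : R) < 6%:R)
    (J : sobolev0 Omega q -> R)
    (J_cont : continuous J) (J_diff : gateaux_differentiable J) :
  let S := @solution_operator R d1 Omega q omega1 in
  let D := transport_distance omega0 omega1 c u0 in
  exists ubar : signed_measure R omega1,
  forall u : signed_measure R omega1,
    ((J (S ubar))%:E + alpha%:E * D ubar <= (J (S u))%:E + alpha%:E * D u)%E.
Proof.
move=> S D.
have [oOmega _ _ bOmega _] := hOmega.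
have n2 : (2 <= d1)%N by case: hd1 => ->.
have np : d1%:R < (conjugate q : R) by case/andP: hq.
have a_gt0 : 0 < 1 - d1%:R / (conjugate q : R).
  by rewrite subr_gt0 ltr_pdivrMr ?mul1r// (le_lt_trans _ np).
pose cost := transport_cost omega0 omega1 c.
have costE := transport_costE omega0_cpt omega1_cpt c_cont.
pose T := ('rV[R]_d0 * 'rV[R]_d1)%type.
have [[u1 [pi1 cpl1]]|nocpl] := pselect (exists (u : signed_measure R omega1)
    (pi : {finite_measure set T -> \bar R}), coupling omega0 omega1 u0 u pi); last first.
  (* Without couplings the objective is [+oo] everywhere, and the zero measure is a minimizer. *)
  have D_oo (u : signed_measure R omega1) : D u = +oo%E.
    rewrite /D /transport_distance (_ : coupling _ _ _ _ = set0) ?image_set0 ?ereal_inf0//.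
    by rewrite -subset0 => pi cpl; apply: nocpl; exists u, pi.
  exists (@SignedMeasure _ _ _ omega1 czero (fun A _ _ => erefl)) => u.
  by rewrite !D_oo gt0_muley ?lte_fin.
pose X := {up : signed_measure R omega1 * {finite_measure set T -> \bar R} |
  coupling omega0 omega1 u0 up.1 up.2}.
pose V (x : X) := J (S (sval x).1) + alpha * cost (sval x).2.
have data (u : signed_measure R omega1) (pi : {finite_measure set T -> \bar R}) :
    coupling omega0 omega1 u0 u pi -> solvable_data Omega q u.
  move=> [_ _ piu].
  have [rho rhoE] := exists_finite_pushforward pi (@measurable_snd _ _ 'rV[R]_d0 'rV[R]_d1).
  have rhou A : measurable A -> rho A = u A by move=> mA; rewrite rhoE -(piu A mA).
  have [f cf fE] := embedding_adjoint_functional np oOmega bOmega omega1_cpt rhou.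
  exact: (solvable_dataP pOmega_solvable n2 hq cf fE).
have [C S_lip] := solution_operator_lipschitz omega1 pOmega_solvable n2 hq.
have [[[ub pib] /= cplb] minV] : exists x : X, forall x', V x <= V x'.
  apply: (attains_min (exist _ (u1, pi1) cpl1)) => x_.
  have [u [pi [kappa [eps [cpl kj ccost [eps0 ceps] H]]]]] :=
    coupling_compactness omega0_cpt omega1_cpt c_cont a_gt0 (fun k => proj2_sig (x_ k)).
  exists (exist _ (u, pi) cpl), kappa; split => //.
  apply: cvgD; last by apply: cvgMr.
  apply: (cvg_comp _ J); last exact: J_cont.
  pose K := @morrey_cst R d1 (conjugate q).
  (* The harmonic term makes [e j] positive, as [S_lip] requires, even where [eps j] vanishes. *)
  pose e (j : nat) : R := K * eps j + j.+1%:R^-1.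
  have e_gt0 j : 0 < e j.
    by rewrite ltr_wpDl ?invr_gt0 ?ltr0n// mulr_ge0// morrey_cst_ge0.
  have e_cvg : (fun j => C * e j) @ \oo --> 0.
    rewrite -(mulr0 C) -(addr0 0) -{1}(mulr0 K).
    apply: cvgMr; apply: cvgD; first exact: cvgMr.
    exact: cvg_harmonic.
  have S_le j : `|S (sval (x_ (kappa j))).1 - S u| <= C * e j.
    apply: S_lip => //; [exact: (data _ _ (proj2_sig (x_ (kappa j))))|exact: (data _ _ cpl)|].
    move=> v; rewrite /embedding_adjoint.
    have [cv _ _] := embeddingP np oOmega bOmega v.
    apply: (le_trans (H j (embedding v) (K * `|v|) _ cv _)).
    - by rewrite mulr_ge0// morrey_cst_ge0.
    - exact: embedding_hoelder.
    - by rewrite /e mulrAC ler_wpM2r// lerDl invr_ge0.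
  apply/cvgrPdist_lt => r r0; move/cvgrPdist_lt : e_cvg => /(_ _ r0).
  apply: filterS => j; rewrite sub0r normrN => /(le_lt_trans (ler_norm _)).
  by apply: le_lt_trans; rewrite distrC.
exists ub => u.
have Db : (D ub <= (cost pib)%:E)%E.
  by apply: ereal_inf_lbound; exists pib => //; exact: costE.
(* Minimality over pairs bounds the cost of every coupling of [u], hence their infimum [D u]; if
   there are none, [D u] is infinite. *)
have Du : (((J (S ub) + alpha * cost pib - J (S u)) / alpha)%:E <= D u)%E.
  apply/ereal_infP => _ [pi cpl <-].
  rewrite costE lee_fin ler_pdivrMr// lerBlDl [cost pi * _]mulrC.
  exact: (minV (exist _ (u, pi) cpl)).
apply: (@le_trans _ _ ((J (S ub))%:E + alpha%:E * (cost pib)%:E)%E).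
  by rewrite leeD2l// lee_pmul2l.
rewrite -leeBlDl//.
apply: le_trans (lee_wpmul2l _ Du); last by rewrite lee_fin ltW.
by rewrite -EFinM -EFinM -EFinD lee_fin [leRHS]mulrC divfK ?gt_eqF.
Qed.
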